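(* Let $\gamma\in(0,2)$ and let $M_\gamma$ be the Liouville measure on $\mathbb{R}^2$ associated with the massive Gaussian free field $X$ of mass $m>0$ defined on $(\Omega,\mathcal{A},P)$. Then, almost surely in $X$ (i.e. $P$-almost surely), the measure $M_\gamma$ belongs to $S_1$, i.e. $M_\gamma$ is smooth in the strict sense with respect to the planar Brownian motion.
   Context: **Dirichlet form.** Let $D(\mathcal{E})=\{f\in L^2(\mathbb{R}^2,dx) : \nabla f\in L^2(\mathbb{R}^2,dx)\}$ (weak gradient), $\mathcal{E}(f,g)=\frac12\int_{\mathbb{R}^2}\langle\nabla f,\nabla g\rangle\,dx$ for $f,g\in D(\mathcal{E})$, and $\mathcal{E}_1(f,g)=\mathcal{E}(f,g)+(f,g)_{L^2(\mathbb{R}^2,dx)}$. Let $((B_t)_{t\ge0},(\mathbb{P}_x)_{x\in\mathbb{R}^2})$ be the planar Brownian motion (the process associated with $(\mathcal{E},D(\mathcal{E}))$), with lifetime $\zeta$, and for Borel $A\subset\mathbb{R}^2$ let $\sigma_A=\inf\{t>0: B_t\in A\}$. $C_0(\mathbb{R}^2)$ denotes the compactly supported continuous functions on $\mathbb{R}^2$. **Classes of measures.** A positive Radon measure $\mu$ on $\mathbb{R}^2$ is of finite energy integral, written $\mu\in S_0$, if there is a constant $c$ such that $\int_{\mathbb{R}^2}|f|\,d\mu\le c\sqrt{\mathcal{E}_1(f,f)}$ for all $f\in D(\mathcal{E})\cap C_0(\mathbb{R}^2)$. Equivalently, there is a unique $U_1\mu\in D(\mathcal{E})$ (the $1$-potential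 of $\mu$) with $\mathcal{E}_1(U_1\mu,f)=\int_{\mathbb{R}^2} f\,d\mu$ for all $f\in D(\mathcal{E})\cap C_0(\mathbb{R}^2)$. Let $S_{00}=\{\mu\in S_0:\mu(\mathbb{R}^2)<\infty,\ \|U_1\mu\|_{L^\infty(\mathbb{R}^2,dx)}<\infty\}$. A positive Borel measure $\mu$ on $\mathbb{R}^2$ is smooth in the strict sense, written $\mu\in S_1$, if there is a sequence $(E_k)_{k\ge1}$ of Borel sets increasing to $\mathbb{R}^2$ such that $1_{E_k}\cdot\mu\in S_{00}$ for each $k$ and $\mathbb{P}_x(\lim_{k\to\infty}\sigma_{\mathbb{R}^2\setminus E_k}\ge\zeta)=1$ for all $x\in\mathbb{R}^2$. Here $1_E\cdot\mu$ is the measure $A\mapsto\mu(A\cap E)$. **Massive Gaussian free field and Liouville measure.** Fix $m>0$. Put $k_m(z)=\frac12\int_0^\infty e^{-\frac{m^2}{2s}|z|^2-\frac s2}\,ds$ for $z\in\mathbb{R}^2$. The massive Green function, i.e. the solution of $(m^2-\Delta)G^{(m)}(x,\cdot)=2\pi\delta_x$, is $G^{(m)}(x,y)=\int_1^\infty\frac{k_m(s(x-y))}{s}\,ds$. Let $(c_n)_{n\ge0}$ be an unbounded strictly increasing sequence with $c_0=1$, and let $(Y_n)_{n\ge1}$ be independent centered continuous Gaussian fields on $\mathbb{R}^2$, defined on a probability space $(\Omega,\mathcal{A},P)$, with covariance $E[Y_n(x)Y_n(y)]=\int_{c_{n-1}}^{c_n}\frac{k_m(s(x-y))}{s}\,ds$.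 The massive Gaussian free field is the random Gaussian distribution $X=\sum_{k\ge1}Y_k$ (centered, with covariance $G^{(m)}$). Set $X_n=\sum_{k=1}^nY_k$ and, for $\gamma\in(0,2)$, $M_{n,\gamma}(dz)=\exp\big(\gamma X_n(z)-\frac{\gamma^2}{2}E[X_n(z)^2]\big)\,dz$. $P$-almost surely, the measures $M_{n,\gamma}$ converge weakly as $n\to\infty$ (as Radon measures on $\mathbb{R}^2$, tested against $C_0(\mathbb{R}^2)$) to a Radon measure $M_\gamma$ on $\mathbb{R}^2$, called the Liouville measure. *)

(* Defs.v *)
From HB Require Import structures.
From mathcomp Require Import all_boot all_order all_algebra.
From mathcomp Require Import all_classical all_reals all_analysis.
Import Order.TTheory GRing.Theory Num.Theory.
Import numFieldNormedType.Exports.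

Set Implicit Arguments.
Unset Strict Implicit.
Unset Printing Implicit Defensive.

Local Open Scope classical_set_scope.
Local Open Scope ring_scope.

(** Two names for one underlying type: [plane R] carries the vector space and
    topological structures, [bplane R] the Borel sigma-algebra (as a product
    sigma-algebra), on which [lebesgue_measure] and its products are defined.
    The library norm of [plane R] is the sup norm, whence the explicit
    Euclidean expressions [dot] and [sqnorm]. *)
Notation plane R := (R * R)%type.
Notation bplane R := (measurableTypeR R * measurableTypeR R)%type.

Section Plane.
Context {R : realType}.

Definition leb2 : {measure set (bplane R) -> \bar R} :=
  (@lebesgue_measure R \x @lebesgue_measure R)%E.

Definition dot (u v : plane R) : R := u.1 * v.1 + u.2 * v.2.

Definition sqnorm (u : plane R) : R := dot u u.

Definition e1 : plane R := (1, 0).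
Definition e2 : plane R := (0, 1).

Definition compactly_supported (f : plane R -> R) :=
  compact (closure [set z | f z != 0]).

Definition C0 (f : plane R -> R) := continuous f /\ compactly_supported f.

Fixpoint Cdiff (k : nat) (f : plane R -> R) : Prop :=
  if k is k'.+1 then
    [/\ continuous f,
        (forall z, derivable f z e1) /\ Cdiff k' (fun z => 'D_e1 f z) &
        (forall z, derivable f z e2) /\ Cdiff k' (fun z => 'D_e2 f z)]
  else continuous f.

Definition test_function (f : plane R -> R) :=
  (forall k, Cdiff k f) /\ compactly_supported f.

Definition square_integrable (f : plane R -> R) := f \in Lfun leb2 2%:E.

(** [g] is a weak gradient of [f] with square-integrable components. *)
Definition weak_gradient (f : plane R -> R) (g : plane R -> plane R) :=
  [/\ square_integrable (fun z => (g z).1),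
      square_integrable (fun z => (g z).2) &
      forall phi, test_function phi ->
        (\int[leb2]_z (f z * 'D_e1 phi z) = - (\int[leb2]_z ((g z).1 * phi z)))
        /\
        (\int[leb2]_z (f z * 'D_e2 phi z) = - (\int[leb2]_z ((g z).2 * phi z)))].

(** The weak gradient is unique up to a.e. equality; [grad] chooses one. *)
Definition grad (f : plane R -> R) : plane R -> plane R :=
  xget (fun=> (0, 0)) [set g | weak_gradient f g].

Definition dirichlet_domain (f : plane R -> R) :=
  square_integrable f /\ exists g, weak_gradient f g.

Definition dirichlet (f g : plane R -> R) : R :=
  2^-1 * (\int[leb2]_z dot (grad f z) (grad g z)).

Definition dirichlet1 (f g : plane R -> R) : R :=
  dirichlet f g + (\int[leb2]_z (f z * g z)).

(** A locally finite Borel measure on the plane is automatically regular. *)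
Definition radon (mu : set (plane R) -> \bar R) :=
  forall K : set (plane R), compact K -> (mu K < +oo)%E.

Definition finite_energy (mu : {measure set (bplane R) -> \bar R}) :=
  radon mu /\
  exists c : R, forall f, dirichlet_domain f -> C0 f ->
    (\int[mu]_z `|f z|%:E <= (c * Num.sqrt (dirichlet1 f f))%:E)%E.

(** [u] is (a version of) the 1-potential of [mu]. *)
Definition one_potential (mu : {measure set (bplane R) -> \bar R})
    (u : plane R -> R) :=
  dirichlet_domain u /\
  forall f, dirichlet_domain f -> C0 f ->
    dirichlet1 u f = \int[mu]_z f z.

(** Since the 1-potential is unique up to a.e. equality, the existential
    quantifier on [u] bears on a single class of [L^2]. *)
Definition S00 (mu : {measure set (bplane R) -> \bar R}) :=
  [/\ finite_energy mu, (mu setT < +oo)%E &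
      exists2 u, one_potential mu u & ('N[leb2]_+oo[EFin \o u] < +oo)%E].

End Plane.

Section Independence.
Context d (T : measurableType d) (R : realType) (P : probability T R).

(** Mutual independence of a sequence of sigma-algebras; an arbitrary finite
    subfamily is reached by taking [A k := setT] for the other indices. *)
Definition independent (F : nat -> set (set T)) :=
  forall (n : nat) (A : nat -> set T),
    (forall k, (k < n)%N -> F k (A k)) ->
    (P (\bigcap_(k < n) A k) = \prod_(k < n) P (A k))%E.

(** The library's [normal_prob m 0] is not the Dirac mass at [m], so the
    degenerate case is separated. *)
Definition centered_gaussian (X : T -> R) :=
  measurable_fun setT X /\
  exists s : R, forall A : set R, measurable A ->
    P (X @^-1` A) = (if s == 0 then \d_(0 : R) A else normal_prob 0 s A).

End Independence.

Section BrownianMotion.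
Context {R : realType} {d : measure_display} {W : measurableType d}.

Definition increment (B : R -> W -> plane R) (t : nat -> R) (k : nat)
  (w : W) : plane R := B (t k.+1) w - B (t k) w.

(** Only the values [B t] with [0 <= t] are relevant. *)
Record planar_brownian_motion (PB : plane R -> probability W R)
    (B : R -> W -> plane R) : Prop := {
  bm_measurable : forall t, 0 <= t -> measurable_fun setT (B t : W -> bplane R) ;
  bm_start : forall x, {ae PB x, forall w, B 0 w = x} ;
  bm_continuous : forall x,
    {ae PB x, forall w, {within `[0, +oo[, continuous (fun t => B t w)}} ;
  bm_increments : forall x (t : nat -> R),
    0 <= t 0%N -> (forall k, t k < t k.+1) ->
    independent (PB x)
      (fun k => preimage_set_system setT (increment B t k)
        (@measurable _ (bplane R))) /\
    forall k (A : set (bplane R)), measurable A ->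
      let s := Num.sqrt (t k.+1 - t k) in
      PB x (increment B t k @^-1` A) =
        (normal_prob 0 s \x normal_prob 0 s)%E A }.

(** [inf set0 = +oo] in [\bar R]. *)
Definition hitting_time (B : R -> W -> plane R) (A : set (plane R)) (w : W)
  : \bar R := ereal_inf [set t%:E | t in [set t : R | 0 < t /\ A (B t w)]].

(** Planar Brownian motion is conservative: its paths, as defined above, stay
    in the plane at all times. *)
Definition lifetime (w : W) : \bar R := +oo%E.

(** An event of the form "the limit of hitting times is large" need not belong
    to the given sigma-algebra; "probability one" is meant in the completion. *)
Definition smooth_strict (PB : plane R -> probability W R)
    (B : R -> W -> plane R) (mu : {measure set (bplane R) -> \bar R}) :=
  exists (E : nat -> set (bplane R)) (mE : forall k, measurable (E k)),
    [/\ nondecreasing_seq E,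
        \bigcup_k E k = setT,
        forall k, S00 (mrestr mu (mE k)) &
        forall x, {ae PB x, forall w,
          (lifetime w <= limn (fun k => hitting_time B (~` E k) w))%E}].

End BrownianMotion.

Section Liouville.
Context {R : realType} {d : measure_display} {T : measurableType d}.
Context (P : probability T R).

Definition km (m : R) (z : plane R) : R :=
  2^-1 * \int[@lebesgue_measure R]_(s in `]0, +oo[)
    expR (- (m ^+ 2 / (2 * s) * sqnorm z) - s / 2).

Definition Ycov (m a b : R) (x y : plane R) : R :=
  \int[@lebesgue_measure R]_(s in `[a, b]) (km m (s *: (x - y)) / s).

(** The sigma-algebra generated by the variables [Z x]. *)
Definition field_sigma (Z : plane R -> T -> R) : set (set T) :=
  <<s [set A | exists x (U : set R), measurable U /\ A = Z x @^-1` U] >>.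

(** [Y k] is the field with index [k + 1] of the decomposition, attached to the
    interval [c k, c (k + 1)]. *)
Record massive_gff_fields (m : R) (c : nat -> R)
    (Y : nat -> plane R -> T -> R) : Prop := {
  Y_gaussian : forall k n (z : 'I_n -> plane R) (a : 'I_n -> R),
    centered_gaussian P (fun w => \sum_(i < n) a i * Y k (z i) w) ;
  Y_continuous : forall k, {ae P, forall w, continuous (fun z => Y k z w)} ;
  Y_independent : independent P (fun k => field_sigma (Y k)) ;
  Y_covariance : forall k x y,
    'E_P[fun w => (Y k x w * Y k y w)%R]%E = (Ycov m (c k) (c k.+1) x y)%:E }.

Definition partial_field (Y : nat -> plane R -> T -> R) (n : nat)
  (z : plane R) (w : T) : R := \sum_(k < n) Y k z w.

Definition liouville_approx (gamma : R) (Y : nat -> plane R -> T -> R)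
    (n : nat) (w : T) (A : set (bplane R)) : \bar R :=
  (\int[leb2]_(z in A)
    (expR (gamma * partial_field Y n z w -
       gamma ^+ 2 / 2 * fine 'E_P[fun w' => (partial_field Y n z w' ^+ 2)%R]%E))%:E)%E.

Definition liouville_measure (gamma : R) (Y : nat -> plane R -> T -> R)
    (M : T -> {measure set (bplane R) -> \bar R}) :=
  {ae P, forall w,
    radon (M w) /\
    forall f, C0 f ->
      (\int[liouville_approx gamma Y n w]_z (f z)%:E)%E @[n --> \oo] -->
        (\int[M w]_z (f z)%:E)%E}.

End Liouville.

(* Main.v *)
(* Brownian paths are continuous, hence leave the boxes [-k, k]^2 at times tending to
   infinity, so it is enough that the restriction of the Liouville measure to each box
   is in S_00. This follows from a growth bound mu(B(x, r)) <= C r^al with al > 0: the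
   Gaussian estimate int p_t(x - y) mu(dy) <= C t^(-1 + al/4) makes the 1-potential
   U = int_0^oo e^-t p_t * mu dt bounded, with a square-integrable weak gradient, and
   f(y) = E_1(g(., y), f), where g is the 1-resolvent kernel, integrates in mu(dy) to
   E_1(U, f) = int f dmu.

   For the growth bound, fix a square S of side r and x in S, and let Z be the average
   of the cut-off field X_n over points at distance at most rho from x, where
   L = log(1/rho). The covariance of X_n is log(1/|x - y|) up to bounded terms, so for y
   at distance about rho the Gaussian tilt by exp(gamma (X_n(x) + X_n(y) - Z)) costs only
   a bounded factor, while exp(gamma X_n(x)) shifts gamma Z by about gamma^2 L. Since
   gamma^2 < 2 + gamma^2/2, the annulus of radius rho around a point chosen according to
   the chaos measure has mass above rho^eta with probability O(rho^(2 eta)), and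
   Markov's inequality gives P(M_n(S) > Lam r^eta) <= C r^(2 + eta). Fatou's lemma and
   Borel-Cantelli over the dyadic squares of a box pass to the limit measure. *)
Require Import Defs.
From HB Require Import structures.
From mathcomp Require Import all_boot all_order all_algebra.
From mathcomp Require Import all_classical all_reals all_analysis.
From mathcomp Require Import measurable_realfun.
From mathcomp Require Import ring lra.
Import Order.TTheory GRing.Theory Num.Theory.
Import numFieldNormedType.Exports.

Set Implicit Arguments.
Unset Strict Implicit.
Unset Printing Implicit Defensive.

Local Open Scope classical_set_scope.
Local Open Scope ring_scope.

(** * Measurability and integration on the plane *)

(** For [gamma ^+ 2 >= 2] the second moments of the cut-off masses are unbounded in n, so
    Chebyshev's inequality cannot give the tail of the mass of a square. The probabilistic input is
    instead the exponential moment of finite combinations of field values, which the covariance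
    determines; this is why Z averages over finitely many points.

    The margin is t = 2 - gamma^2/2, and eta = t^2/32 is small enough for each scale to contribute
    rho^(2 eta). One factor rho^eta is spent in Markov's inequality, the other survives the r^-2
    squares of side r in Borel-Cantelli.

    On the analytic side, mu may be singular, so E_1(U, f) = int f dmu involves the values of f on a
    Lebesgue-null set. Hence f(y) is recovered pointwise from the heat kernel, at every y where the
    resolvent integral converges absolutely. The finiteness of the mu-integral of that absolute
    integral shows that mu-almost every y is of this kind. *)

Section PlaneMeasurability.
Context {R : realType}.

Definition dfloor (n : nat) (x : R) : R :=
  (Num.floor (n.+1%:R * x))%:~R / n.+1%:R.

Lemma dfloor_dist n x : 0 <= x - dfloor n x <= n.+1%:R^-1.
Proof.
have n0 : 0 < n.+1%:R :> R by [].
have /andP[h1 h2] := floor_itv (n.+1%:R * x).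
rewrite /dfloor subr_ge0 ler_pdivrMr// [x * _]mulrC h1/= lerBlDr.
rewrite -[X in _ <= X + _]mul1r -mulrDl ler_pdivlMr// mulrC (le_trans (ltW h2))//.
by rewrite intrD addrC.
Qed.

Lemma cvg_dfloor x : (dfloor n x) @[n --> \oo] --> x.
Proof.
apply/cvgrPdist_le => e e0; near=> n.
have /andP[h1 h2] := dfloor_dist n x.
rewrite ger0_norm// (le_trans h2)//.
near: n; exists (Num.truncn e^-1) => //= k /= hk.
rewrite -[leRHS]invrK lef_pV2 ?posrE ?invr_gt0//.
rewrite (le_trans (ltW (truncnS_gt _)))//.
by rewrite ler_nat ltnS.
Unshelve. all: by end_near. Qed.

Lemma measurable_dfloor_fiber n (i : int) :
  measurable [set x : R | Num.floor (n.+1%:R * x) = i].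
Proof.
rewrite (_ : [set _ | _] = (fun x => n.+1%:R * x) @^-1` `[i%:~R, (i + 1)%:~R[).
  rewrite -[X in measurable X]setTI.
  by apply: (@measurable_funM _ _ R setT (cst n.+1%:R) id) => //; exact: measurable_itv.
apply/seteqP; split => x /=.
  by rewrite in_itv/= => <-; exact: floor_itv.
by rewrite in_itv/= => h; apply/floor_def.
Qed.

Lemma cvg_plane {T} {F : set_system T} {FF : Filter F} (f g : T -> R) (a b : R) :
  f @ F --> a -> g @ F --> b -> (fun t => (f t, g t)) @ F --> ((a, b) : plane R).
Proof.
move=> fa gb; apply: (@cvg_pair _ _ _ F (nbhs a) (nbhs b) FF _ _ f g) => //.
Qed.

(** Freezing [z] at the lower corner of its grid cell of mesh [n.+1%:R^-1] gives a function whose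
    preimages are countable unions of rectangles. Continuity in [z] makes [F] the pointwise limit of
    these functions. *)
Lemma measurable_caratheodory d (T : measurableType d) (F : plane R -> T -> R) :
  (forall z, measurable_fun setT (F z)) ->
  (forall w, continuous (fun z => F z w)) ->
  measurable_fun setT (fun zw : bplane R * T => F zw.1 zw.2).
Proof.
move=> mF cF.
pose G n (zw : bplane R * T) := F (dfloor n zw.1.1, dfloor n zw.1.2) zw.2.
apply: (@measurable_fun_cvg _ _ _ _ G) => [n|[z w] _]; last first.
  rewrite /G/=.
  apply: (@cvg_comp _ (plane R) _
    (fun n => (dfloor n z.1, dfloor n z.2)) (fun z => F z w)
    _ (nbhs (z : plane R))); last exact: cF.
  by case: z => x y; apply: cvg_plane; exact: cvg_dfloor.
move=> _ A mA; rewrite setTI.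
pose f n (x : R) := Num.floor (n.+1%:R * x).
rewrite (_ : _ @^-1` _ = \bigcup_(ij : int * int)
    (([set x : R | f n x = ij.1] `*` [set x : R | f n x = ij.2]) `*`
     ((F (ij.1%:~R / n.+1%:R, ij.2%:~R / n.+1%:R)) @^-1` A))).
  apply: countable_bigcupT_measurable => // -[i j].
  apply: measurableX.
    by apply: measurableX; exact: measurable_dfloor_fiber.
  by rewrite -[X in measurable X]setTI; exact: mF.
apply/seteqP; split => -[[x y] w].
  by rewrite /G /= => h; exists (f n x, f n y) => //.
by move=> [[i j] _ /= [[<- <-]]]; rewrite /G.
Qed.

Lemma continuous_plane_measurable (f : plane R -> R) :
  continuous f -> measurable_fun setT (f : bplane R -> R).
Proof.
move=> cf.
have := @measurable_caratheodory _ unit (fun z _ => f z) (fun _ => measurable_cst _)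
  (fun _ => cf).
by move/(measurable_fun_pair1 tt).
Qed.

(** An open set is the union of the countably many grid cells that it contains, because the cells
    around a point shrink to it. *)
Lemma open_plane_measurable (U : set (plane R)) :
  open U -> measurable (U : set (bplane R)).
Proof.
move=> oU.
pose cell (nij : nat * (int * int)) : set (bplane R) :=
  [set x : R | Num.floor (nij.1.+1%:R * x) = nij.2.1] `*`
  [set x : R | Num.floor (nij.1.+1%:R * x) = nij.2.2].
rewrite (_ : U = \bigcup_(nij in [set nij | cell nij `<=` U]) cell nij).
  rewrite bigcup_mkcond; apply: countable_bigcupT_measurable => // nij.
  case: ifP => // _.
  by apply: measurableX; exact: measurable_dfloor_fiber.
apply/seteqP; split => [z Uz|z [nij /= h] /h//].
have [e /= e0 zeU] : exists2 e : R, 0 < e & ball z e `<=` U.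
  by apply/nbhs_ballP; exact: open_nbhs_nbhs.
pose n := Num.truncn e^-1.
have ne : n.+1%:R^-1 < e.
  by rewrite -[ltRHS]invrK ltf_pV2 ?posrE ?invr_gt0// truncnS_gt.
exists (n, (Num.floor (n.+1%:R * z.1), Num.floor (n.+1%:R * z.2))) => //=.
move=> [x y] [/= hx hy]; apply: zeU.
have aux (s t : R) : Num.floor (n.+1%:R * t) = Num.floor (n.+1%:R * s) ->
    `|s - t| < e.
  move=> st; have := dfloor_dist n s; have := dfloor_dist n t.
  rewrite /dfloor st => hs ht; rewrite (le_lt_trans _ ne)//.
  move: hs ht; set N := n.+1%:R^-1; set f := _ * N.
  by move=> /andP[? ?] /andP[? ?]; rewrite ler_norml; apply/andP; split; lra.
by split; rewrite /ball/=; apply: aux.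
Qed.

Lemma compact_plane_measurable (K : set (plane R)) :
  compact K -> measurable (K : set (bplane R)).
Proof.
move=> cK; rewrite -[K]setCK; apply: measurableC; apply: open_plane_measurable.
by apply/closed_openC; apply: compact_closed => //; exact: norm_hausdorff.
Qed.

End PlaneMeasurability.

(** * Integrability criteria and Fubini's theorem for real-valued integrals *)

Section IntegralTools.
Context d (T : measurableType d) (R : realType).
Variable mu : {measure set T -> \bar R}.

(** The square integrals enter through real upper bounds, the form in which kernel estimates provide
    them. *)
Lemma cauchy_schwarz_integral (f g : T -> R) (a b : R) :
  measurable_fun setT f -> measurable_fun setT g ->
  0 <= a -> 0 <= b ->
  (\int[mu]_x (f x ^+ 2)%:E <= a%:E)%E ->
  (\int[mu]_x (g x ^+ 2)%:E <= b%:E)%E ->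
  (\int[mu]_x `|f x * g x|%:E <= (Num.sqrt a * Num.sqrt b)%:E)%E.
Proof.
move=> mf mg a0 b0 fa gb.
have := @hoelder _ _ R mu f g 2 2 mf mg ltac:(by []) ltac:(by []).
have h2 : (2^-1 + 2^-1 = 1 :> R) by lra.
move/(_ h2); rewrite Lnorm1 => /le_trans; apply.
have key (h : T -> R) (c : R) : 0 <= c -> (\int[mu]_x (h x ^+ 2)%:E <= c%:E)%E ->
    ('N[mu]_2%:E [EFin \o h] <= (Num.sqrt c)%:E)%E.
  move=> c0 hc.
  rewrite unlock /Lnorm /= -powR12_sqrt// -poweR_EFin.
  apply: gt0_ler_poweR; rewrite ?inE/= ?subitvE ?bnd_simp ?in_itv/= ?leey ?andbT ?lee_fin//.
    by apply: integral_ge0 => x _; rewrite lee_fin powR_ge0.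
  apply: le_trans hc; rewrite le_eqVlt; apply/orP; left; apply/eqP.
  by apply: eq_integral => x _; rewrite powR_mulrn// real_normK// num_real.
rewrite EFinM; apply: lee_pmul; rewrite ?Lnorm_ge0//; exact: key.
Qed.

Lemma square_integrableP (f : T -> R) :
  f \in Lfun mu 2%:E <->
  measurable_fun setT f /\ (\int[mu]_x (f x ^+ 2)%:E < +oo)%E.
Proof.
have e : (\int[mu]_x (f x ^+ 2)%:E = 'N[mu]_2%:E[EFin \o f] `^ 2)%E.
  rewrite powR_Lnorm//; apply: eq_integral => x _ /=.
  by rewrite powR_mulrn// real_normK// num_real.
split.
  move=> /andP[]; rewrite !inE /= => mf fin; split => //.
  by rewrite e poweR_lty.
move=> [mf fin]; apply/andP; split; rewrite inE//=.
rewrite /finite_norm; move: fin; rewrite e.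
have := Lnorm_ge0 mu 2%:E (EFin \o f).
by case: ('N[mu]_2%:E[_])%E => [r|//|//] _; rewrite ?ltry// poweRyr.
Qed.

Lemma integrable_EFinP (f : T -> R) : measurable_fun setT f ->
  (\int[mu]_x `|f x|%:E < +oo)%E -> mu.-integrable setT (EFin \o f).
Proof. by move=> mf fin; apply/integrableP; split => //; exact/measurable_EFinP. Qed.

Lemma Rintegral_fine (f : T -> R) : mu.-integrable setT (EFin \o f) ->
  ((\int[mu]_x f x)%:E = \int[mu]_x (f x)%:E)%E.
Proof. by move=> fi; rewrite fineK//; exact: integrable_fin_num. Qed.

End IntegralTools.

Section RealFubini.
Context d1 d2 (T1 : measurableType d1) (T2 : measurableType d2) (R : realType).
Variable m1 : {sigma_finite_measure set T1 -> \bar R}.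
Variable m2 : {sigma_finite_measure set T2 -> \bar R}.
Variable f : T1 -> T2 -> R.
Hypothesis mf : measurable_fun setT (fun z : T1 * T2 => f z.1 z.2).
Hypothesis fi : (\int[m1]_x \int[m2]_y `|f x y|%:E < +oo)%E.

Let g (z : T1 * T2) := (f z.1 z.2)%:E.

Let gi : (m1 \x m2)%E.-integrable setT g.
Proof. by apply/integrable12ltyP => //; exact/measurable_EFinP. Qed.

Lemma ae_section_integrable :
  {ae m1, forall x, m2.-integrable setT (EFin \o f x)}.
Proof. exact: ae_integrable1 gi. Qed.

Lemma iterated_abs_swap : (\int[m2]_y \int[m1]_x `|f x y|%:E < +oo)%E.
Proof. by apply/(integrable21ltyP m1 m2 (f := g)) => //; exact/measurable_EFinP. Qed.

Lemma measurable_Rsection : measurable_fun setT (fun x => \int[m2]_y f x y).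
Proof.
apply: (@measurableT_comp _ _ _ _ _ _ (@fine R) _ (fun x => \int[m2]_y (f x y)%:E)%E).
  exact: fine_measurable.
exact: (measurable_fubini_F gi).
Qed.

Let aeq : {ae m1, forall x, setT x ->
  (fun x => (\int[m2]_y f x y)%:E) x = (fun x => \int[m2]_y (f x y)%:E)%E x}.
Proof.
apply: filterS ae_section_integrable => x xi _.
by rewrite /Rintegral fineK//; exact: integrable_fin_num.
Qed.

(** A real integral is 0 where the extended one is infinite, so it is dominated by the latter; the
    two agree off the null set of non-integrable sections. *)
Lemma Rsection_integrable :
  m1.-integrable setT (fun x => (\int[m2]_y f x y)%:E).
Proof.
apply: (le_integrable _ _ _ (integrable_fubini_F gi)) => //.
  by apply/measurable_EFinP; exact: measurable_Rsection.
move=> x _; rewrite /Rintegral /fubini_F/=.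
by case: (integral _ _ _) => [r| |] /=; rewrite ?abse0 ?leey ?le0y.
Qed.

Lemma Rintegral_fubini1 :
  (\int[m1]_x (\int[m2]_y f x y)%:E = \int[m1 \x m2]_z g z)%E.
Proof.
rewrite -(integral12_prod_meas1 gi); apply: ae_eq_integral => //.
  by apply/measurable_EFinP; exact: measurable_Rsection.
exact: (measurable_fubini_F gi).
Qed.

End RealFubini.

Section RealFubiniSwap.
Context d1 d2 (T1 : measurableType d1) (T2 : measurableType d2) (R : realType).
Variable m1 : {sigma_finite_measure set T1 -> \bar R}.
Variable m2 : {sigma_finite_measure set T2 -> \bar R}.
Variable f : T1 -> T2 -> R.
Hypothesis mf : measurable_fun setT (fun z : T1 * T2 => f z.1 z.2).
Hypothesis fi : (\int[m1]_x \int[m2]_y `|f x y|%:E < +oo)%E.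

Lemma Rintegral_fubini :
  \int[m1]_x (\int[m2]_y f x y) = \int[m2]_y (\int[m1]_x f x y).
Proof.
congr fine; rewrite Rintegral_fubini1//.
have mf' : measurable_fun setT (fun z : T2 * T1 => f z.2 z.1).
  exact: (measurableT_comp mf (@measurable_swap _ _ _ _)).
have gi : (m1 \x m2)%E.-integrable setT (fun z : T1 * T2 => (f z.1 z.2)%:E).
  by apply/integrable12ltyP => //; exact/measurable_EFinP.
have fi' := iterated_abs_swap mf fi.
rewrite -(integral21_prod_meas1 gi).
apply: ae_eq_integral => //.
- exact: (measurable_fubini_G gi).
- apply/measurable_EFinP.
  exact: (@measurable_Rsection _ _ _ _ _ m2 m1 (fun y x => f x y)).
apply: filterS (@ae_section_integrable _ _ _ _ _ m2 m1 (fun y x => f x y) mf' fi') => y yi _.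
by rewrite /Rintegral fineK//; exact: integrable_fin_num.
Qed.

End RealFubiniSwap.

Section AsSigmaFinite.
Context d (T : measurableType d) (R : realType) (mu : {measure set T -> \bar R}).

(* A copy of [mu] on which the hypothesis can be registered as a canonical structure. *)
Definition sigma_finite_copy of sigma_finite setT mu : set T -> \bar R := mu.

Section Copy.
Hypothesis h : sigma_finite setT mu.
Local Notation cp := (sigma_finite_copy h).
HB.instance Definition _ := isMeasure.Build _ _ _ cp
  (measure0 mu) (measure_ge0 mu) (@measure_semi_sigma_additive _ _ _ mu).
HB.instance Definition _ := Measure_isSigmaFinite.Build _ _ _ cp h.
End Copy.

(** Turns sigma-finiteness known as a proposition into a property of the type of the measure. It
    serves for measures whose type is that of a bare measure, such as [leb2]. *)
Lemma as_sigma_finite : sigma_finite setT mu ->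
  exists nu : {sigma_finite_measure set T -> \bar R}, mu = nu.
Proof. by move=> h; exists (sigma_finite_copy h); exact: eq_measure. Qed.

End AsSigmaFinite.

Section FubiniSigmaFinite.
Context d1 d2 (T1 : measurableType d1) (T2 : measurableType d2) (R : realType).
Variables (m1 : {measure set T1 -> \bar R}) (m2 : {measure set T2 -> \bar R}).
Hypotheses (s1 : sigma_finite setT m1) (s2 : sigma_finite setT m2).

Lemma sf_tonelli (f : T1 * T2 -> \bar R) : measurable_fun setT f ->
  (forall z, 0 <= f z)%E ->
  (\int[m1]_x \int[m2]_y f (x, y) = \int[m2]_y \int[m1]_x f (x, y))%E.
Proof.
have [n1 ->] := as_sigma_finite s1; have [n2 ->] := as_sigma_finite s2.
by move=> *; exact: fubini_tonelli.
Qed.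

Lemma sf_measurable_tonelli (f : T1 * T2 -> \bar R) : measurable_fun setT f ->
  (forall z, 0 <= f z)%E -> measurable_fun setT (fun x => (\int[m2]_y f (x, y))%E).
Proof.
have [n2 ->] := as_sigma_finite s2.
by move=> *; exact: measurable_fun_fubini_tonelli_F.
Qed.

Variable f : T1 -> T2 -> R.
Hypothesis mf : measurable_fun setT (fun z : T1 * T2 => f z.1 z.2).
Hypothesis fi : (\int[m1]_x \int[m2]_y `|f x y|%:E < +oo)%E.

Lemma sf_ae_section_integrable :
  {ae m1, forall x, m2.-integrable setT (EFin \o f x)}.
Proof.
have [n1 e1] := as_sigma_finite s1; have [n2 e2] := as_sigma_finite s2.
move: fi; rewrite e1 e2 => fi'; exact: ae_section_integrable.
Qed.

Lemma sf_measurable_Rsection : measurable_fun setT (fun x => \int[m2]_y f x y).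
Proof.
have [n1 e1] := as_sigma_finite s1; have [n2 e2] := as_sigma_finite s2.
move: fi; rewrite e1 e2 => fi'; exact: measurable_Rsection fi'.
Qed.

Lemma sf_Rsection_integrable :
  m1.-integrable setT (fun x => (\int[m2]_y f x y)%:E).
Proof.
have [n1 e1] := as_sigma_finite s1; have [n2 e2] := as_sigma_finite s2.
move: fi; rewrite e1 e2 => fi'; exact: Rsection_integrable.
Qed.

Lemma sf_iterated_abs_swap : (\int[m2]_y \int[m1]_x `|f x y|%:E < +oo)%E.
Proof.
have [n1 e1] := as_sigma_finite s1; have [n2 e2] := as_sigma_finite s2.
move: fi; rewrite e1 e2 => fi'; exact: iterated_abs_swap.
Qed.

Lemma sf_Rintegral_fubini :
  \int[m1]_x (\int[m2]_y f x y) = \int[m2]_y (\int[m1]_x f x y).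
Proof.
have [n1 e1] := as_sigma_finite s1; have [n2 e2] := as_sigma_finite s2.
move: fi; rewrite e1 e2 => fi'; exact: Rintegral_fubini.
Qed.

End FubiniSigmaFinite.

(** * Smooth functions *)

Section Smooth.
Context {R : realType}.
Implicit Types (f g : R -> R) (k : nat).

(** The derivative is a witness of [is_derive] rather than a value of ['D], so that the closure
    properties go by plain induction on [k]. *)
Fixpoint smoothk k f : Prop :=
  if k is k'.+1 then
    exists2 f', (forall x : R, is_derive x 1 f (f' x)) & smoothk k' f'
  else continuous f.

Definition smooth f := forall k, smoothk k f.

Lemma is_derive1_continuous f (f' : R -> R) :
  (forall x : R, is_derive x 1 f (f' x)) -> continuous f.
Proof.
move=> df x; apply/differentiable_continuous/derivable1_diffP.
exact: (@ex_derive _ _ _ _ _ _ _ (df x)).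
Qed.

Lemma smoothkS k f : smoothk k.+1 f -> smoothk k f.
Proof.
elim: k f => [|k ih] f; first by move=> [f' df _]; exact: is_derive1_continuous df.
by move=> [f' df sf']; exists f' => //; exact: ih.
Qed.

Lemma smoothk_ext k f g : f =1 g -> smoothk k f -> smoothk k g.
Proof. by move=> /funext ->. Qed.

Lemma smoothk_cst k c : smoothk k (fun=> c).
Proof.
elim: k c => [|k ih] c /=; first exact: cst_continuous.
by exists (fun=> 0); [move=> x; exact: is_derive_cst|exact: ih].
Qed.

Lemma smoothk_id k : smoothk k id.
Proof.
case: k => [|k] /=; first by move=> x; exact: cvg_id.
by exists (fun=> 1); [move=> x; exact: is_derive_id|exact: smoothk_cst].
Qed.

Lemma smoothkD k f g : smoothk k f -> smoothk k g ->
  smoothk k (fun x => f x + g x).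
Proof.
elim: k f g => [|k ih] f g /=; first by move=> cf cg x; apply: cvgD; [exact: cf|exact: cg].
move=> [f' df sf] [g' dg sg]; exists (fun x => f' x + g' x); last exact: ih.
by move=> x; exact: is_deriveD.
Qed.

Lemma smoothkM k f g : smoothk k f -> smoothk k g ->
  smoothk k (fun x => f x * g x).
Proof.
elim: k f g => [|k ih] f g; first by move=> cf cg x; apply: cvgM; [exact: cf|exact: cg].
move=> sf sg; have [sf0 sg0] := (smoothkS sf, smoothkS sg).
case: sf sg => f' df sf [g' dg sg].
exists (fun x => f x * g' x + g x * f' x); last by apply: smoothkD; exact: ih.
by move=> x; apply: is_deriveM.
Qed.

Lemma smoothkZ k c f : smoothk k f -> smoothk k (fun x => c * f x).
Proof. by move=> sf; apply: smoothkM => //; exact: smoothk_cst. Qed.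

Lemma smoothk_affine k f a b : smoothk k f -> smoothk k (fun x => f (a * x + b)).
Proof.
elim: k f => [|k ih] f /=.
  move=> cf x; apply: (continuous_comp (f := fun x => a * x + b)); last exact: cf.
  by apply: cvgD; [apply: cvgM; [exact: cvg_cst|exact: cvg_id]|exact: cvg_cst].
move=> [f' df sf]; exists (fun x => a * f' (a * x + b)); last exact: (smoothkZ a (ih _ sf)).
move=> x; rewrite mulrC.
have h : is_derive x 1 (fun x => a * x + b) a.
  by apply: is_derive_eq; rewrite /GRing.scale/=; ring.
exact: (is_derive1_comp (f := f) (g := fun x => a * x + b) (df _) h).
Qed.

Lemma smoothkX k f n : smoothk k f -> smoothk k (fun x => f x ^+ n).
Proof.
move=> sf; elim: n => [|n ih].
  by apply: (smoothk_ext _ (smoothk_cst k 1)) => x; rewrite expr0.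
by apply: (smoothk_ext _ (smoothkM sf ih)) => x; rewrite exprS.
Qed.

Lemma smoothk_expR k g : smooth g -> smoothk k (fun x => expR (g x)).
Proof.
move=> sg; elim: k => [|k ih].
  move=> x; apply: (continuous_comp (f := g)); first exact: (sg 0%N).
  exact: continuous_expR.
have [g' dg sg'] := sg k.+1.
exists (fun x => expR (g x) * g' x); last exact: smoothkM.
by move=> x; exact: (is_derive1_comp (f := expR) (g := g) (is_derive_expR _) (dg x)).
Qed.

(* The family is closed under differentiation up to linear combinations. *)
Definition flat n (x : R) : R := if 0 < x then x ^- n * expR (- x^-1) else 0.

Lemma flat_ge0 n x : 0 <= flat n x.
Proof.
by rewrite /flat; case: ifP => // x0; rewrite mulr_ge0// ?expR_ge0// invr_ge0 exprn_ge0// ltW.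
Qed.

(** With N = n + 1, [expR x^-1] is the N-th power of [expR (N * x)^-1], and the latter is at least
    [(N * x)^-1]. The linear rate gives both the limit at 0 and, one index higher, the derivative
    there. *)
Lemma flat_le n x : flat n x <= n.+1%:R ^+ n.+1 * `|x|.
Proof.
rewrite /flat; case: ifPn => [x0|_]; last by rewrite mulr_ge0// exprn_ge0.
rewrite gtr0_norm// ler_pdivrMl ?exprn_gt0// mulrCA -exprSr.
rewrite expRN -[leLHS]div1r ler_pdivrMr ?expR_gt0// -exprMn.
have n0 : 0 < n.+1%:R :> R by [].
have -> : expR x^-1 = expR ((n.+1%:R * x)^-1) ^+ n.+1.
  by rewrite -expRM_natl invfM mulrA divff ?mul1r// gt_eqF.
rewrite -exprMn exprn_ege1//.
have nx0 : 0 < n.+1%:R * x by rewrite mulr_gt0.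
rewrite -ler_pdivrMl// mulr1 (le_trans _ (expR_ge1Dx _))//.
by rewrite lerDr.
Qed.

Lemma flat_cvg0 n : flat n x @[x --> 0] --> 0.
Proof.
apply/cvgrPdist_le => e e0; near=> x.
rewrite sub0r normrN ger0_norm ?flat_ge0// (le_trans (flat_le _ _))//.
rewrite -ler_pdivlMl ?exprn_gt0//.
near: x; apply/(@nbhs0_le _ R); rewrite mulr_gt0// invr_gt0 exprn_gt0//.
Unshelve. all: by end_near. Qed.

Lemma is_derive_flat n (x : R) :
  is_derive x 1 (flat n) (flat n.+2 x - n%:R * flat n.+1 x).
Proof.
have [x0|x0|->] := ltgtP x 0.
- rewrite /flat !ltNge !(ltW x0)/= mulr0 subr0.
  apply: (near_eq_is_derive _ (is_derive_cst 0 x 1)).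
  by near=> y; rewrite ltNge ltW//=; near: y; exact: lt_nbhsl.
- have xn0 : x != 0 by rewrite gt_eqF.
  have h1 : is_derive x 1 (fun y : R => y^-1) (- x ^- 2).
    by have := @is_deriveV R id x 1 1 xn0 (is_derive_id _ _); rewrite [_ *: _]mulr1.
  have := is_deriveX n h1; rewrite exprfctE => h2.
  have h3 : is_derive x 1 (fun y => expR (- y^-1)) (expR (- x^-1) * x ^- 2).
    have := @is_derive1_comp R expR (fun y => - y^-1) x _ _ (is_derive_expR _) (is_deriveN h1).
    by rewrite opprK.
  have h4 : is_derive x 1 (fun y => y^-1 ^+ n * expR (- y^-1))
      (flat n.+2 x - n%:R * flat n.+1 x).
    have := is_deriveM h2 h3; rewrite /GRing.scale/=.
    move/is_derive_eq; apply; rewrite /flat x0 -!exprVn.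
    case: n {h2} => [|n]; first by rewrite !mul0r !expr0; ring.
    by rewrite /= !exprS; ring.
  apply: (near_eq_is_derive _ h4).
  by near=> y; rewrite /flat ifT ?exprVn//; near: y; exact: lt_nbhsr.
(* At 0 the difference quotient of [flat n] is [flat n.+1], which tends to 0. *)
- rewrite /flat ltxx mulr0 subr0 -/(flat n).
  have H : h^-1 *: ((flat n \o shift 0) (h *: 1) - flat n 0) @[h --> 0^'] --> 0.
    rewrite [X in X @ _ --> _](_ : _ = flat n.+1); last first.
      apply/funext => h; rewrite /= addr0 [_ *: 1]mulr1 /flat ltxx subr0.
      rewrite /GRing.scale/=; case: ifP => _; last by rewrite mulr0.
      by rewrite mulrA exprSr invfM [h^-1 * _]mulrC.
    exact: cvg_within_filter (@flat_cvg0 n.+1).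
  by apply: DeriveDef; [exact: cvgP H|exact: cvg_lim H].
Unshelve. all: by end_near. Qed.

Lemma smooth_flat n : smooth (flat n).
Proof.
move=> k; elim: k n => [|k ih] n.
  exact: is_derive1_continuous (@is_derive_flat n).
exists (fun x => flat n.+2 x - n%:R * flat n.+1 x); first exact: is_derive_flat.
apply: (smoothk_ext _ (smoothkD (ih n.+2) (smoothkZ (- n%:R) (ih n.+1)))) => x.
by rewrite mulNr.
Qed.

Lemma flat_gt0 n x : (0 < flat n x) = (0 < x).
Proof.
rewrite /flat; case: ifP => [x0|]; last by rewrite ltxx.
by rewrite mulr_gt0 ?expR_gt0// invr_gt0 exprn_gt0.
Qed.

Lemma flat0_le1 x : flat 0 x <= 1.
Proof.
rewrite /flat; case: ifPn => // x0; rewrite expr0 invr1 mul1r expR_le1.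
by rewrite oppr_le0 invr_ge0 ltW.
Qed.

Definition bump (a b x : R) := flat 0 (x - a) * flat 0 (b - x).

Lemma smooth_bump a b : smooth (bump a b).
Proof.
move=> k; apply: smoothkM.
  by apply: (smoothk_ext _ (smoothk_affine 1 (- a) (smooth_flat 0 k))) => x; rewrite mul1r.
by apply: (smoothk_ext _ (smoothk_affine (-1) b (smooth_flat 0 k))) => x; rewrite mulN1r addrC.
Qed.

Lemma bump_ge0 a b x : 0 <= bump a b x.
Proof. by rewrite mulr_ge0// flat_ge0. Qed.

Lemma bump_le1 a b x : bump a b x <= 1.
Proof. by rewrite mulr_ile1// ?flat_ge0// flat0_le1. Qed.

Lemma bump_gt0 a b x : (0 < bump a b x) = (a < x < b).
Proof.
have [/andP[ax xb]|] := boolP (a < x < b).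
  by rewrite mulr_gt0// flat_gt0 subr_gt0.
rewrite negb_and -!leNgt => /orP[h|h]; apply/negbTE; rewrite -leNgt /bump.
  by rewrite {1}/flat ifF ?mul0r//; apply/negbTE; rewrite -leNgt subr_le0.
by rewrite mulrC {1}/flat ifF ?mul0r//; apply/negbTE; rewrite -leNgt subr_le0.
Qed.

End Smooth.

(** * Test functions on the plane, built as tensor products supported in boxes *)

Section TestFunctions.
Context {R : realType}.
Notation leb := (@lebesgue_measure R).

Definition box (r : R) : set (plane R) := `[- r, r] `*` `[- r, r].

Lemma compact_box r : compact (box r).
Proof. by apply: compact_setX; exact: segment_compact. Qed.

Lemma measurable_box r : measurable (box r : set (bplane R)).
Proof. by apply: measurableX. Qed.

Lemma leb_itvcc (a b : R) : a <= b -> leb (`[a, b]%classic : set R) = (b - a)%:E.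
Proof.
move=> ab; rewrite lebesgue_measure_itv/= lte_fin; case: ltP => // ba.
by rewrite (_ : a = b) ?subrr//; apply/eqP; rewrite eq_le ab.
Qed.

Lemma leb2_box r : (leb2 (box r : set (bplane R)) < +oo)%E.
Proof.
rewrite [ltLHS](product_measure1E leb leb)//.
have [rr|rr] := leP (- r) r; last by rewrite set_itv_ge ?measure0 ?mul0e// bnd_simp -ltNge.
by have := ltry ((r - - r) * (r - - r)); rewrite EFinM -(leb_itvcc rr).
Qed.

Definition supp_in r (f : plane R -> R) := forall z, ~ box r z -> f z = 0.

Lemma compactly_supported_box f : compactly_supported f ->
  exists2 r : R, 0 < r & supp_in r f.
Proof.
move=> /compact_bounded[M [Mreal hM]].
pose r := `|M| + 1; have r0 : 0 < r by rewrite ltr_wpDl.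
exists r => // z; apply: contra_notP => /eqP fz0.
have zr : `|z| <= r.
  apply: hM; first by rewrite (le_lt_trans (ler_norm M))// ltrDl.
  exact: subset_closure.
move: zr; rewrite prod_normE ge_max => /andP[z1 z2].
by split; rewrite /= in_itv/= -ler_norml.
Qed.

Lemma supp_in_compactly r f : supp_in r f -> compactly_supported f.
Proof.
move=> h; apply: (subclosed_compact _ (compact_box (r := r))).
  exact: closed_closure.
rewrite [X in _ `<=` X](_ : _ = closure (box r : set (plane R))).
  apply: closureS => z /= /eqP; apply: contra_notP; exact: h.
apply/closure_id; apply: compact_closed; last exact: compact_box.
exact: (@norm_hausdorff R (plane R)).
Qed.

Lemma continuous_box_bounded r (f : plane R -> R) : continuous f ->
  exists2 C : R, 0 <= C & forall z, box r z -> `|f z| <= C.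
Proof.
move=> cf.
have : compact (f @` box r).
  by apply: continuous_compact; [exact: continuous_subspaceT|exact: compact_box].
move=> /compact_bounded[M [Mreal hM]]; exists (`|M| + 1); first by rewrite addr_ge0.
move=> z bz; apply: hM; first by rewrite (le_lt_trans (ler_norm M))// ltrDl.
by exists z.
Qed.

Lemma supp_in_bounded r (f : plane R -> R) : continuous f -> supp_in r f ->
  exists2 C : R, 0 <= C & forall z, `|f z| <= C.
Proof.
move=> cf sf; have [C C0 hC] := continuous_box_bounded r cf.
exists C => // z; have [/hC//|nz] := pselect (box r z).
by rewrite sf// normr0.
Qed.

Lemma supp_in_integrable r (f : plane R -> R) : continuous f -> supp_in r f ->
  leb2.-integrable setT (EFin \o (f : bplane R -> R)).
Proof.
move=> cf sf; have [C C0 hC] := supp_in_bounded cf sf.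
apply: (integrable_EFinP (f := f : bplane R -> R)); first exact: continuous_plane_measurable.
apply: (@le_lt_trans _ _ (\int[leb2]_z (C%:E * (\1_(box r : set (bplane R)) z)%:E))%E).
  apply: ge0_le_integral => //.
  - apply/measurable_EFinP; apply: measurableT_comp => //.
    exact: continuous_plane_measurable.
  - apply: measurable_funeM; apply/measurable_EFinP; apply: measurable_indic.
    exact: measurable_box.
  - move=> z _; rewrite -EFinM lee_fin indicE.
    have [|nz] := boolP (z \in _); first by rewrite mulr1.
    by rewrite mulr0 sf ?normr0// => bz; move: nz; rewrite mem_set.
rewrite ge0_integralZl//.
- by rewrite integral_indic// ?setIT ?lte_mul_pinfty ?leb2_box//; exact: measurable_box.
- by apply/measurable_EFinP; apply: measurable_indic; exact: measurable_box.
Qed.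

Lemma supp_inM r (f g : plane R -> R) : supp_in r f -> supp_in r (fun z => f z * g z).
Proof. by move=> sf z nz; rewrite sf ?mul0r. Qed.

Lemma is_derive_e1 (f : plane R -> R) z (l : R) :
  is_derive z (e1 : plane R) f l <-> is_derive z.1 1 (fun s => f (s, z.2)) l.
Proof.
have E : (fun h : R => h^-1 *: ((f \o shift z) (h *: (e1 : plane R)) - f z)) =
  (fun h => h^-1 *: (((fun s => f (s, z.2)) \o shift z.1) (h *: 1) - f (z.1, z.2))).
  apply/funext => h; rewrite -surjective_pairing; congr (_ *: (f _ - _)).
  by case: z => x y /=; rewrite /e1 /shift/=; congr pair; rewrite [LHS]/= scaler0 add0r.
by split=> -[d <-]; apply: DeriveDef; move: d; rewrite /derivable /derive E.
Qed.

Lemma is_derive_e2 (f : plane R -> R) z (l : R) :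
  is_derive z (e2 : plane R) f l <-> is_derive z.2 1 (fun s => f (z.1, s)) l.
Proof.
have E : (fun h : R => h^-1 *: ((f \o shift z) (h *: (e2 : plane R)) - f z)) =
  (fun h => h^-1 *: (((fun s => f (z.1, s)) \o shift z.2) (h *: 1) - f (z.1, z.2))).
  apply/funext => h; rewrite -surjective_pairing; congr (_ *: (f _ - _)).
  by case: z => x y /=; rewrite /e2 /shift/=; congr pair; rewrite [LHS]/= scaler0 add0r.
by split=> -[d <-]; apply: DeriveDef; move: d; rewrite /derivable /derive E.
Qed.

Definition tens (a b : R -> R) (z : plane R) : R := a z.1 * b z.2.

Lemma continuous_tens a b : continuous a -> continuous b -> continuous (tens a b).
Proof.
move=> ca cb z; apply: cvgM.
  by apply: (@cvg_comp _ _ _ fst a _ (nbhs z.1)); [exact: cvg_fst|exact: ca].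
by apply: (@cvg_comp _ _ _ snd b _ (nbhs z.2)); [exact: cvg_snd|exact: cb].
Qed.

Lemma is_derive_tens1 a b a' z : (forall x : R, is_derive x 1 a (a' x)) ->
  is_derive z (e1 : plane R) (tens a b) (tens a' b z).
Proof.
move=> da; apply/is_derive_e1; rewrite /tens /=.
have := is_deriveM (da z.1) (is_derive_cst (b z.2) z.1 1).
by move/is_derive_eq; apply; rewrite /GRing.scale/= mulr0 add0r mulrC.
Qed.

Lemma is_derive_tens2 a b b' z : (forall x : R, is_derive x 1 b (b' x)) ->
  is_derive z (e2 : plane R) (tens a b) (tens a b' z).
Proof.
move=> db; apply/is_derive_e2; rewrite /tens /=.
have := is_deriveM (is_derive_cst (a z.1) z.2 1) (db z.2).
by move/is_derive_eq; apply; rewrite /GRing.scale/= mulr0 addr0.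
Qed.

(** Partial derivatives of a tensor product are again tensor products, so the induction never leaves
    this class. *)
Lemma Cdiff_tens k a b : smooth a -> smooth b -> Cdiff k (tens a b).
Proof.
(* The witness inside [smoothk] may vary with the order; uniqueness of derivatives makes the given
   [f'] smooth at all orders. *)
have smd f f' : smooth f -> (forall x : R, is_derive x 1 f (f' x)) -> smooth f'.
  move=> sf df k'; have [f'' df''] := sf k'.+1.
  apply: smoothk_ext => x; have <- := @derive_val _ _ _ _ _ _ _ (df'' x).
  by rewrite (@derive_val _ _ _ _ _ _ _ (df x)).
elim: k a b => [|k ih] a b sa sb /=.
  by apply: continuous_tens; [exact: (sa 0%N)|exact: (sb 0%N)].
have [a' da _] := sa 1%N; have [b' db _] := sb 1%N.
split.
- by apply: continuous_tens; [exact: (sa 0%N)|exact: (sb 0%N)].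
- split; first by move=> z; exact: (@ex_derive _ _ _ _ _ _ _ (is_derive_tens1 b z da)).
  rewrite (_ : (fun z => _) = tens a' b); first by apply: ih => //; exact: smd da.
  by apply/funext => z; exact: (@derive_val _ _ _ _ _ _ _ (is_derive_tens1 b z da)).
- split; first by move=> z; exact: (@ex_derive _ _ _ _ _ _ _ (is_derive_tens2 a z db)).
  rewrite (_ : (fun z => _) = tens a b'); first by apply: ih => //; exact: smd db.
  by apply/funext => z; exact: (@derive_val _ _ _ _ _ _ _ (is_derive_tens2 a z db)).
Qed.

Lemma test_tens r a b : smooth a -> smooth b ->
  (forall x, x \notin `[- r, r] -> a x = 0) ->
  (forall x, x \notin `[- r, r] -> b x = 0) -> test_function (tens a b).
Proof.
move=> sa sb ha hb; split; first by move=> k; exact: Cdiff_tens.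
apply: (@supp_in_compactly r) => z nz; rewrite /tens.
have [z1|/ha->] := boolP (z.1 \in `[- r, r]); last by rewrite mul0r.
have [z2|/hb->] := boolP (z.2 \in `[- r, r]); last by rewrite mulr0.
by exfalso; apply: nz; split.
Qed.

End TestFunctions.

Lemma sigma_finite_leb2 {R : realType} : sigma_finite setT (@leb2 R).
Proof.
exists (fun n => box n%:R); last first.
  by move=> n; split; [exact: measurable_box|rewrite leb2_box// ltry].
apply/esym; rewrite -subTset => -[x1 x2] _.
exists (Num.truncn (`|x1| + `|x2|)).+1 => //=.
have h := truncnS_gt (`|x1| + `|x2|).
rewrite /box /= !in_itv/= -!ler_norml; split; apply: le_trans (ltW h).
  by rewrite lerDl.
by rewrite lerDr.
Qed.

Lemma sigma_finite_leb {R : realType} : sigma_finite setT (@lebesgue_measure R).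
Proof. exact: sigma_finiteT. Qed.

(** * Integration by parts against compactly supported functions *)

Section IntegrationByParts.
Context {R : realType}.
Notation leb := (@lebesgue_measure R).

Lemma integral_derive_compact (F F' : R -> R) (r : R) : 0 < r ->
  (forall x : R, is_derive x 1 F (F' x)) -> continuous F' ->
  (forall x, r < `|x| -> F x = 0) -> (forall x, r < `|x| -> F' x = 0) ->
  (\int[leb]_x (F' x)%:E = 0)%E.
Proof.
move=> r0 dF cF' F0 F'0.
have cF : continuous F := is_derive1_continuous dF.
(* One beyond [r], so that [F] vanishes at both end points. *)
pose s := r + 1; have ss : - s < s by rewrite /s; lra.
transitivity (\int[leb]_(x in `[(- s)%R, s]) (F' x)%:E)%E.
  rewrite [RHS]integral_mkcond; apply: eq_integral => x _; rewrite patchE.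
  case: ifPn => // /negP; rewrite inE/= in_itv/= -ler_norml => /negP; rewrite -ltNge => h.
  by rewrite F'0// (lt_trans _ h)// ltrDl.
rewrite (@continuous_FTC2 _ F' F)//.
- have h : r < `|s| by rewrite ger0_norm /s; lra.
  by rewrite !F0 ?normrN// subee.
- exact: continuous_subspaceT.
- split.
  + by move=> x _; exact: (@ex_derive _ _ _ _ _ _ _ (dF x)).
  + by apply: cvg_at_right_filter; exact: cF.
  + by apply: cvg_at_left_filter; exact: cF.
- by move=> x _; rewrite derive1E (@derive_val _ _ _ _ _ _ _ (dF x)).
Qed.

Lemma open_setC_box r : open (~` (box r : set (plane R))).
Proof.
apply: closed_openC; apply: compact_closed; last exact: compact_box.
exact: (@norm_hausdorff R (plane R)).
Qed.

Lemma supp_in_derive r (f f' : plane R -> R) v : supp_in r f ->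
  (forall z, is_derive z v f (f' z)) -> supp_in r f'.
Proof.
move=> sf df z nz; rewrite -(@derive_val _ _ _ _ _ _ _ (df z)).
rewrite -(derive_cst (0 : R) z v); apply: near_eq_derive.
have : nbhs z (~` (box r : set (plane R))).
  by apply: open_nbhs_nbhs; split => //; exact: open_setC_box.
by apply: filterS => w /sf.
Qed.

(** The partial derivative of the compactly supported product [g * phi] integrates to 0 along every
    line of direction [v]; Fubini is applied with that direction innermost. *)
Lemma ibp (v : plane R) (g gd phi phi' : plane R -> R) r : 0 < r ->
  (v = e1 \/ v = e2) ->
  (forall z, is_derive z v g (gd z)) -> (forall z, is_derive z v phi (phi' z)) ->
  continuous g -> continuous gd -> continuous phi -> continuous phi' ->
  supp_in r phi ->
  \int[leb2]_z (g z * phi' z) = - \int[leb2]_z (gd z * phi z).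
Proof.
move=> r0 hv dg dphi cg cgd cphi cphi' sphi.
have sphi' : supp_in r phi' := supp_in_derive sphi dphi.
have cM (a b : plane R -> R) : continuous a -> continuous b -> continuous (fun z => a z * b z).
  by move=> ca cb z; apply: cvgM; [exact: ca|exact: cb].
have i1 : leb2.-integrable setT (EFin \o (fun z : bplane R => g z * phi' z)).
  apply: (@supp_in_integrable _ r); first exact: cM.
  by move=> z nz; rewrite sphi' ?mulr0.
have i2 : leb2.-integrable setT (EFin \o (fun z : bplane R => gd z * phi z)).
  apply: (@supp_in_integrable _ r); first exact: cM.
  by move=> z nz; rewrite sphi ?mulr0.
apply/eqP; rewrite -addr_eq0 -RintegralD//; apply/eqP.
pose H z := g z * phi' z + gd z * phi z.
have dH z : is_derive z v (fun z => g z * phi z) (H z).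
  have := is_deriveM (dg z) (dphi z); move/is_derive_eq; apply.
  by rewrite /H /GRing.scale/= [phi z * _]mulrC.
have cH : continuous H.
  by move=> z; apply: cvgD; [exact: (cM _ _ cg cphi')|exact: (cM _ _ cgd cphi)].
have sgp : supp_in r (fun z => g z * phi z) by move=> z nz; rewrite sphi ?mulr0.
have sH : supp_in r H := supp_in_derive sgp dH.
have iH : leb2.-integrable setT (EFin \o (H : bplane R -> R)) := supp_in_integrable cH sH.
rewrite /Rintegral; suff -> : (\int[leb2]_z (H z)%:E = 0)%E by [].
have nbox1 x y : r < `|x| -> ~ box r ((x, y) : plane R).
  by move=> h [/=]; rewrite in_itv/= -ler_norml leNgt h.
have nbox2 x y : r < `|y| -> ~ box r ((x, y) : plane R).
  by move=> h [_ /=]; rewrite in_itv/= -ler_norml leNgt h.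
case: hv => ev.
- rewrite -[LHS](integral21_prod_meas1 iH) integral0_eq// => y _.
  rewrite /fubini_G/=; apply: (@integral_derive_compact (fun x => g (x, y) * phi (x, y)) _ r) => //.
  + by move=> x; have := dH (x, y); rewrite ev => /is_derive_e1.
  + move=> x; apply: (@cvg_comp _ _ _ (fun x => (x, y) : plane R) H _ (nbhs ((x, y) : plane R))).
      by apply: cvg_plane; [exact: cvg_id|exact: cvg_cst].
    exact: cH.
  + by move=> x /(@nbox1 _ y)/sgp.
  + by move=> x /(@nbox1 _ y)/sH.
- rewrite -[LHS](integral12_prod_meas1 iH) integral0_eq// => x _.
  rewrite /fubini_F/=; apply: (@integral_derive_compact (fun y => g (x, y) * phi (x, y)) _ r) => //.
  + by move=> y; have := dH (x, y); rewrite ev => /is_derive_e2.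
  + move=> y; apply: (@cvg_comp _ _ _ (fun y => (x, y) : plane R) H _ (nbhs ((x, y) : plane R))).
      by apply: cvg_plane; [exact: cvg_cst|exact: cvg_id].
    exact: cH.
  + by move=> y /(@nbox2 x)/sgp.
  + by move=> y /(@nbox2 x)/sH.
Qed.

End IntegrationByParts.

(** * The heat kernel *)

Section HeatKernel.
Context {R : realType}.
Notation leb := (@lebesgue_measure R).
Implicit Types (t : R) (z : plane R) (i : bool).

(* Written as a power because measurability of [powR] is in the library, that of the
   inverse is not. The indices [false] and [true] are the two coordinates; [pk t] is
   the Brownian transition density, [wt] the weight of the 1-resolvent. *)
Definition iv t : R := t `^ (-1).
Definition cd i z : R := if i then z.2 else z.1.
Definition ev i : plane R := if i then e2 else e1.
Definition pk t z : R := (2 * pi)^-1 * iv t * expR (- (2^-1 * sqnorm z * iv t)).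
(** First derivative of [pk t] in the direction [ev i]; [DDk] is the second one. *)
Definition Dk i t z : R := - (cd i z * iv t) * pk t z.
Definition DDk i t z : R := (cd i z ^+ 2 * iv t ^+ 2 - iv t) * pk t z.
Definition wt t : R := if 0 < t then expR (- t) else 0.

Lemma ivE t : 0 < t -> iv t = t^-1.
Proof. by move=> t0; rewrite /iv powR_inv1// ltW. Qed.

Lemma iv_ge0 t : 0 <= iv t.
Proof. exact: powR_ge0. Qed.

Lemma twopi_ge1 : 1 <= 2 * pi :> R.
Proof. by have := pi_ge2 R; lra. Qed.

Lemma pk_ge0 t z : 0 <= pk t z.
Proof.
rewrite /pk !mulr_ge0// ?expR_ge0 ?iv_ge0// invr_ge0 (le_trans _ twopi_ge1)//.
Qed.

Lemma sqnorm_ge0 z : 0 <= sqnorm z.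
Proof. by rewrite /sqnorm /dot -!expr2 addr_ge0// sqr_ge0. Qed.

Lemma sqnorm_cd i z : cd i z ^+ 2 <= sqnorm z.
Proof.
rewrite /sqnorm /dot -!expr2; have := sqr_ge0 z.1; have := sqr_ge0 z.2.
by case: i => /=; lra.
Qed.

Lemma pk_le t z : pk t z <= iv t.
Proof.
rewrite /pk mulrAC -[leRHS]mul1r ler_wpM2r ?iv_ge0//.
rewrite mulr_ile1 ?expR_ge0//.
- by rewrite invr_ge0 (le_trans _ twopi_ge1).
- by rewrite invf_le1 ?twopi_ge1// (lt_le_trans _ twopi_ge1).
- by rewrite expR_le1 oppr_le0 !mulr_ge0 ?sqnorm_ge0// iv_ge0.
Qed.

Lemma iv2 t : 0 < t -> iv (2 * t) = 2^-1 * iv t.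
Proof. by move=> t0; rewrite !ivE ?mulr_gt0// invfM. Qed.

(** Half of the Gaussian exponent is traded for a doubling of time. The freed factor absorbs
    polynomials in z / sqrt t, so that bounds for the derivatives are again heat kernels and can be
    integrated both in space and against [mu]. *)
Lemma pk_double t z : 0 < t ->
  pk t z = 2 * expR (- (4^-1 * sqnorm z * iv t)) * pk (2 * t) z.
Proof.
move=> t0; rewrite /pk iv2//.
have -> : - (2^-1 * sqnorm z * iv t) =
    - (4^-1 * sqnorm z * iv t) - (2^-1 * sqnorm z * (2^-1 * iv t)) by field.
by rewrite expRD; set c := (2 * pi)^-1; field.
Qed.

Lemma expR_quad (s : R) : s <= expR (4^-1 * s ^+ 2).
Proof.
apply: le_trans (expR_ge1Dx _).
by have := sqr_ge0 (s - 2); rewrite sqrrB; lra.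
Qed.

(** With s = |z_i| / sqrt t, the prefactor |z_i| / t is s / sqrt t, and s is absorbed by
    exp(-s^2/4). Only the singularity t^(-1/2), integrable at 0, remains. *)
Lemma Dk_le i t z : 0 < t ->
  `|Dk i t z| <= 2 * t `^ (- 2^-1) * pk (2 * t) z.
Proof.
move=> t0; rewrite /Dk normrM normrN [`|pk _ _|]ger0_norm ?pk_ge0//.
rewrite {1}(pk_double z t0) mulrA; apply: ler_wpM2r; first exact: pk_ge0.
set s := `|cd i z| * t `^ (- 2^-1).
have hiv : iv t = t `^ (- 2^-1) * t `^ (- 2^-1).
  rewrite -powRD; last by rewrite (gt_eqF t0) implybT.
  by congr (_ `^ _); field.
have s0 : 0 <= s by rewrite mulr_ge0 ?powR_ge0.
have ss : s ^+ 2 <= sqnorm z * iv t.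
  rewrite exprMn real_normK ?num_real// [X in _ * X]expr2 -hiv.
  by rewrite ler_wpM2r ?iv_ge0 ?sqnorm_cd.
rewrite normrM [`|iv t|]ger0_norm ?iv_ge0//.
have key : s * expR (- (4^-1 * sqnorm z * iv t)) <= 1.
  rewrite expRN ler_pdivrMr ?expR_gt0// mul1r (le_trans (expR_quad s))//.
  by rewrite ler_expR -mulrA ler_wpM2l.
have -> : `|cd i z| * iv t * (2 * expR (- (4^-1 * sqnorm z * iv t))) =
    2 * t `^ (- 2^-1) * (s * expR (- (4^-1 * sqnorm z * iv t))).
  by rewrite hiv /s; ring.
by rewrite ler_piMr// mulr_ge0// powR_ge0.
Qed.

Lemma DDk_le i t z : 0 < t -> `|DDk i t z| <= 10 * iv t * pk (2 * t) z.
Proof.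
move=> t0; rewrite /DDk normrM [`|pk _ _|]ger0_norm ?pk_ge0//.
rewrite {1}(pk_double z t0) mulrA; apply: ler_wpM2r; first exact: pk_ge0.
set a := 4^-1 * sqnorm z * iv t; set e := expR (- a).
have a0 : 0 <= a by rewrite !mulr_ge0 ?sqnorm_ge0 ?iv_ge0.
have e0 : 0 <= e by rewrite expR_ge0.
have ae : a * e <= 1.
  rewrite /e expRN ler_pdivrMr ?expR_gt0// mul1r.
  by apply: le_trans (expR_ge1Dx _); rewrite lerDr.
have e1' : e <= 1 by rewrite expR_le1 oppr_le0.
have h : `|cd i z ^+ 2 * iv t ^+ 2 - iv t| <= (4 * a + 1) * iv t.
  apply: (le_trans (ler_normB _ _)).
  rewrite [`|iv t|]ger0_norm ?iv_ge0// ger0_norm; last exact: (mulr_ge0 (sqr_ge0 _) (sqr_ge0 _)).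
  rewrite mulrDl mul1r lerD2r expr2 mulrA ler_wpM2r ?iv_ge0//.
  have -> : 4 * a = sqnorm z * iv t by rewrite /a; field.
  by rewrite ler_wpM2r ?iv_ge0 ?sqnorm_cd.
apply: (@le_trans _ _ ((4 * a + 1) * iv t * (2 * e))).
  by rewrite ler_wpM2r// mulr_ge0.
(* Both [a * e] and [e] are at most 1, whence 10 = 8 + 2. *)
have -> : (4 * a + 1) * iv t * (2 * e) = (8 * (a * e) + 2 * e) * iv t by ring.
by rewrite ler_wpM2r ?iv_ge0//; lra.
Qed.

Lemma pk_normal t x y : 0 < t ->
  pk t (x - y) = normal_pdf y.1 (Num.sqrt t) x.1 * normal_pdf y.2 (Num.sqrt t) x.2.
Proof.
move=> t0; have st0 : Num.sqrt t != 0 by rewrite gt_eqF// sqrtr_gt0.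
rewrite !normal_pdfE// /normal_peak /normal_fun sqr_sqrtr ?ltW//.
rewrite mulrACA -expRD -expr2 exprVn sqr_sqrtr; last first.
  by rewrite mulrn_wge0// mulr_ge0 ?pi_ge0 ?ltW.
rewrite /pk ivE//; congr (_ * _).
  have -> : t * pi *+ 2 = 2 * pi * t by rewrite -mulr_natr; ring.
  by rewrite [RHS]invfM.
congr expR; rewrite /sqnorm /dot /=; field.
by rewrite gt_eqF.
Qed.

Lemma integral_pk t y : 0 < t ->
  (\int[leb2]_x (pk t (x - y))%:E = 1)%E.
Proof.
move=> t0.
rewrite (eq_integral (fun x : bplane R => (normal_pdf y.1 (Num.sqrt t) x.1 *
    normal_pdf y.2 (Num.sqrt t) x.2)%:E)); last by move=> x _; rewrite pk_normal.
rewrite [LHS](@fubini_tonelli1 _ _ _ _ _ leb leb)//; last 2 first.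
  apply/measurable_EFinP; apply: measurable_funM.
    exact: (measurableT_comp (measurable_normal_pdf _ _) measurable_fst).
  exact: (measurableT_comp (measurable_normal_pdf _ _) measurable_snd).
  by move=> x; rewrite lee_fin mulr_ge0 ?normal_pdf_ge0.
rewrite -[RHS](integral_normal_pdf y.1 (Num.sqrt t)); apply: eq_integral => x1 _.
rewrite /fubini_F/=; under eq_integral do rewrite EFinM.
rewrite ge0_integralZl ?lee_fin ?normal_pdf_ge0//.
- by rewrite integral_normal_pdf mule1.
- by apply/measurable_EFinP; exact: measurable_normal_pdf.
- by move=> x2 _; rewrite lee_fin normal_pdf_ge0.
Qed.

Lemma measurable_cd d (T : measurableType d) i (f : T -> bplane R) :
  measurable_fun setT f -> measurable_fun setT (fun x => cd i (f x)).
Proof.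
by move=> mf; case: i; [exact: (measurableT_comp measurable_snd mf)|
  exact: (measurableT_comp measurable_fst mf)].
Qed.

Lemma measurable_iv d (T : measurableType d) (f : T -> R) :
  measurable_fun setT f -> measurable_fun setT (fun x => iv (f x)).
Proof. by move=> mf; exact: (measurableT_comp (measurable_powR _) mf). Qed.

Lemma measurable_sqnorm d (T : measurableType d) (f : T -> bplane R) :
  measurable_fun setT f -> measurable_fun setT (fun x => sqnorm (f x)).
Proof.
move=> mf; apply: measurable_funD; apply: measurable_funM.
- exact: (measurable_cd false mf).
- exact: (measurable_cd false mf).
- exact: (measurable_cd true mf).
- exact: (measurable_cd true mf).
Qed.

Lemma measurable_planeB d (T : measurableType d) (f g : T -> bplane R) :
  measurable_fun setT f -> measurable_fun setT g ->
  measurable_fun setT (fun x => f x - g x : bplane R).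
Proof.
move=> mf mg; apply/measurable_fun_pairP; split.
  by apply: measurable_funB; [exact: (measurable_cd false mf)|exact: (measurable_cd false mg)].
by apply: measurable_funB; [exact: (measurable_cd true mf)|exact: (measurable_cd true mg)].
Qed.

Section Measurability.
Context d (T : measurableType d) (f : T -> R) (g : T -> bplane R).
Hypotheses (mf : measurable_fun setT f) (mg : measurable_fun setT g).

Lemma measurable_pk : measurable_fun setT (fun x => pk (f x) (g x)).
Proof.
apply: measurable_funM; first by apply: measurable_funM => //; exact: measurable_iv.
apply: measurableT_comp => //; apply: measurableT_comp => //.
apply: measurable_funM; last exact: measurable_iv.
by apply: measurable_funM => //; exact: measurable_sqnorm.
Qed.

Lemma measurable_Dk i : measurable_fun setT (fun x => Dk i (f x) (g x)).
Proof.
apply: measurable_funM; last exact: measurable_pk.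
apply: measurableT_comp => //; apply: measurable_funM; last exact: measurable_iv.
exact: measurable_cd.
Qed.

Lemma measurable_DDk i : measurable_fun setT (fun x => DDk i (f x) (g x)).
Proof.
apply: measurable_funM; last exact: measurable_pk.
apply: measurable_funB; last exact: measurable_iv.
apply: measurable_funM; apply: measurable_funX; last exact: measurable_iv.
exact: measurable_cd.
Qed.

Lemma measurable_wt : measurable_fun setT (fun x => wt (f x)).
Proof.
apply: measurable_fun_ifT => //.
  by apply: measurable_fun_ltr => //; exact: measurable_cst.
by apply: measurableT_comp => //; exact: measurableT_comp.
Qed.

End Measurability.

Lemma wt_ge0 t : 0 <= wt t.
Proof. by rewrite /wt; case: ifP => // _; exact: expR_ge0. Qed.

End HeatKernel.

Section HeatKernelCalculus.
Context {R : realType}.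
Notation leb := (@lebesgue_measure R).
Implicit Types (t : R) (z : plane R) (i : bool).

Lemma is_derive1_cvg (f : R -> R) (x d : R) : is_derive x 1 f d -> f y @[y --> x] --> f x.
Proof.
by move=> df; apply: differentiable_continuous; apply/derivable1_diffP; exact: ex_derive.
Qed.

(** The integral is improper at 0: it is the monotone limit of the integrals over the intervals from
    [n.+1%:R^-1] to 1. *)
Lemma integral_powR01 (p : R) : 0 < p <= 1 ->
  (\int[leb]_(t in `]0%R, 1%R]) (t `^ (p - 1))%:E <= (p^-1)%:E)%E.
Proof.
move=> /andP[p0 p1].
pose A n : set R := `[n.+1%:R^-1, 1]%classic.
have n0 n : 0 < n.+1%:R^-1 :> R by rewrite invr_gt0.
have UA : \bigcup_n A n = `]0, 1]%classic.
  apply/seteqP; split => [t [n _]|t].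
    by rewrite /A /= !in_itv/= => /andP[h ->]; rewrite (lt_le_trans (n0 n))//.
  rewrite /= in_itv/= => /andP[t0 t1]; exists (Num.truncn t^-1) => //.
  rewrite /A /= in_itv/= t1 andbT -[leRHS]invrK lef_pV2 ?posrE ?invr_gt0//.
  by rewrite ltW// truncnS_gt.
have mf : measurable_fun setT (fun t : R => (t `^ (p - 1))%:E).
  by apply/measurable_EFinP; exact: measurable_powR.
have H : (\int[leb]_(x in A i) (x `^ (p - 1))%:E)%E @[i --> \oo] -->
    (\int[leb]_(x in `]0%R, 1%R]) (x `^ (p - 1))%:E)%E.
  rewrite -UA.
  apply: (@ge0_nondecreasing_set_cvg_integral _ (measurableTypeR R) R A) => //.
  - apply/nondecreasing_seqP => n; rewrite subsetEset => t; rewrite /A /= !in_itv/=.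
    by move=> /andP[h ->]; rewrite andbT (le_trans _ h)// lef_pV2 ?posrE// ler_nat.
  - by move=> n; exact: measurable_itv.
  - by move=> n; exact: measurable_funTS.
  - by move=> n t _; rewrite lee_fin powR_ge0.
rewrite -(cvg_lim _ H)//; apply: lime_le; first exact: cvgP H.
(* For index 0 the interval is the single point 1. *)
apply: nearW => -[|n].
  rewrite /A invr1 set_itv1 integral_set1 lee_fin invr_ge0 ltW//.
have n1 : n.+2%:R^-1 < 1 :> R by rewrite invf_lt1// ltr1n.
rewrite (@continuous_FTC2 _ _ (fun t => p^-1 * t `^ p))//.
- rewrite -EFinB lee_fin powR1 mulr1 lerBlDr lerDl mulr_ge0 ?powR_ge0//.
  by rewrite invr_ge0 ltW.
- apply: derivable_within_continuous => t; rewrite in_itv/= => /andP[h _].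
  by apply: ex_derive; apply: is_derive1_powR; exact: lt_le_trans h.
- have D t : 0 < t -> is_derive t 1 (fun t => p^-1 * t `^ p) (p^-1 * (p * t `^ (p - 1))).
    move=> t0; have := is_deriveZ p^-1 (is_derive1_powR p t0).
    by move/is_derive_eq; apply.
  have C t : 0 < t -> (fun t => p^-1 * t `^ p) x @[x --> t] --> p^-1 * t `^ p.
    by move=> t0; exact: is_derive1_cvg (D _ t0).
  split.
  + move=> t; rewrite in_itv/= => /andP[h _]; have t0 := lt_trans (n0 n.+1) h.
    exact: (@ex_derive _ _ _ _ _ _ _ (D _ t0)).
  + by apply: cvg_at_right_filter; exact: C.
  + by apply: cvg_at_left_filter; exact: C.
- move=> t; rewrite in_itv/= => /andP[h _]; have t0 := lt_trans (n0 n.+1) h.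
  rewrite derive1E deriveMl; last by apply: ex_derive; exact: is_derive1_powR.
  by rewrite (@derive_val _ _ _ _ _ _ _ (is_derive1_powR p t0)) mulKf// gt_eqF.
Qed.

(** Below 1 the exponential is at most 1 and the power remains; above 1 the power is at most 1 and
    the exponential density remains. *)
Lemma integral_wt_powR (p : R) : 0 < p <= 1 ->
  (\int[leb]_t (wt t * t `^ (p - 1))%:E < +oo)%E.
Proof.
move=> p01; have /andP[p0 p1] := p01.
apply: (@le_lt_trans _ _ (\int[leb]_t ((fun t : R => (t `^ (p - 1))%:E) \_ (`]0%R, 1%R] : set R)
   t + (exponential_pdf 1 t)%:E))%E).
  apply: ge0_le_integral => //.
  - by move=> t _; rewrite lee_fin mulr_ge0 ?wt_ge0 ?powR_ge0.
  - apply/measurable_EFinP; apply: measurable_funM; last exact: measurable_powR.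
    exact: measurable_wt.
  - apply: emeasurable_funD; last first.
      by apply/measurable_EFinP; exact: measurable_exponential_pdf.
    apply/(measurable_restrictT _ _).1 => //; apply: measurable_funTS.
    by apply/measurable_EFinP; exact: measurable_powR.
  - move=> t _; rewrite /wt patchE; case: ifPn => t0; last first.
      rewrite mul0r adde_ge0//; last by rewrite lee_fin exponential_pdf_ge0.
      by case: ifP => // _; rewrite lee_fin powR_ge0.
    rewrite (@exponential_pdfE _ 1 t (ltW t0)) mul1r mulN1r.
    case: ifPn => [_|].
      rewrite -EFinD lee_fin ler_wpDr ?expR_ge0// ler_piMl ?powR_ge0//.
      by rewrite expR_le1 oppr_le0 ltW.
    rewrite notin_setE/= in_itv/= t0/= => /negP; rewrite -ltNge => t1.
    rewrite add0e lee_fin ler_piMr ?expR_ge0//.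
    have h : p - 1 <= 0 by rewrite subr_le0.
    by have := ler_powR (ltW t1) h; rewrite powRr0.
rewrite ge0_integralD//; last 4 first.
- by move=> t _; rewrite patchE; case: ifP => // _; rewrite lee_fin powR_ge0.
- apply/(measurable_restrictT _ _).1 => //; apply: measurable_funTS.
  by apply/measurable_EFinP; exact: measurable_powR.
- by move=> t _; rewrite lee_fin exponential_pdf_ge0.
- by apply/measurable_EFinP; exact: measurable_exponential_pdf.
rewrite integral_exponential_pdf// -integral_mkcond lte_add_pinfty ?ltry//.
by rewrite (le_lt_trans (integral_powR01 p01))// ltry.
Qed.

Definition gs t (c s : R) : R := expR (- (2^-1 * (s - c) ^+ 2 * iv t)).

Lemma smooth_poly2 a b (k : nat) (c : R) : smoothk k (fun s : R => a * (s - c) ^+ 2 + b).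
Proof.
apply: smoothkD; last exact: smoothk_cst.
apply: smoothkZ; apply: smoothkX; apply: smoothkD; [exact: smoothk_id|exact: smoothk_cst].
Qed.

Lemma smooth_gs t c : smooth (gs t c).
Proof.
move=> k; apply: smoothk_expR => {}k.
apply: (smoothk_ext _ (smooth_poly2 (- (2^-1 * iv t)) 0 k c)) => s; ring.
Qed.

Lemma is_derive_gs t c (s : R) :
  is_derive s 1 (gs t c) (- ((s - c) * iv t) * gs t c s).
Proof.
have D : is_derive s 1 (fun s => - (2^-1 * (s - c) ^+ 2 * iv t)) (- ((s - c) * iv t)).
  apply: is_derive_eq; rewrite /GRing.scale/=; by field.
have := @is_derive1_comp _ expR (fun s => - (2^-1 * (s - c) ^+ 2 * iv t)) s _ _
  (is_derive_expR _) D.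
by move/is_derive_eq; apply; rewrite mulrC.
Qed.

Lemma pk_tens t (y : plane R) : (fun x => pk t (x - y)) =
  (fun x => (2 * pi)^-1 * iv t * tens (gs t y.1) (gs t y.2) x).
Proof.
apply/funext => x; rewrite /pk /tens /gs -expRD; congr (_ * expR _).
by rewrite /sqnorm /dot /=; ring.
Qed.

Lemma is_derive_pk i t (y x : plane R) :
  is_derive x (ev i) (fun x => pk t (x - y)) (Dk i t (x - y)).
Proof.
rewrite /Dk (congr1 (fun f => f x) (pk_tens t y)) pk_tens.
have h : is_derive x (ev i) (tens (gs t y.1) (gs t y.2))
    (- (cd i (x - y) * iv t) * tens (gs t y.1) (gs t y.2) x).
  case: i => /=.
    have := is_derive_tens2 (gs t y.1) x (is_derive_gs t y.2).
    by move/is_derive_eq; apply; rewrite /tens /=; ring.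
  have := is_derive_tens1 (gs t y.2) x (is_derive_gs t y.1).
  by move/is_derive_eq; apply; rewrite /tens /=; ring.
have := is_deriveZ ((2 * pi)^-1 * iv t) h.
by move/is_derive_eq; apply; rewrite /GRing.scale/=; ring.
Qed.

Lemma is_derive_Dk i t (y x : plane R) :
  is_derive x (ev i) (fun x => Dk i t (x - y)) (DDk i t (x - y)).
Proof.
have h : is_derive x (ev i) (fun x => - (cd i (x - y) * iv t)) (- iv t).
  case: i; [apply/is_derive_e2|apply/is_derive_e1] => /=.
    by apply: is_derive_eq; rewrite /GRing.scale/=; ring.
  by apply: is_derive_eq; rewrite /GRing.scale/=; ring.
have := is_deriveM h (is_derive_pk i t y x).
by move/is_derive_eq; apply; rewrite /GRing.scale/= /Dk /DDk; ring.
Qed.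

Lemma continuous_pk t (y : plane R) : continuous (fun x : plane R => pk t (x - y)).
Proof.
rewrite pk_tens => x; apply: cvgM; first exact: cvg_cst.
by apply: continuous_tens; exact: (smooth_gs _ _ 0%N).
Qed.

Lemma continuous_cdB i (y : plane R) : continuous (fun x : plane R => cd i (x - y)).
Proof.
move=> x; case: i => /=.
  by apply: (@cvgB _ R); [exact: cvg_snd|exact: cvg_cst].
by apply: (@cvgB _ R); [exact: cvg_fst|exact: cvg_cst].
Qed.

Lemma continuous_Dk i t (y : plane R) : continuous (fun x : plane R => Dk i t (x - y)).
Proof.
move=> x; apply: cvgM; last exact: continuous_pk.
by apply: cvgN; apply: cvgM; [exact: continuous_cdB|exact: cvg_cst].
Qed.

Lemma continuous_DDk i t (y : plane R) : continuous (fun x : plane R => DDk i t (x - y)).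
Proof.
move=> x; apply: cvgM; last exact: continuous_pk.
apply: cvgB; last exact: cvg_cst.
apply: cvgM; last exact: cvg_cst.
by rewrite expr2; apply: cvgM; exact: continuous_cdB.
Qed.

(** The heat equation, with damping: the time derivative of e^-t p_t is -(1 - Laplacian/2) applied
    to e^-t p_t. *)
Lemma is_derive_pk_time t z : 0 < t ->
  is_derive t 1 (fun t => expR (- t) * pk t z)
    (- (expR (- t) * (pk t z - 2^-1 * (DDk false t z + DDk true t z)))).
Proof.
move=> t0; have tn0 : t != 0 by rewrite gt_eqF.
have D : is_derive t 1 (fun t => expR (- t) * ((2 * pi)^-1 * t^-1 * expR (- (2^-1 * sqnorm z * t^-1))))
    (- (expR (- t) * (pk t z - 2^-1 * (DDk false t z + DDk true t z)))).
  have h1 : is_derive t 1 (fun y : R => y^-1) (- t ^- 2).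
    by have := @is_deriveV R id t 1 1 tn0 (is_derive_id _ _); rewrite [_ *: _]mulr1.
  have h2 : is_derive t 1 (fun t => expR (- t)) (- expR (- t)).
    have := @is_derive1_comp _ expR (fun t => - t) t _ _ (is_derive_expR _)
      (is_deriveN (is_derive_id t 1)).
    by move/is_derive_eq; apply; rewrite mulrN1.
  have h3 : is_derive t 1 (fun t => expR (- (2^-1 * sqnorm z * t^-1)))
      (expR (- (2^-1 * sqnorm z * t^-1)) * (2^-1 * sqnorm z * t ^- 2)).
    have := @is_derive1_comp _ expR (fun t => - (2^-1 * sqnorm z * t^-1)) t _ _
      (is_derive_expR _) (is_deriveN (is_deriveZ (2^-1 * sqnorm z) h1)).
    by move/is_derive_eq; apply; rewrite /GRing.scale/=; ring.
  have h4 : is_derive t 1 (fun t => (2 * pi)^-1 * t^-1) ((2 * pi)^-1 * - t ^- 2).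
    exact: is_deriveZ h1.
  have h5 : is_derive t 1 (fun t => (2 * pi)^-1 * t^-1 * expR (- (2^-1 * sqnorm z * t^-1))) _ :=
    is_deriveM h4 h3.
  have := is_deriveM h2 h5.
  move/is_derive_eq; apply.
  rewrite /GRing.scale/= /DDk /pk ivE// /sqnorm /dot /=.
  set c := (2 * pi)^-1; set e := expR (- (_ * _)); field.
  by [].
apply: (near_eq_is_derive _ D).
by near=> s; rewrite /pk ivE//; near: s; exact: lt_nbhsr.
Unshelve. all: by end_near. Qed.

Lemma integral_pk_time (a b : R) z : 0 < a -> a < b ->
  (\int[leb]_(t in `[a, b])
     (expR (- t) * (pk t z - 2^-1 * (DDk false t z + DDk true t z)))%:E =
   (expR (- a) * pk a z - expR (- b) * pk b z)%:E)%E.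
Proof.
move=> a0 ab.
pose F t := - (expR (- t) * pk t z).
pose f t := expR (- t) * (pk t z - 2^-1 * (DDk false t z + DDk true t z)).
have D t : 0 < t -> is_derive t 1 F (f t).
  by move=> t0; have := is_deriveN (is_derive_pk_time z t0); rewrite opprK.
have Civ t : 0 < t -> iv x @[x --> t] --> iv t.
  by move=> t0; exact: is_derive1_cvg (is_derive1_powR _ t0).
have Cpk t : 0 < t -> pk x z @[x --> t] --> pk t z.
  move=> t0; apply: cvgM; first by apply: cvgM; [exact: cvg_cst|exact: Civ].
  apply: (cvg_comp _ expR); last exact: continuous_expR.
  by apply: cvgN; apply: cvgM; [exact: cvg_cst|exact: Civ].
have CDD j t : 0 < t -> DDk j x z @[x --> t] --> DDk j t z.
  move=> t0; apply: cvgM; last exact: Cpk.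
  apply: cvgB; last exact: Civ.
  by apply: cvgM; [exact: cvg_cst|apply: cvgM; exact: Civ].
have Cf t : 0 < t -> f x @[x --> t] --> f t.
  move=> t0; apply: cvgM.
    apply: (cvg_comp _ expR); last exact: continuous_expR.
    by apply: cvgN; exact: cvg_id.
  apply: cvgB; first exact: Cpk.
  apply: cvgM; first exact: cvg_cst.
  by apply: cvgD; exact: CDD.
rewrite (@continuous_FTC2 _ f F)//.
- by rewrite -EFinB /F opprK addrC.
- apply: continuous_in_subspaceT => t; rewrite inE/= in_itv/= => /andP[h _].
  by apply: Cf; exact: lt_le_trans h.
- split.
  + move=> t; rewrite in_itv/= => /andP[h _].
    by apply: (@ex_derive _ _ _ _ _ _ _ (D _ _)); exact: lt_trans h.
  + by apply: cvg_at_right_filter; exact: is_derive1_cvg (D _ a0).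
  + by apply: cvg_at_left_filter; apply: is_derive1_cvg (D _ _); exact: lt_trans ab.
- move=> t; rewrite in_itv/= => /andP[h _]; rewrite derive1E.
  by rewrite (@derive_val _ _ _ _ _ _ _ (D _ (lt_trans a0 h))).
Qed.

End HeatKernelCalculus.

(** * The heat kernel as an approximate identity, and heat potentials of measures of power growth *)

Section HeatSemigroup.
Context {R : realType}.
Notation leb := (@lebesgue_measure R).
Implicit Types (t : R) (z : plane R) (i : bool).

Lemma measurable_pk_x t (y : plane R) :
  measurable_fun setT (fun x : bplane R => pk t (x - y)).
Proof. by apply: measurable_pk => //; apply: measurable_planeB. Qed.

Lemma integrable_pk t (y : plane R) : 0 < t ->
  leb2.-integrable setT (fun x : bplane R => (pk t (x - y))%:E).
Proof.
move=> t0; apply: integrable_EFinP; first exact: measurable_pk_x.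
under eq_integral do rewrite ger0_norm ?pk_ge0//.
by rewrite integral_pk// ltry.
Qed.

Lemma Rintegral_pk t (y : plane R) : 0 < t -> \int[leb2]_x pk t (x - y) = 1.
Proof. by move=> t0; rewrite /Rintegral integral_pk. Qed.

Lemma Rintegral_cpk c t (y : plane R) : 0 < t -> \int[leb2]_x (c * pk t (x - y)) = c.
Proof.
by move=> t0; rewrite RintegralZl ?Rintegral_pk ?mulr1//; exact: integrable_pk.
Qed.

Lemma integrable_bounded_pk (f : bplane R -> R) (C : R) t (y : plane R) : 0 < t ->
  measurable_fun setT f -> (forall x, `|f x| <= C) ->
  leb2.-integrable setT (fun x : bplane R => (f x * pk t (x - y))%:E).
Proof.
move=> t0 mf fC.
apply: (le_integrable _ _ _ (integrableZl _ C (integrable_pk y t0))) => //.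
  by apply/measurable_EFinP; apply: measurable_funM => //; exact: measurable_pk_x.
move=> x _; rewrite -EFinM !abse_EFin lee_fin !normrM.
by rewrite ler_wpM2r// (le_trans (fC x))// ler_norm.
Qed.

Lemma Rintegral_pk_le (f : bplane R -> R) (C : R) t (y : plane R) : 0 < t ->
  measurable_fun setT f -> (forall x, `|f x| <= C) ->
  `|\int[leb2]_x (f x * pk t (x - y))| <= C.
Proof.
move=> t0 mf fC; have ifp := integrable_bounded_pk y t0 mf fC.
apply: (le_trans (le_normr_Rintegral _ ifp)) => //.
rewrite -[leRHS](Rintegral_cpk C y t0).
apply: le_Rintegral => //.
- exact: integrable_norm.
- by apply: (integrableZl _ C (integrable_pk y t0)).
- by move=> x _; rewrite normrM [`|pk _ _|]ger0_norm ?pk_ge0// ler_wpM2r ?pk_ge0.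
Qed.

(** From [pk_double] and e^-u <= 1/u with u = |z|^2/(4t). The bound is still a heat kernel, so its
    space integral is known and vanishes with [t]. *)
Lemma pk_far t (d : R) z : 0 < t -> 0 < d -> d ^+ 2 <= sqnorm z ->
  pk t z <= (8 * t / d ^+ 2) * pk (2 * t) z.
Proof.
move=> t0 d0 dz; rewrite {1}(pk_double z t0) ler_wpM2r ?pk_ge0// ivE//.
have q0 : 0 < 4^-1 * sqnorm z / t.
  by rewrite divr_gt0// mulr_gt0// (lt_le_trans _ dz)// exprn_gt0.
have : expR (- (4^-1 * sqnorm z / t)) <= 4 * t / d ^+ 2.
  rewrite expRN -[leRHS]invrK lef_pV2 ?posrE ?expR_gt0 ?invr_gt0 ?divr_gt0 ?mulr_gt0 ?exprn_gt0//.
  apply: le_trans (expR_ge1Dx _).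
  rewrite (@le_trans _ _ (4^-1 * sqnorm z / t)) ?lerDr// invf_div invfM mulrA.
  by rewrite ler_wpM2r ?invr_ge0 ?(ltW t0)// mulrC ler_wpM2l.
move=> h; have -> : 8 * t / d ^+ 2 = 2 * (4 * t / d ^+ 2) by ring.
by rewrite ler_wpM2l.
Qed.

(** The norm of the plane is the sup norm, which is at most the Euclidean one. *)
Lemma sqnorm_far (d : R) z : 0 < d -> ~ (`|z| < d) -> d ^+ 2 <= sqnorm z.
Proof.
move=> d0 /negP; rewrite -leNgt prod_normE le_max => /orP[h|h].
  apply: le_trans (sqnorm_cd false z); rewrite /= -[z.1 ^+ 2]real_normK ?num_real//.
  by rewrite lerXn2r// ?nnegrE ?ltW.
apply: le_trans (sqnorm_cd true z); rewrite /= -[z.2 ^+ 2]real_normK ?num_real//.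
by rewrite lerXn2r// ?nnegrE ?ltW.
Qed.

Lemma cvg_heat (f : plane R -> R) (C : R) (y : plane R) : continuous f ->
  (forall x, `|f x| <= C) ->
  (\int[leb2]_x (f x * pk n.+1%:R^-1 (x - y))) @[n --> \oo] --> f y.
Proof.
move=> cf fC.
have mf : measurable_fun setT (f : bplane R -> R) := continuous_plane_measurable cf.
have C0 : 0 <= C := le_trans (normr_ge0 _) (fC y).
apply/cvgrPdist_le => e e0.
have e20 : 0 < e / 2 by rewrite divr_gt0.
have /cvgrPdist_le/(_ _ e20)/nbhs_ballP[d /= d0 hd] := cf y.
have d2 : 0 < d ^+ 2 by rewrite exprn_gt0.
(* The far part contributes at most 2C times 8t/d^2; the added 1 keeps [B] positive when [C] is
   0. *)
pose B := 16 * C / d ^+ 2 + 1.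
have B0 : 0 < B by rewrite ltr_wpDl// divr_ge0 ?mulr_ge0// ltW.
have eB : 0 < e / 2 / B by rewrite divr_gt0.
near=> n; have tB : n.+1%:R^-1 < e / 2 / B.
  by near: n; exact: near_infty_natSinv_lt (PosNum eB).
set t : R := n.+1%:R^-1 in tB *; have t0 : 0 < t by rewrite invr_gt0.
have it := integrable_pk y t0.
have i2t : leb2.-integrable setT (fun x : bplane R => (pk (2 * t) (x - y))%:E).
  by apply: integrable_pk; rewrite mulr_gt0.
have h1 : f y = \int[leb2]_x (f y * pk t (x - y)).
  by rewrite Rintegral_cpk.
rewrite {1}h1 -RintegralB//; last 2 first.
  by apply: (integrableZl _ (f y) it).
  exact: integrable_bounded_pk fC.
pose A := 2 * C * (8 * t / d ^+ 2).
have A0 : 0 <= A by rewrite !mulr_ge0// ?invr_ge0 ltW.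
have iI : leb2.-integrable setT (fun x : bplane R => (f y * pk t (x - y) - f x * pk t (x - y))%:E).
  exact: (integrableB measurableT (integrableZl measurableT (f y) it)
    (integrable_bounded_pk y t0 mf fC)).
apply: (le_trans (le_normr_Rintegral _ iI)) => //.
apply: (@le_trans _ _ (\int[leb2]_x (e / 2 * pk t (x - y) + A * pk (2 * t) (x - y)))).
  apply: le_Rintegral => //.
  - exact: integrable_norm.
  - by apply: (integrableD _ (integrableZl _ (e / 2) it) (integrableZl _ A i2t)).
  - move=> x _; rewrite -mulrBl normrM [`|pk _ _|]ger0_norm ?pk_ge0//.
    have [xy|nxy] := pselect (`|x - y| < d).
      apply: ler_wpDr; first by rewrite mulr_ge0 ?pk_ge0.
      rewrite ler_wpM2r ?pk_ge0//.
      by apply: hd; rewrite -ball_normE/= distrC.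
    apply: ler_wpDl; first by rewrite mulr_ge0 ?pk_ge0 ?ltW.
    rewrite /A -mulrA ler_pM//.
    - exact: pk_ge0.
    - by rewrite (le_trans (ler_normB _ _))// mulr2n mulrDl mul1r lerD.
    - by apply: pk_far => //; exact: sqnorm_far.
rewrite RintegralD//; last 2 first.
  by apply: (integrableZl _ (e / 2) it).
  by apply: (integrableZl _ A i2t).
rewrite (Rintegral_cpk _ _ t0) Rintegral_cpk ?mulr_gt0//.
suff : A <= e / 2 by lra.
have -> : A = (16 * C / d ^+ 2) * t by rewrite /A; ring.
rewrite (@le_trans _ _ (B * t)) ?ler_wpM2r ?(ltW t0) ?lerDl//.
by rewrite -ler_pdivlMl// mulrC ltW.
Unshelve. all: by end_near. Qed.

Definition cbox (x : plane R) (r : R) : set (bplane R) :=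
  `[x.1 - r, x.1 + r] `*` `[x.2 - r, x.2 + r].

Lemma measurable_cbox x r : measurable (cbox x r).
Proof. exact: measurableX. Qed.

Lemma cboxP x r y : cbox x r y <-> `|x.1 - y.1| <= r /\ `|x.2 - y.2| <= r.
Proof.
by rewrite /cbox /= !in_itv/= !ler_distl; split=> -[/andP[? ?] /andP[? ?]]; split;
  apply/andP; split; lra.
Qed.

(** For s < 1 the integral is split at distance r = s^(1/4). Near x the kernel is at most 1/s and
    the mass at most C s^(al/4). Far from x one has |x - y|^2 / s >= s^(-1/2), so that the kernel is
    at most 2 s^(-1/2), and s^(-1/2) <= s^(al/4 - 1) because al <= 2. For s >= 1 the bound 1/s and
    the total mass suffice. *)
Lemma heat_potential_bound (mu : {measure set (bplane R) -> \bar R}) (C al : R) :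
  (mu setT < +oo)%E -> 0 < al <= 2 -> 0 <= C ->
  (forall x r, 0 < r <= 1 -> (mu (cbox x r) <= (C * r `^ al)%:E)%E) ->
  exists2 C' : R, 0 <= C' & forall s x, 0 < s ->
    (\int[mu]_y (pk s (x - y))%:E <= (C' * s `^ (al / 4 - 1))%:E)%E.
Proof.
move=> muT /andP[al0 al2] C0 hmu.
pose m := fine (mu setT).
have mE : mu setT = m%:E by rewrite /m fineK// ge0_fin_numE.
have m0 : 0 <= m by rewrite fine_ge0.
exists (C + 2 * m); first by rewrite addr_ge0// mulr_ge0.
move=> s x s0.
have mpk : measurable_fun setT (fun y : bplane R => (pk s (x - y))%:E).
  by apply/measurable_EFinP; apply: measurable_pk => //; apply: measurable_planeB.
have pk0 (y : bplane R) : setT y -> (0 <= (pk s (x - y))%:E)%E by rewrite lee_fin pk_ge0.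
have [s1|s1] := leP 1 s.
  apply: (@le_trans _ _ (\int[mu]_(y in setT) (s^-1)%:E)%E).
    apply: ge0_le_integral => //.
    by move=> y _; rewrite lee_fin -ivE// pk_le.
  rewrite integral_cst// mE -EFinM lee_fin mulrC ler_pM ?invr_ge0//; first exact: ltW.
    by lra.
  rewrite -(powR_inv1 (ltW s0)) ler_powR//; lra.
set r := s `^ (4^-1).
have r0 : 0 < r by rewrite powR_gt0.
have r1 : r <= 1.
  have : s `^ 4^-1 <= 1 `^ 4^-1 by rewrite ge0_ler_powR ?nnegrE ?ltW ?invr_gt0.
  by rewrite powR1.
have r2 : r ^+ 2 = s `^ 2^-1.
  by rewrite -powR_mulrn ?powR_ge0// -powRrM; congr (_ `^ _); field.
apply: (@le_trans _ _ (\int[mu]_y ((s^-1)%:E * (\1_(cbox x r) y)%:E + (2 * s `^ (- 2^-1))%:E))%E).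
  apply: ge0_le_integral => //.
  - apply: emeasurable_funD => //; apply: measurable_funeM; apply/measurable_EFinP.
    by apply: measurable_indic; exact: measurable_cbox.
  - move=> y _; rewrite -EFinM -EFinD lee_fin indicE.
    have [|ny] := boolP (y \in _).
      by rewrite mulr1 ler_wpDr ?mulr_ge0 ?powR_ge0// -ivE// pk_le.
    rewrite mulr0 add0r.
    have far : r ^+ 2 <= sqnorm (x - y).
      apply: sqnorm_far => // h; move: ny; rewrite mem_set//; apply/cboxP.
      by move: h; rewrite prod_normE gt_max => /andP[/ltW ? /ltW ?].
    rewrite /pk ivE//.
    have q0 : 0 < 2^-1 * sqnorm (x - y) / s.
      by rewrite divr_gt0// mulr_gt0// (lt_le_trans _ far)// exprn_gt0.
    have h : expR (- (2^-1 * sqnorm (x - y) / s)) <= 2 * s `^ 2^-1.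
      have -> : 2 * s `^ 2^-1 = (2^-1 * r ^+ 2 / s)^-1.
        rewrite invf_div r2 invfM invrK mulrCA; congr (_ * _).
        rewrite -powRN -{2}[s](powRr1 (ltW s0)) -powRD ?(gt_eqF s0) ?implybT//.
        by congr (_ `^ _); field.
      rewrite expRN lef_pV2 ?posrE ?expR_gt0 ?divr_gt0 ?mulr_gt0 ?exprn_gt0//.
      apply: le_trans (expR_ge1Dx _).
      rewrite (@le_trans _ _ (2^-1 * sqnorm (x - y) / s)) ?lerDr//.
      by rewrite ler_wpM2r ?invr_ge0 ?(ltW s0)// ler_wpM2l.
    apply: (@le_trans _ _ (s^-1 * (2 * s `^ 2^-1))).
      rewrite ler_pM ?expR_ge0//.
        by rewrite mulr_ge0 ?invr_ge0 ?(ltW s0)// (le_trans _ twopi_ge1).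
      rewrite ler_piMl ?invr_ge0 ?(ltW s0)//.
      by rewrite invf_le1 ?twopi_ge1// (lt_le_trans _ twopi_ge1).
    rewrite mulrCA ler_wpM2l// -(powR_inv1 (ltW s0)) -powRD ?(gt_eqF s0) ?implybT//.
    by rewrite (_ : -1 + 2^-1 = - 2^-1) //; field.
rewrite ge0_integralD//; last 3 first.
- by move=> y _; rewrite -EFinM lee_fin mulr_ge0 ?invr_ge0 ?(ltW s0).
- apply: measurable_funeM; apply/measurable_EFinP.
  by apply: measurable_indic; exact: measurable_cbox.
- by move=> y _; rewrite lee_fin mulr_ge0 ?powR_ge0.
rewrite ge0_integralZl//; last 2 first.
- by apply/measurable_EFinP; apply: measurable_indic; exact: measurable_cbox.
- by rewrite lee_fin invr_ge0 ltW.
rewrite integral_indic//; last exact: measurable_cbox.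
rewrite setIT integral_cst// mE -EFinM.
have hr := hmu x r; rewrite r0 r1 in hr; have {}hr := hr isT.
apply: (@le_trans _ _ ((s^-1)%:E * (C * r `^ al)%:E + (2 * s `^ (- 2^-1) * m)%:E)%E).
  by rewrite leeD2r// lee_wpmul2l// lee_fin invr_ge0 ltW.
rewrite -EFinM -EFinD lee_fin [leRHS]mulrDl; apply: lerD.
  rewrite mulrCA ler_wpM2l// /r -powRrM -(powR_inv1 (ltW s0)) -powRD ?(gt_eqF s0) ?implybT//.
  by rewrite (_ : -1 + 4^-1 * al = al / 4 - 1) //; ring.
rewrite mulrAC ler_wpM2l ?mulr_ge0//.
by apply: ger_powR; [rewrite s0 ltW|lra].
Qed.

End HeatSemigroup.

(** * Rules for real integrals, including the non-integrable case *)

Section RintegralTools.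
Context d (T : measurableType d) (R : realType).
Variable mu : {measure set T -> \bar R}.

(** If the absolute integral is infinite, so is the integral of the positive or of the negative
    part; the extended integral is then infinite and its real value is 0 by convention. With this,
    scalar factors and the triangle inequality hold for every measurable function. *)
Lemma Rintegral_nonintegrable (f : T -> R) : measurable_fun setT f ->
  (\int[mu]_x `|f x|%:E = +oo)%E -> \int[mu]_x f x = 0.
Proof.
move=> mf h; rewrite /Rintegral integralE.
have : (\int[mu]_x ((EFin \o f)^\+ x) + \int[mu]_x ((EFin \o f)^\- x) = +oo)%E.
  rewrite -h -ge0_integralD//; last 2 first.
  - by apply: measurable_funepos; exact/measurable_EFinP.
  - by apply: measurable_funeneg; exact/measurable_EFinP.
  apply: eq_integral => x _.
  by have /(congr1 (fun k => k x)) := fune_abse (EFin \o f); rewrite /= => ->.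
have : (0 <= \int[mu]_x ((EFin \o f)^\+ x))%E by apply: integral_ge0 => x _; exact: funepos_ge0.
have : (0 <= \int[mu]_x ((EFin \o f)^\- x))%E by apply: integral_ge0 => x _; exact: funeneg_ge0.
by move: (integral _ _ _) (integral _ _ _) => [a| |] [b| |].
Qed.

Lemma Rintegral_integrableVnon (f : T -> R) : measurable_fun setT f ->
  mu.-integrable setT (EFin \o f) \/ (\int[mu]_x `|f x|%:E = +oo)%E.
Proof.
move=> mf; have [h|] := ltP (\int[mu]_x `|f x|%:E)%E +oo%E.
  by left; exact: integrable_EFinP.
by rewrite leye_eq => /eqP; right.
Qed.

Lemma RintegralZl_measurable (f : T -> R) (c : R) : measurable_fun setT f ->
  \int[mu]_x (c * f x) = c * \int[mu]_x f x.
Proof.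
move=> mf; have [fi|fn] := Rintegral_integrableVnon mf; first exact: RintegralZl.
have [->|c0] := eqVneq c 0.
  by rewrite mul0r; under eq_Rintegral do rewrite mul0r; rewrite Rintegral_cst// mul0r.
rewrite (Rintegral_nonintegrable mf fn) mulr0 Rintegral_nonintegrable//.
  exact: measurable_funM.
under eq_integral do rewrite normrM EFinM.
rewrite ge0_integralZl// ?fn ?gt0_muley ?lte_fin ?normr_gt0//.
by apply/measurable_EFinP; exact: measurableT_comp.
Qed.

Lemma normr_Rintegral_le (f : T -> R) : measurable_fun setT f ->
  `|\int[mu]_x f x| <= \int[mu]_x `|f x|.
Proof.
move=> mf; have [fi|fn] := Rintegral_integrableVnon mf; first exact: le_normr_Rintegral.
by rewrite (Rintegral_nonintegrable mf fn) normr0 Rintegral_ge0.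
Qed.

Lemma square_integrable_prod (f g : T -> R) :
  f \in Lfun mu 2%:E -> g \in Lfun mu 2%:E ->
  mu.-integrable setT (fun x => (f x * g x)%:E).
Proof.
move=> /square_integrableP[mf f2] /square_integrableP[mg g2].
have fin (h : T -> R) : (\int[mu]_x (h x ^+ 2)%:E < +oo)%E ->
    exists2 a : R, 0 <= a & (\int[mu]_x (h x ^+ 2)%:E <= a%:E)%E.
  have : (0 <= \int[mu]_x (h x ^+ 2)%:E)%E.
    by apply: integral_ge0 => x _; rewrite lee_fin sqr_ge0.
  by case: (integral _ _ _) => [a| |]//; rewrite lee_fin => a0 _; exists a.
have [[a a0 fa] [b b0 gb]] := (fin _ f2, fin _ g2).
apply: integrable_EFinP; first exact: measurable_funM.
by rewrite (le_lt_trans (cauchy_schwarz_integral mf mg a0 b0 fa gb))// ltry.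
Qed.

Lemma square_integrable_le (f g : T -> R) : measurable_fun setT f ->
  g \in Lfun mu 2%:E -> (forall x, `|f x| <= `|g x|) -> f \in Lfun mu 2%:E.
Proof.
move=> mf /square_integrableP[mg g2] fg; apply/square_integrableP; split => //.
apply: le_lt_trans g2; apply: ge0_le_integral => //.
- by move=> x _; rewrite lee_fin sqr_ge0.
- by apply/measurable_EFinP; exact: measurable_funX.
- by apply/measurable_EFinP; exact: measurable_funX.
- move=> x _; rewrite lee_fin -[f x ^+ 2]real_normK ?num_real//.
  by rewrite -[g x ^+ 2]real_normK ?num_real// lerXn2r ?nnegrE.
Qed.

Lemma Rintegral_dominated_cvg (f_ : nat -> T -> R) (f g : T -> R) :
  (forall n, measurable_fun setT (f_ n)) ->
  (forall x, f_ n x @[n --> \oo] --> f x) ->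
  mu.-integrable setT (EFin \o g) ->
  (forall n x, `|f_ n x| <= g x) ->
  \int[mu]_x f_ n x @[n --> \oo] --> \int[mu]_x f x.
Proof.
move=> mf cf ig fg.
have mf' : measurable_fun setT f.
  by apply: (measurable_fun_cvg mf) => x _; exact: cf.
have [fi _ H] := @dominated_convergence _ T R mu setT measurableT (fun n x => (f_ n x)%:E)
  (EFin \o f) (EFin \o g) ltac:(by move=> n; exact/measurable_EFinP) ltac:(exact/measurable_EFinP)
  ltac:(by apply: aeW => x _; apply: cvg_EFin; [exact: nearW|exact: cf]) ig
  ltac:(by apply: aeW => x n _; rewrite /= lee_fin).
by apply: fine_cvg; rewrite Rintegral_fine.
Qed.

End RintegralTools.

(** * Weak gradients tested against the heat kernel *)

Section WeakHeat.
Context {R : realType}.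
Notation leb := (@lebesgue_measure R).
Implicit Types (t : R) (z : plane R) (i : bool).

Lemma weak_gradient_cd i (f : plane R -> R) h : weak_gradient f h ->
  square_integrable (fun z => cd i (h z)) /\
  forall phi, test_function phi ->
    \int[leb2]_z (f z * 'D_(ev i) phi z) = - (\int[leb2]_z (cd i (h z) * phi z)).
Proof. by case=> h1 h2 h3; case: i; split => // phi /h3[]. Qed.

Lemma pk_square_integrable t (y : plane R) : 0 < t ->
  (fun x : bplane R => pk t (x - y)) \in Lfun leb2 2%:E.
Proof.
move=> t0; apply/square_integrableP; split; first exact: measurable_pk_x.
apply: (@le_lt_trans _ _ (\int[leb2]_x ((iv t)%:E * (pk t (x - y))%:E))%E).
  apply: ge0_le_integral => //.
  - by move=> x _; rewrite lee_fin sqr_ge0.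
  - by apply/measurable_EFinP; apply: measurable_funX; exact: measurable_pk_x.
  - by apply: measurable_funeM; apply/measurable_EFinP; exact: measurable_pk_x.
  - by move=> x _; rewrite -EFinM lee_fin expr2 ler_wpM2r ?pk_ge0 ?pk_le.
rewrite ge0_integralZl//.
- by rewrite integral_pk// mule1 ltry.
- by apply/measurable_EFinP; exact: measurable_pk_x.
- by move=> x _; rewrite lee_fin pk_ge0.
- by rewrite lee_fin iv_ge0.
Qed.

Lemma Dk_square_integrable i t (y : plane R) : 0 < t ->
  (fun x : bplane R => Dk i t (x - y)) \in Lfun leb2 2%:E.
Proof.
move=> t0; have t20 : 0 < 2 * t by rewrite mulr_gt0.
have /square_integrableP[m2 i2] := pk_square_integrable y t20.
have : (fun x : bplane R => 2 * t `^ (- 2^-1) * pk (2 * t) (x - y)) \in Lfun leb2 2%:E.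
  apply/square_integrableP; split; first exact: measurable_funM.
  under eq_integral do rewrite exprMn EFinM.
  rewrite ge0_integralZl//.
  - by rewrite lte_mul_pinfty// lee_fin sqr_ge0.
  - by apply/measurable_EFinP; exact: measurable_funX.
  - by move=> x _; rewrite lee_fin sqr_ge0.
  - by rewrite lee_fin sqr_ge0.
move=> hk; apply: (square_integrable_le _ hk).
  by apply: measurable_Dk => //; exact: measurable_planeB.
move=> x; apply: (le_trans (Dk_le _ _ t0)); exact: ler_norm.
Qed.

(** Cut-offs at scale [n.+1]. They converge to the positive constant [bump (-1) 1 0], not to 1; the
    constant appears on both sides of [weak_heat] and cancels. *)
Definition chi (n : nat) (s : R) : R := bump (-1) 1 (n.+1%:R^-1 * s).

Lemma smooth_chi n : smooth (chi n).
Proof.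
move=> k; apply: (smoothk_ext _ (smoothk_affine n.+1%:R^-1 0 (smooth_bump (-1) 1 k))) => s.
by rewrite addr0.
Qed.

Lemma chi_bound n s : 0 <= chi n s <= 1.
Proof. by rewrite /chi bump_ge0 bump_le1. Qed.

Lemma chi_out n s : s \notin `[- n.+1%:R, n.+1%:R] -> chi n s = 0.
Proof.
move=> h; apply/eqP; rewrite eq_le; have /andP[-> _] := chi_bound n s; rewrite andbT.
rewrite leNgt bump_gt0; apply: contra h => /andP[h1 h2]; rewrite in_itv/=.
have n0 : 0 < n.+1%:R :> R by [].
move: h1 h2; rewrite ltr_pdivlMl// ltr_pdivrMl// mulrN mulr1 => /ltW -> /ltW ->//.
Qed.

Lemma chi_cvg s : chi n s @[n --> \oo] --> bump (-1) 1 (0 : R).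
Proof.
have cb : continuous (bump (-1) 1 : R -> R) := smooth_bump (-1) 1 0.
apply: (cvg_comp (fun n => n.+1%:R^-1 * s) (bump (-1) 1)); last exact: cb.
rewrite -(mul0r s); apply: cvgM; last exact: cvg_cst.
exact: cvg_harmonic.
Qed.

Lemma chi_deriv : exists2 C : R, 0 <= C & exists chi' : nat -> R -> R,
  [/\ (forall n (s : R), is_derive s 1 (chi n) (chi' n s)),
  (forall n, continuous (chi' n)) &
  (forall n s, `|chi' n s| <= C / n.+1%:R)].
Proof.
have [b' db _] := smooth_bump (-1 : R) 1 1%N.
have [b'' db' _] : smoothk 1 b'.
  have [c' dc sc] := smooth_bump (-1 : R) 1 2%N.
  suff -> : b' = c' by exact: sc.
  apply/funext => x; rewrite -(@derive_val _ _ _ _ _ _ _ (dc x)).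
  by rewrite (@derive_val _ _ _ _ _ _ _ (db x)).
have cb' := is_derive1_continuous db'.
have : compact (b' @` `[-2, 2]).
  by apply: continuous_compact; [exact: continuous_subspaceT|exact: segment_compact].
move=> /compact_bounded[M [Mreal hM]]; exists (`|M| + 1); first by rewrite addr_ge0.
exists (fun n s => n.+1%:R^-1 * b' (n.+1%:R^-1 * s)); split.
  move=> n s.
  have D : is_derive s 1 (fun s : R => n.+1%:R^-1 * s) n.+1%:R^-1.
    by have := is_deriveZ n.+1%:R^-1 (is_derive_id s 1); rewrite [_ *: _]mulr1.
  have := @is_derive1_comp _ (bump (-1) 1) (fun s : R => n.+1%:R^-1 * s) s _ _ (db _) D.
  by rewrite mulrC.
  move=> n s; apply: cvgM; first exact: cvg_cst.
  apply: (cvg_comp (fun s : R => n.+1%:R^-1 * s) b'); last exact: cb'.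
  by apply: cvgM; [exact: cvg_cst|exact: cvg_id].
move=> n s; rewrite normrM [leRHS]mulrC ger0_norm ?invr_ge0// ler_wpM2l ?invr_ge0//.
set x := _ * s.
have [xI|xI] := boolP (x \in `[-2, 2]).
  by apply: hM; [rewrite (le_lt_trans (ler_norm M))// ltrDl|exists x].
(* Outside [-2, 2] the bump vanishes in a neighbourhood of [x]; the margin beyond [-1, 1] provides
   the neighbourhood. *)
suff -> : b' x = 0 by rewrite normr0 addr_ge0.
have Z y : 1 < `|y| -> bump (-1) 1 y = 0 :> R.
  move=> y1; apply/eqP; rewrite eq_le bump_ge0 andbT leNgt bump_gt0 -ltr_norml -leNgt ltW//.
have x1 : 1 < `|x|.
  by move: xI; rewrite in_itv/= -ler_norml -ltNge; apply: lt_trans; rewrite ltr1n.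
rewrite -(@derive_val _ _ _ _ _ _ _ (db x)) -(derive_cst (0 : R) x 1).
apply: near_eq_derive; near=> y; apply: Z; near: y.
have cn : continuous (@Num.norm R R) by exact: norm_continuous.
exact: (cvgr_gt _ (cn x)).
Unshelve. all: by end_near. Qed.

Definition chi2 (n : nat) (x : plane R) : R := tens (chi n) (chi n) x.

(** The linear factor of [Dk i] involves only the coordinate [i], so the cut-off kernel is a tensor
    product of smooth functions of compact support. *)
Lemma test_chi2_Dk i t (y : plane R) n :
  test_function (fun x => chi2 n x * Dk i t (x - y)).
Proof.
pose c := (2 * pi)^-1 * iv t.
pose P (z s : R) := chi n s * ((- iv t * s + iv t * z) * gs t z s).
pose Q (z s : R) := chi n s * gs t z s.
have sQ (z : R) : smooth (Q z) by move=> k; apply: smoothkM; [exact: smooth_chi|exact: smooth_gs].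
have sP (z : R) : smooth (P z).
  move=> k; apply: smoothkM; first exact: smooth_chi.
  by apply: smoothkM; [exact: (smoothk_affine _ _ (smoothk_id k))|exact: smooth_gs].
have scQ (z : R) : smooth (fun s => c * Q z s) by move=> k; exact: (smoothkZ c (sQ z k)).
have PQ0 (z s : R) : s \notin `[- n.+1%:R, n.+1%:R] -> P z s = 0 /\ Q z s = 0.
  by move=> /chi_out h; rewrite /P /Q h !mul0r.
pose a := if i then (fun s => c * Q y.1 s) else P y.1.
pose b := if i then P y.2 else (fun s => c * Q y.2 s).
rewrite (_ : (fun _ => _) = tens a b); last first.
  apply/funext => x; rewrite /Dk (congr1 (fun f => f x) (pk_tens t y)) -/c.
  by rewrite /chi2 /tens /a /b /P /Q; case: (i) => /=; ring.
apply: (@test_tens _ n.+1%:R).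
- by rewrite /a; case: (i).
- by rewrite /b; case: (i).
- by move=> s hs; rewrite /a; case: (i); rewrite ?(PQ0 _ _ hs).1 ?(PQ0 _ _ hs).2 ?mulr0.
- by move=> s hs; rewrite /b; case: (i); rewrite ?(PQ0 _ _ hs).1 ?(PQ0 _ _ hs).2 ?mulr0.
Qed.

(** The kernel is not compactly supported, so the weak gradient is tested on its cut-offs. The term
    in which the cut-off is differentiated is O(1/n); the others converge by domination, on the left
    because [h] and [Dk] are square-integrable, on the right because [f] has compact support. *)
Lemma weak_heat i (f : plane R -> R) h t (y : plane R) : C0 f -> weak_gradient f h -> 0 < t ->
  \int[leb2]_x (cd i (h x) * Dk i t (x - y)) = - \int[leb2]_x (f x * DDk i t (x - y)).
Proof.
move=> [cf sf] /(weak_gradient_cd i)[h2 wg] t0.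
have mf : measurable_fun setT (f : bplane R -> R) := continuous_plane_measurable cf.
have [r r0 sfr] := compactly_supported_box sf.
have [C C0 [chi' [dchi cchi' chib]]] := @chi_deriv.
pose chid n (x : plane R) := chi' n (cd i x) * chi n (cd (~~ i) x).
have mDk : measurable_fun setT (fun x : bplane R => Dk i t (x - y)).
  by apply: measurable_Dk => //; exact: measurable_planeB.
have mDDk : measurable_fun setT (fun x : bplane R => DDk i t (x - y)).
  by apply: measurable_DDk => //; exact: measurable_planeB.
have cchi n : continuous (chi n : R -> R) := @smooth_chi n 0%N.
have cchi2 n : continuous (chi2 n) := continuous_tens (cchi n) (cchi n).
have dchi2 n x : is_derive x (ev i) (chi2 n) (chid n x).
  rewrite /chid; case: i {h2 wg chid mDk mDDk} => /=.
    have := is_derive_tens2 (chi n) x (dchi n).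
    by move/is_derive_eq; apply; rewrite /tens mulrC.
  exact: (is_derive_tens1 (chi n) x (dchi n)).
have chi2b n x : `|chi2 n x| <= 1.
  have /andP[? ?] := chi_bound n x.1; have /andP[? ?] := chi_bound n x.2.
  by rewrite /chi2 /tens ger0_norm; [exact: mulr_ile1|exact: mulr_ge0].
have chidb n x : `|chid n x| <= C / n.+1%:R.
  rewrite /chid normrM -[leRHS]mulr1 ler_pM//.
  by have /andP[? ?] := chi_bound n (cd (~~ i) x); rewrite ger0_norm.
have dphi n x : is_derive x (ev i) (fun x => chi2 n x * Dk i t (x - y))
    (chi2 n x * DDk i t (x - y) + Dk i t (x - y) * chid n x).
  exact: is_deriveM (dchi2 n x) (is_derive_Dk i t y x).
have E n : \int[leb2]_x (f x * (chi2 n x * DDk i t (x - y) + Dk i t (x - y) * chid n x)) =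
    - \int[leb2]_x (cd i (h x) * (chi2 n x * Dk i t (x - y))).
  rewrite -wg; last exact: test_chi2_Dk.
  by apply: eq_Rintegral => x _; rewrite (@derive_val _ _ _ _ _ _ _ (dphi n x)).
pose b0 : R := bump (-1) 1 0.
have b00 : 0 < b0 by rewrite bump_gt0; apply/andP; split; lra.
have chi2cvg x : chi2 n x @[n --> \oo] --> b0 * b0.
  by apply: cvgM; exact: chi_cvg.
have Cn0 : C / n.+1%:R @[n --> \oo] --> (0 : R).
  by rewrite -(mulr0 C); apply: cvgM; [exact: cvg_cst|exact: cvg_harmonic].
have chidcvg x : chid n x @[n --> \oo] --> (0 : R).
  apply/cvgrPdist_le => e e0; near=> n.
  rewrite sub0r normrN (le_trans (chidb n x))//.
  by near: n; have /cvgrPdist_le/(_ _ e0) := Cn0; apply: filterS => n; rewrite sub0r normrN; apply: le_trans; exact: ler_norm.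
have m1 n : measurable_fun setT (fun x : bplane R =>
    f x * (chi2 n x * DDk i t (x - y) + Dk i t (x - y) * chid n x)).
  apply: measurable_funM => //; apply: measurable_funD; apply: measurable_funM => //.
    exact: continuous_plane_measurable.
  apply: measurable_funM.
    by apply: (measurableT_comp (continuous_measurable_fun (cchi' n))); exact: measurable_cd.
  by apply: (measurableT_comp (continuous_measurable_fun (cchi n))); exact: measurable_cd.
have L1 : \int[leb2]_x (f x * (chi2 n x * DDk i t (x - y) + Dk i t (x - y) * chid n x))
    @[n --> \oo] --> \int[leb2]_x (f x * (b0 * b0 * DDk i t (x - y) + Dk i t (x - y) * 0)).
  apply: (@Rintegral_dominated_cvg _ _ _ leb2 _ _
    (fun x => `|f x| * (`|DDk i t (x - y)| + C * `|Dk i t (x - y)|))) => //.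
  - move=> x; apply: cvgM; first exact: cvg_cst.
    by apply: cvgD; apply: cvgM => //; exact: cvg_cst.
  - apply: (@supp_in_integrable _ r); last by move=> x nx; rewrite sfr// normr0 mul0r.
    have cn : continuous (@Num.norm R R) by exact: norm_continuous.
    move=> x; apply: cvgM; first exact: (cvg_comp f _ (cf x) (cn _)).
    apply: cvgD; first exact: (cvg_comp _ _ (@continuous_DDk _ i t y x) (cn _)).
    apply: cvgM; first exact: cvg_cst.
    exact: (cvg_comp _ _ (@continuous_Dk _ i t y x) (cn _)).
  - move=> n x; rewrite normrM ler_wpM2l// (le_trans (ler_normD _ _))// lerD//.
      by rewrite normrM ler_piMl.
    rewrite normrM mulrC ler_wpM2r// (le_trans (chidb n x))//.
    by rewrite ler_pdivrMr// ler_peMr// ler1n.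
have L2 : \int[leb2]_x (cd i (h x) * (chi2 n x * Dk i t (x - y)))
    @[n --> \oo] --> \int[leb2]_x (cd i (h x) * (b0 * b0 * Dk i t (x - y))).
  have iD := square_integrable_prod h2 (Dk_square_integrable i y t0).
  have mh : measurable_fun setT (fun x : bplane R => cd i (h x)).
    by have /square_integrableP[] := h2.
  apply: (@Rintegral_dominated_cvg _ _ _ leb2 _ _
    (fun x => `|cd i (h x) * Dk i t (x - y)|)) => //.
  - move=> n; apply: measurable_funM => //; apply: measurable_funM => //.
    exact: continuous_plane_measurable.
  - by move=> x; apply: cvgM; [exact: cvg_cst|apply: cvgM => //; exact: cvg_cst].
  - exact: integrable_norm iD.
  - by move=> n x; rewrite mulrCA normrM ler_piMl.
have E2 : \int[leb2]_x (f x * (b0 * b0 * DDk i t (x - y) + Dk i t (x - y) * 0)) =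
    - \int[leb2]_x (cd i (h x) * (b0 * b0 * Dk i t (x - y))).
  move: L1; under eq_fun do rewrite E.
  by move=> L1; exact: (cvg_unique _ L1 (cvgN L2)).
have mh : measurable_fun setT (fun x : bplane R => cd i (h x)).
  by have /square_integrableP[] := h2.
move: E2; under eq_Rintegral do rewrite mulr0 addr0 mulrCA.
rewrite RintegralZl_measurable; last exact: measurable_funM.
under [in X in _ = X -> _]eq_Rintegral do rewrite mulrCA.
rewrite RintegralZl_measurable; last exact: measurable_funM.
rewrite -mulrN => /mulfI -> //; first by rewrite opprK.
by rewrite mulf_neq0 ?gt_eqF.
Unshelve. all: by end_near. Qed.

End WeakHeat.

(** * Pointwise resolvent representation of a continuous function of the domain *)

Section Representation.
Context {R : realType}.
Notation leb := (@lebesgue_measure R).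
Implicit Types (t : R) (z : plane R) (i : bool).

Lemma Rintegral_indicM d (T : measurableType d) (mu : {measure set T -> \bar R})
    (A : set T) (g : T -> R) :
  \int[mu]_t (\1_A t * g t) = \int[mu]_(t in A) g t.
Proof.
rewrite [RHS]Rintegral_mkcond; apply: eq_Rintegral => t _; rewrite patchE indicE.
by case: ifP => _; rewrite ?mul1r ?mul0r.
Qed.

Lemma integral_pk_comb (c1 c2 : R) t (y : plane R) : 0 <= c1 -> 0 <= c2 -> 0 < t ->
  (\int[leb2]_x (c1 * pk t (x - y) + c2 * pk (2 * t) (x - y))%:E = (c1 + c2)%:E)%E.
Proof.
move=> c10 c20 t0; have t20 : 0 < 2 * t by rewrite mulr_gt0.
have i1 := integrableZl measurableT c1 (integrable_pk y t0).
have i2 := integrableZl measurableT c2 (integrable_pk y t20).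
rewrite -Rintegral_fine; last exact: (integrableD measurableT i1 i2).
by rewrite (RintegralD measurableT i1 i2) !Rintegral_cpk.
Qed.

(** The integrand, in time [t] and space [x], of E_1(g(., y), f), where g is the 1-resolvent kernel,
    the time integral of [wt t * pk t (x - y)], and [h] stands for the gradient of [f]. *)
Definition heat_kernel_pairing (f : plane R -> R) (h : plane R -> plane R) (y : plane R)
    (t : R) (x : plane R) : R :=
  wt t * (2^-1 * (cd false (h x) * Dk false t (x - y) + cd true (h x) * Dk true t (x - y))
    + f x * pk t (x - y)).

Lemma measurable_pairing d (T : measurableType d) (f : plane R -> R) h
    (ft : T -> R) (fx fy : T -> bplane R) :
  measurable_fun setT (f : bplane R -> R) ->
  (forall i, measurable_fun setT (fun x : bplane R => cd i (h x))) ->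
  measurable_fun setT ft -> measurable_fun setT fx -> measurable_fun setT fy ->
  measurable_fun setT (fun w => heat_kernel_pairing f h (fy w) (ft w) (fx w)).
Proof.
move=> mf mh mft mfx mfy.
have mxy := measurable_planeB mfx mfy.
apply: measurable_funM; first exact: measurable_wt.
apply: measurable_funD.
  apply: measurable_funM => //; apply: measurable_funD; apply: measurable_funM.
  - exact: (measurableT_comp (mh false) mfx).
  - exact: measurable_Dk.
  - exact: (measurableT_comp (mh true) mfx).
  - exact: measurable_Dk.
apply: measurable_funM; first exact: (measurableT_comp mf mfx).
exact: measurable_pk.
Qed.

Section Rep.
Variables (f : plane R -> R) (h : plane R -> plane R) (y : plane R).
Hypotheses (Cf : C0 f) (wf : weak_gradient f h).
Hypothesis fin :
  (\int[leb]_t \int[leb2]_x `|heat_kernel_pairing f h y t x|%:E < +oo)%E.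

Let cf : continuous f := Cf.1.
Let mf : measurable_fun setT (f : bplane R -> R) := continuous_plane_measurable cf.
Let mh i : measurable_fun setT (fun x : bplane R => cd i (h x)).
Proof. by have [/square_integrableP[]] := weak_gradient_cd i wf. Qed.

(** The operator 1 - Laplacian/2 applied to [pk t (x - y)]. *)
Let LL t (x : plane R) : R := pk t (x - y) - 2^-1 * (DDk false t (x - y) + DDk true t (x - y)).

Let mLL : measurable_fun setT (fun tx : R * bplane R => LL tx.1 tx.2).
Proof.
have mxy : measurable_fun setT (fun tx : R * bplane R => tx.2 - y : bplane R).
  by apply: measurable_planeB => //; exact: measurable_snd.
have m1 : measurable_fun setT (fst : R * bplane R -> R) by exact: measurable_fst.
apply: measurable_funB; first exact: measurable_pk.
by apply: measurable_funM => //; apply: measurable_funD; exact: measurable_DDk.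
Qed.

Let J t := \int[leb2]_x heat_kernel_pairing f h y t x.

(** At a fixed positive time everything is integrable in space, and [weak_heat] moves the gradient
    onto the kernel. *)
Let JE t : 0 < t -> J t = wt t * \int[leb2]_x (f x * LL t x).
Proof.
move=> t0; have [r r0 sfr] := compactly_supported_box Cf.2.
have [C C0' fC] := supp_in_bounded cf sfr.
have ih i : leb2.-integrable setT (fun x : bplane R => (cd i (h x) * Dk i t (x - y))%:E).
  apply: square_integrable_prod; last exact: Dk_square_integrable.
  by have [] := weak_gradient_cd i wf.
have ip := integrable_bounded_pk y t0 mf fC.
have iD i : leb2.-integrable setT (fun x : bplane R => (f x * DDk i t (x - y))%:E).
  apply: (@supp_in_integrable _ r); last by move=> x nx; rewrite sfr// mul0r.
  by move=> x; apply: cvgM; [exact: cf|exact: continuous_DDk].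
have mDh i : measurable_fun setT (fun x : bplane R => cd i (h x) * Dk i t (x - y)).
  by apply: measurable_funM => //; apply: measurable_Dk => //; exact: measurable_planeB.
have mDD i : measurable_fun setT (fun x : bplane R => f x * DDk i t (x - y)).
  by apply: measurable_funM => //; apply: measurable_DDk => //; exact: measurable_planeB.
have mfp : measurable_fun setT (fun x : bplane R => f x * pk t (x - y)).
  by apply: measurable_funM => //; exact: measurable_pk_x.
rewrite /J /heat_kernel_pairing RintegralZl_measurable; last first.
  apply: measurable_funD => //; apply: measurable_funM => //.
  by apply: measurable_funD; exact: mDh.
congr (_ * _).
have ihs := integrableD measurableT (ih false) (ih true).
rewrite RintegralD//; last exact: (integrableZl measurableT 2^-1 ihs).
rewrite RintegralZl_measurable; last by apply: measurable_funD; exact: mDh.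
rewrite (RintegralD measurableT (ih false) (ih true)) !(weak_heat _ _ Cf wf t0).
rewrite [RHS](eq_Rintegral leb2 (g := fun x : plane R => f x * pk t (x - y) -
    2^-1 * (f x * DDk false t (x - y) + f x * DDk true t (x - y)))); last first.
  by move=> x _; rewrite /LL; ring.
have iDs := integrableD measurableT (iD false) (iD true).
rewrite RintegralB//; last exact: (integrableZl measurableT 2^-1 iDs).
rewrite RintegralZl_measurable; last by apply: measurable_funD; exact: mDD.
by rewrite (RintegralD measurableT (iD false) (iD true)); ring.
Qed.

Let mJ : measurable_fun setT (fun tx : measurableTypeR R * bplane R => heat_kernel_pairing f h y tx.1 tx.2).
Proof. exact: measurable_pairing. Qed.

(** Away from time 0 the function [G] below is absolutely integrable in time and space. Fubini then
    puts the time integral innermost, where the integrand is the exact derivative of e^-t p_t, up to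
    sign. *)
Let truncated (a b : R) : 0 < a -> a < b ->
  \int[leb]_t (\1_(`[a, b]%classic : set R) t * J t) =
  expR (- a) * \int[leb2]_x (f x * pk a (x - y)) - expR (- b) * \int[leb2]_x (f x * pk b (x - y)).
Proof.
move=> a0 ab; have b0 := lt_trans a0 ab.
have [r r0 sfr] := compactly_supported_box Cf.2.
have [C C0' fC] := supp_in_bounded cf sfr.
pose A : set R := `[a, b]%classic.
pose G (t : R) (x : plane R) : R := \1_A t * (expR (- t) * (f x * LL t x)).
have mG : measurable_fun setT (fun tx : measurableTypeR R * bplane R => G tx.1 tx.2).
  apply: measurable_funM.
    by apply: (measurableT_comp (measurable_indic (measurable_itv _))); exact: measurable_fst.
  apply: measurable_funM.
    apply: measurableT_comp => //; apply: measurableT_comp => //; exact: measurable_fst.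
  by apply: measurable_funM => //; exact: (measurableT_comp mf measurable_snd).
have Gb t x : `|G t x| <= C * \1_A t * (pk t (x - y) + 10 * iv a * pk (2 * t) (x - y)).
  rewrite /G indicE; have [|tA] := boolP (t \in A); last first.
    by rewrite mul0r normr0 mulr0 mul0r.
  rewrite inE /A /= in_itv/= => /andP[at_ tb].
  have t0 := lt_le_trans a0 at_.
  rewrite mul1r mulr1 !normrM [`|expR _|]ger0_norm ?expR_ge0//.
  rewrite mulrA ler_pM ?mulr_ge0 ?expR_ge0//.
    rewrite -[leRHS]mul1r ler_pM ?expR_ge0//; first by rewrite expR_le1 oppr_le0 ltW.
  rewrite (le_trans (ler_normB _ _))// ger0_norm ?pk_ge0// lerD2l.
  rewrite normrM ger0_norm// (le_trans (ler_wpM2l _ (ler_normD _ _)))//.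
  have hiv : iv t <= iv a by rewrite !ivE// lef_pV2.
  have hD i : `|DDk i t (x - y)| <= 10 * iv a * pk (2 * t) (x - y).
    by rewrite (le_trans (DDk_le _ _ t0))// ler_wpM2r ?pk_ge0// ler_wpM2l.
  by have := hD false; have := hD true; lra.
have inner t : (\int[leb2]_x `|G t x|%:E <= (C * (1 + 10 * iv a) * \1_A t)%:E)%E.
  have [tA|tA] := boolP (t \in A); last first.
    rewrite indicE (negbTE tA) mulr0 integral0_eq// => x _.
    by rewrite /G indicE (negbTE tA) mul0r normr0.
  have t0 : 0 < t.
    by move: tA; rewrite inE /A /= in_itv/= => /andP[+ _]; exact: lt_le_trans.
  have c0 : 0 <= C * \1_A t by rewrite mulr_ge0.
  have c1 : 0 <= C * \1_A t * (10 * iv a).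
    by apply: mulr_ge0 => //; rewrite mulr_ge0 ?iv_ge0.
  rewrite (_ : C * (1 + 10 * iv a) * \1_A t = C * \1_A t + C * \1_A t * (10 * iv a)); last ring.
  rewrite -(integral_pk_comb y c0 c1 t0).
  apply: ge0_le_integral => //.
  - apply/measurable_EFinP.
    exact: (measurableT_comp (@normr_measurable R setT) (measurable_fun_pair2 t mG)).
  - apply/measurable_EFinP; apply: measurable_funD; apply: measurable_funM => //; exact: measurable_pk_x.
  - move=> x _; rewrite lee_fin (le_trans (Gb t x))//.
    by rewrite le_eqVlt; apply/orP; left; apply/eqP; ring.
have Gfin : (\int[leb]_t \int[leb2]_x `|G t x|%:E < +oo)%E.
  apply: (@le_lt_trans _ _ (\int[leb]_t (C * (1 + 10 * iv a) * \1_A t)%:E)%E).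
    apply: ge0_le_integral => //.
    - by move=> t _; apply: integral_ge0.
    - apply: (@sf_measurable_tonelli _ _ _ _ _ leb2 sigma_finite_leb2 (fun tx => `|G tx.1 tx.2|%:E)) => //.
      by apply/measurable_EFinP; exact: measurableT_comp.
    - apply/measurable_EFinP; apply: measurable_funM => //.
      exact: (measurable_indic (measurable_itv _)).
  under eq_integral do rewrite EFinM.
  rewrite ge0_integralZl//; last 2 first.
  - by apply/measurable_EFinP; exact: (measurable_indic (measurable_itv _)).
  - by rewrite lee_fin mulr_ge0// addr_ge0// mulr_ge0 ?iv_ge0.
  have -> : (\int[leb]_t (\1_A t)%:E = leb A)%E.
    rewrite -[in RHS](setIT A); exact: (integral_indic leb measurableT (measurable_itv _)).
  rewrite lte_mul_pinfty ?lee_fin//.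
    by rewrite mulr_ge0// addr_ge0// mulr_ge0 ?iv_ge0.
  by have := ltry (b - a); rewrite -(leb_itvcc (ltW ab)).
transitivity (\int[leb]_t \int[leb2]_x G t x).
  apply: eq_Rintegral => t _; rewrite /G indicE.
  have [tA|tA] := boolP (t \in A); last first.
    by rewrite mul0r; under eq_Rintegral do rewrite mul0r; rewrite Rintegral_cst// mul0r.
  have t0 : 0 < t.
    by move: tA; rewrite inE /A /= in_itv/= => /andP[+ _]; exact: lt_le_trans.
  rewrite mul1r JE// /wt t0 -RintegralZl_measurable; last first.
    exact: measurable_funM mf (measurable_fun_pair2 t mLL).
  by apply: eq_Rintegral => x _; rewrite mul1r.
rewrite (@sf_Rintegral_fubini _ _ _ _ _ leb leb2 sigma_finite_leb sigma_finite_leb2 G mG Gfin).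
have ipa := integrable_bounded_pk y a0 mf fC.
have ipb := integrable_bounded_pk y b0 mf fC.
rewrite -(RintegralZl _ measurableT ipa) -(RintegralZl _ measurableT ipb).
rewrite -(RintegralB measurableT (integrableZl measurableT _ ipa) (integrableZl measurableT _ ipb)).
apply: eq_Rintegral => x _.
rewrite (eq_Rintegral leb (g := fun t => f x * (\1_A t * (expR (- t) * LL t x)))); last first.
  by move=> t _; rewrite /G; ring.
rewrite RintegralZl_measurable; last first.
  apply: measurable_funM; first exact: (measurable_indic (measurable_itv _)).
  apply: measurable_funM; last exact: (measurable_fun_pair1 x mLL).
  by apply: measurableT_comp => //; exact: measurableT_comp.
rewrite Rintegral_indicM /Rintegral integral_pk_time//=; ring.
Qed.

(** Time is truncated. Absolute convergence gives the limit of the truncated integrals; on the other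
    hand their boundary term near 0 tends to [f y] by [cvg_heat] and the one near infinity is killed
    by the exponential. *)
Lemma heat_representation :
  \int[leb]_t (\int[leb2]_x heat_kernel_pairing f h y t x) = f y.
Proof.
have iJ := @sf_Rsection_integrable _ _ _ _ _ leb leb2 sigma_finite_leb sigma_finite_leb2 _ mJ fin.
(* The shift by 2 keeps the left end point strictly below the right one. *)
pose A n : set R := `[n.+2%:R^-1, n.+2%:R]%classic.
have [r r0 sfr] := compactly_supported_box Cf.2.
have [C C0' fC] := supp_in_bounded cf sfr.
have L1 : \int[leb]_t (\1_(A n) t * J t) @[n --> \oo] --> \int[leb]_t J t.
  have mJ' : measurable_fun setT J :=
    @sf_measurable_Rsection _ _ _ _ _ leb leb2 sigma_finite_leb sigma_finite_leb2 _ mJ fin.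
  apply: (@Rintegral_dominated_cvg _ _ _ leb _ _ (fun t => `|J t|)) => //.
  - by move=> n; apply: measurable_funM => //; exact: (measurable_indic (measurable_itv _)).
  - move=> t; have [t0|t0] := ltP 0 t; last first.
      suff -> : J t = 0 by under eq_fun do rewrite mulr0; exact: cvg_cst.
      rewrite /J (eq_Rintegral leb2 (g := fun=> 0)) ?Rintegral_cst ?mul0r// => x _.
      by rewrite /heat_kernel_pairing /wt ltNge t0 mul0r.
    rewrite -[X in _ --> X]mul1r; apply: cvgM; last exact: cvg_cst.
    apply: cvg_near_cst; near=> n; rewrite indicE; apply/eqP; rewrite pnatr_eq1 eqb1 inE.
    rewrite /A /= in_itv/=; apply/andP; split.
      rewrite (@le_trans _ _ n.+1%:R^-1)//; first by rewrite lef_pV2 ?posrE// ler_nat.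
      by rewrite ltW//; near: n; exact: near_infty_natSinv_lt (PosNum t0).
    rewrite ltW// (@lt_le_trans _ _ (Num.truncn t).+1%:R)//; first exact: truncnS_gt.
    by rewrite ler_nat; near: n; exists (Num.truncn t) => // n /= hn; rewrite ltnS ltnW.
  - exact: integrable_norm.
  - by move=> n t; rewrite normrM ler_piMl// indicE; case: (_ \in _); rewrite ?normr1 ?normr0.
have L2 : \int[leb]_t (\1_(A n) t * J t) @[n --> \oo] --> f y.
  have -> : (fun n => \int[leb]_t (\1_(A n) t * J t)) = (fun n =>
      expR (- n.+2%:R^-1) * \int[leb2]_x (f x * pk n.+2%:R^-1 (x - y))
      - expR (- n.+2%:R) * \int[leb2]_x (f x * pk n.+2%:R (x - y))).
    apply/funext => n; apply: truncated; first by rewrite invr_gt0.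
    by rewrite (@lt_trans _ _ 1)// ?ltr1n// invf_lt1// ltr1n.
  rewrite -[X in _ --> X]subr0 -[X in _ --> X - _]mul1r.
  have H := @cvg_heat R f C y cf fC.
  have Hh : n.+2%:R^-1 @[n --> \oo] --> (0 : R).
    by have := @cvg_harmonic R; rewrite -cvg_shiftS.
  have He : expR (- n.+2%:R^-1) @[n --> \oo] --> (1 : R).
    rewrite (_ : nbhs (1 : R) = nbhs (expR (- (0 : R)))); last by rewrite oppr0 expR0.
    have Hn : (- n.+2%:R^-1 : R) @[n --> \oo] --> - (0 : R) by apply: cvgN; exact: Hh.
    exact: (cvg_comp (fun n => - n.+2%:R^-1 : R) expR Hn (@continuous_expR R (- 0))).
  rewrite -cvg_shiftS in H.
  apply: cvgB; first by apply: cvgM; [exact: He|exact: H].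
  - apply/cvgrPdist_le => e e0; near=> n.
    rewrite sub0r normrN normrM ger0_norm ?expR_ge0//.
    have h1 := Rintegral_pk_le y (ltr0Sn R n.+1) mf fC.
    have h2 : expR (- n.+2%:R) <= n.+1%:R^-1 :> R.
      rewrite expRN lef_pV2 ?posrE ?expR_gt0//.
      apply: le_trans (expR_ge1Dx _); rewrite -natr1 addrC lerD// ler_nat; exact: leqW.
    rewrite (le_trans (ler_pM _ _ h2 h1)) ?expR_ge0//.
    rewrite (@le_trans _ _ (n.+1%:R^-1 * (C + 1)))// ?ler_wpM2l ?lerDl//.
    have C1 : 0 < C + 1 by rewrite ltr_wpDl.
    rewrite -ler_pdivlMr// ltW//; near: n.
    have eC : 0 < e / (C + 1) by rewrite divr_gt0// ltr_wpDl.
    exact: near_infty_natSinv_lt (PosNum eC).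
exact: (cvg_unique _ L1 L2).
Unshelve. all: by end_near. Qed.

End Rep.

End Representation.

(** * Functions with vanishing integrals, and uniqueness of the weak gradient *)

Section NullIntegrals.
Context d (T : measurableType d) (R : realType) (mu : {measure set T -> \bar R}).

Lemma integrableM_bounded (k w : T -> R) : mu.-integrable setT (EFin \o k) ->
  measurable_fun setT w -> (forall x, `|w x| <= 1) ->
  mu.-integrable setT (EFin \o (fun x => k x * w x)).
Proof.
move=> ik mw w1; have mk : measurable_fun setT k by apply/measurable_EFinP; case/integrableP: ik.
apply: (le_integrable measurableT _ _ ik).
  by apply/measurable_EFinP; exact: measurable_funM.
by move=> x _; rewrite /= lee_fin normrM ler_piMr.
Qed.

Lemma indic_norm_le1 d' (T' : measurableType d') (A : set T') x : `|\1_A x : R| <= 1.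
Proof. by rewrite indicE; case: (_ \in _); rewrite ?normr0 ?normr1. Qed.

Lemma measurable_indic_comp d' (T' : measurableType d') (p : T -> T') (A : set T') :
  measurable_fun setT p -> measurable A -> measurable_fun setT (fun x => \1_A (p x) : R).
Proof. by move=> mp mA; exact: (measurableT_comp (measurable_indic mA) mp). Qed.

Lemma Rintegral_limit0 (k : T -> R) (w_ : nat -> T -> R) (w : T -> R) :
  mu.-integrable setT (EFin \o k) ->
  (forall n, measurable_fun setT (w_ n)) -> (forall n x, `|w_ n x| <= 1) ->
  (forall x, w_ n x @[n --> \oo] --> w x) ->
  (forall n, \int[mu]_x (k x * w_ n x) = 0) -> \int[mu]_x (k x * w x) = 0.
Proof.
move=> ik mw w1 ww h.
have mk : measurable_fun setT k by apply/measurable_EFinP; case/integrableP: ik.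
have : \int[mu]_x (k x * w_ n x) @[n --> \oo] --> \int[mu]_x (k x * w x).
  apply: (@Rintegral_dominated_cvg _ _ _ mu _ _ (fun x => `|k x|)) => //.
  - by move=> n; exact: measurable_funM.
  - by move=> x; apply: cvgM; [exact: cvg_cst|exact: ww].
  - exact: integrable_norm.
  - by move=> n x; rewrite normrM ler_piMr.
rewrite (_ : (fun n => _) = fun=> 0); last exact/funext.
move=> H; have H0 := @cvg_cst R 0 nat \oo _.
exact: (cvg_unique _ H (H0 _)).
Qed.

(** Dynkin's argument for the signed set function sending A to the integral of [k] over the preimage
    of A under [p]. With [p] a coordinate or the identity, the Borel sets of the plane are reached
    one coordinate at a time. *)
Lemma dynkin_null d' (T' : measurableType d') (p : T -> T') (G : set (set T')) (k : T -> R) :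
  measurable_fun setT p -> @measurable _ T' = <<s G >> -> setI_closed G ->
  mu.-integrable setT (EFin \o k) -> \int[mu]_x k x = 0 ->
  (forall A, G A -> \int[mu]_x (k x * \1_A (p x)) = 0) ->
  forall A, measurable A -> \int[mu]_x (k x * \1_A (p x)) = 0.
Proof.
move=> mp GE GI ik k0 hG A mA.
have mk : measurable_fun setT k by apply/measurable_EFinP; case/integrableP: ik.
have := mA; rewrite GE; move: A mA => A0 _.
apply: (dynkin_induction (P := fun A => \int[mu]_x (k x * \1_A (p x)) = 0)) => //.
- rewrite -[RHS]k0; apply: eq_Rintegral => x _; rewrite indicE in_setT mulr1//.
- move=> A mA hA.
  rewrite (eq_Rintegral mu (g := fun x => k x - k x * \1_A (p x))); last first.
    by move=> x _; rewrite !indicE in_setC; case: (_ \in _); rewrite /= !(mulr0, mulr1) ?subr0 ?subrr.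
  rewrite RintegralB//; first by rewrite k0 hA subrr.
  by apply: integrableM_bounded => //; [exact: measurable_indic_comp|move=> x; exact: indic_norm_le1].
- move=> F mF tF hF.
  apply: (@Rintegral_limit0 k (fun n x => \1_(\big[setU/set0]_(i < n) F i) (p x))) => //.
  + by move=> n; apply: measurable_indic_comp => //; exact: bigsetU_measurable.
  + by move=> n x; exact: indic_norm_le1.
  + move=> x; apply: cvg_near_cst; have [[i _ Fi]|nF] := pselect ((\bigcup_i F i) (p x)).
      exists i.+1 => // n /= ni; rewrite !indicE; congr (_%:R); congr nat_of_bool.
      apply/idP/idP; rewrite !inE => _; first by exists i.
      by rewrite -bigcup_mkord; exists i.
    exists 0%N => // n _; rewrite !indicE; congr (_%:R); congr nat_of_bool.
    apply/idP/idP; rewrite !inE => H; exfalso; apply: nF => //.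
    by move: H; rewrite -bigcup_mkord => -[i _ ?]; exists i.
  + move=> n; rewrite (eq_Rintegral mu (g := fun x => \sum_(i < n) (k x * \1_(F i) (p x)))).
      elim: n => [|n ih].
        by under eq_Rintegral do rewrite big_ord0; rewrite Rintegral_cst ?mul0r.
      have is_ i : mu.-integrable setT (EFin \o (fun x => k x * \1_(F i) (p x))).
        by apply: integrableM_bounded => //; [exact: measurable_indic_comp|move=> x; exact: indic_norm_le1].
      under eq_Rintegral do rewrite big_ord_recr/=.
      rewrite RintegralD//; first by rewrite ih hF addr0.
      rewrite [X in _.-integrable _ X](_ : _ = fun x => (\sum_(i < n) (k x * \1_(F i) (p x))%:E)%E).
        by apply: integrable_sum => // i _; exact: is_.
      by apply/funext => x; rewrite /= sumEFin.
    move=> x _; rewrite -mulr_sumr; congr (_ * _).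
    elim: n => [|n ih]; first by rewrite !big_ord0 indic0.
    rewrite !big_ord_recr/= -ih !indicE in_setU.
    have [xn|xn] := boolP (p x \in F n); last by rewrite orbF addr0.
    suff /negbTE -> : p x \notin \big[setU/set0]_(i < n) F i by rewrite add0r.
    apply/negP; rewrite inE -bigcup_mkord => -[i /= ni Fi].
    have : (F i `&` F n) (p x) by split => //; move: xn; rewrite inE.
    by move: tF => /trivIsetP/(_ i n I I); rewrite neq_ltn ni => /(_ isT) ->.
Qed.

Lemma Rintegral_null_ae (k : T -> R) : mu.-integrable setT (EFin \o k) ->
  (forall A, measurable A -> \int[mu]_x (k x * \1_A x) = 0) ->
  {ae mu, forall x, k x = 0}.
Proof.
move=> ik h; have mk : measurable_fun setT k by apply/measurable_EFinP; case/integrableP: ik.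
pose A := [set x | 0 <= k x].
have mA : measurable A.
  by rewrite /A -[X in measurable X]setTI; apply: measurable_fun_le => //; exact: measurable_cst.
have E x : `|k x| = k x * \1_A x - k x * \1_(~` A) x.
  rewrite !indicE in_setC; have [xA|xA] := boolP (x \in A).
    by rewrite mulr1 mulr0 subr0 ger0_norm//; move: xA; rewrite inE.
  rewrite mulr0 mulr1 sub0r ler0_norm// ltW//; move: xA; rewrite notin_setE /A/= => /negP.
  by rewrite -ltNge.
have i1 B : measurable B -> mu.-integrable setT (EFin \o (fun x => k x * \1_B x)).
  move=> mB; apply: integrableM_bounded => //; last by move=> x; exact: indic_norm_le1.
have : \int[mu]_x `|k x| = 0.
  under eq_Rintegral do rewrite E.
  by rewrite RintegralB ?h ?subrr//; [exact: measurableC|exact: i1|apply: i1; exact: measurableC].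
move=> H; have ik' : mu.-integrable setT (EFin \o (fun x => `|k x|)) by exact: integrable_norm.
have := Rintegral_fine ik'; rewrite H => /esym.
have /measurable_EFinP mk' := mk.
move/(ae_eq_integral_abs mu measurableT mk'); apply: filterS => x /(_ I)/= [].
by [].
Qed.

End NullIntegrals.

Section WeakGradientUnique.
Context {R : realType}.
Notation leb := (@lebesgue_measure R).

Lemma smoothM (a b : R -> R) : smooth a -> smooth b -> smooth (fun x => a x * b x).
Proof. by move=> sa sb k; exact: smoothkM. Qed.

(* Converges pointwise to the indicator of the open interval. *)
Definition step (a b : R) n (x : R) : R := 1 - (1 - bump a b x) ^+ n.

Lemma smooth_step a b n : smooth (step a b n).
Proof.
move=> k; have := smoothkD (smoothk_cst k (1 : R)) (smoothkZ (-1)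
  (smoothkX n (smoothkD (smoothk_cst k (1 : R)) (smoothkZ (-1) (smooth_bump a b k))))).
by apply: smoothk_ext => x; rewrite /step !mulN1r.
Qed.

Lemma step_itv01 a b n x : 0 <= step a b n x <= 1.
Proof.
have h0 := bump_ge0 a b x; have h1 := bump_le1 a b x.
have h2 : 0 <= 1 - bump a b x by rewrite subr_ge0.
have h3 : 1 - bump a b x <= 1 by rewrite gerDl oppr_le0.
by rewrite /step subr_ge0 exprn_ile1//= gerDl oppr_le0 exprn_ge0.
Qed.

Lemma cvg_step a b x : step a b n x @[n --> \oo] --> (\1_(`]a, b[%classic : set R) x : R).
Proof.
have h0 := bump_ge0 a b x; have h1 := bump_le1 a b x; have hb := bump_gt0 a b x.
rewrite indicE (_ : (x \in _) = (0 < bump a b x)); last first.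
  by rewrite hb; apply/idP/idP; rewrite inE /= in_itv.
rewrite /step; have [hp|hn] := ltP 0 (bump a b x).
  rewrite -[X in _ --> X]subr0; apply: cvgB; first exact: cvg_cst.
  apply: cvg_expr; rewrite ger0_norm ?subr_ge0//.
  by rewrite ltrBlDr ltrDl.
have -> : bump a b x = 0 by apply/eqP; rewrite eq_le hn.
by under eq_fun do rewrite subr0 expr1n subrr; exact: cvg_cst.
Qed.

Lemma supp_in_square_integrable r (b : plane R -> R) : continuous b -> supp_in r b ->
  (b : bplane R -> R) \in Lfun leb2 2%:E.
Proof.
move=> cb sb; apply/square_integrableP; split; first exact: continuous_plane_measurable.
have c2 : continuous (fun z => b z * b z) by move=> z; apply: cvgM; exact: cb.
have /integrableP[_] := supp_in_integrable c2 (supp_inM _ sb).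
rewrite (_ : (fun z => `|_|%E) = (fun z : bplane R => (b z ^+ 2)%:E))//.
by apply/funext => z; rewrite /= -expr2 ger0_norm ?sqr_ge0.
Qed.

Lemma measurable_smooth (a : R -> R) : smooth a -> measurable_fun setT a.
Proof. by move=> sa; exact: continuous_measurable_fun (sa 0%N). Qed.

Lemma cst1_setT : (fun=> 1) = \1_(setT : set R) :> (R -> R).
Proof. by apply/funext => x; rewrite indicE in_setT. Qed.

Definition open_intervals : set (set R) := [set A | exists x y, A = `]x, y[%classic].

Lemma setI_open_intervals : setI_closed open_intervals.
Proof.
move=> _ _ [a [b ->]] [c [e ->]]; exists (Num.max a c), (Num.min b e).
apply/seteqP; split => x /=; rewrite !in_itv/= gt_max lt_min.
  by move=> [/andP[-> ->] /andP[-> ->]].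
by move=> /andP[/andP[-> ->] /andP[-> ->]].
Qed.

Section TestNull.
Variable k : bplane R -> R.
Hypothesis k2 : square_integrable k.
Hypothesis k0 : forall phi, test_function phi -> \int[leb2]_z (k z * phi z) = 0.

Section Cutoff.
Variable N : R.
(** Multiplication by [b] makes [k] integrable, and turns any product of smooth functions of one
    coordinate each into a test function. *)
Let b : plane R -> R := tens (bump (- N) N) (bump (- N) N).
Let kb : bplane R -> R := fun z => k z * b z.

Let bump_out x : x \notin `[- N, N] -> bump (- N) N x = 0.
Proof.
move=> h; apply/eqP; rewrite eq_le bump_ge0 andbT leNgt bump_gt0.
by apply: contra h => /andP[h1 h2]; rewrite in_itv/= !ltW.
Qed.

Let cb : continuous b.
Proof. by apply: continuous_tens; exact: (smooth_bump _ _ 0%N). Qed.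

Let ikb : leb2.-integrable setT (EFin \o kb).
Proof.
have b2 : (b : bplane R -> R) \in Lfun leb2 2%:E.
  apply: (@supp_in_square_integrable N) => // z nz; rewrite /b /tens.
  have [z1|/bump_out->] := boolP (z.1 \in `[- N, N]); last by rewrite mul0r.
  have [z2|/bump_out->] := boolP (z.2 \in `[- N, N]); last by rewrite mulr0.
  by exfalso; apply: nz; split.
exact: square_integrable_prod.
Qed.

(** This class of pairs starts with smooth functions and grows, one coordinate at a time, to
    indicators of open intervals by limits and then to indicators of Borel sets by [dynkin_null]. *)
Let pair0 (A B : R -> R) := [/\ measurable_fun setT A, measurable_fun setT B,
  (forall x, `|A x| <= 1), (forall x, `|B x| <= 1) &
  \int[leb2]_z (kb z * (A z.1 * B z.2)) = 0].

Let mcomp (A B : R -> R) : measurable_fun setT A -> measurable_fun setT B ->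
  measurable_fun setT (fun z : bplane R => A z.1 * B z.2).
Proof.
move=> mA mB; apply: measurable_funM.
  by apply: (measurableT_comp mA); exact: measurable_fst.
by apply: (measurableT_comp mB); exact: measurable_snd.
Qed.

Let norm_step a c n x : `|step a c n x| <= 1.
Proof. by have /andP[h1 h2] := step_itv01 a c n x; rewrite ger0_norm. Qed.

Let pair_smooth A B : smooth A -> smooth B -> (forall x, `|A x| <= 1) ->
  (forall x, `|B x| <= 1) -> pair0 A B.
Proof.
move=> sA sB A1 B1; split => //; [exact: measurable_smooth|exact: measurable_smooth|].
have t := @test_tens _ N _ _ (smoothM (smooth_bump (- N) N) sA) (smoothM (smooth_bump (- N) N) sB).
rewrite -(k0 (t _ _)).
- by apply: eq_Rintegral => z _; rewrite /kb /b /tens; ring.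
- by move=> x /bump_out ->; rewrite mul0r.
- by move=> x /bump_out ->; rewrite mul0r.
Qed.

Let pair_lim1 a c B : (forall n, pair0 (step a c n) B) -> pair0 (\1_(`]a, c[%classic : set R)) B.
Proof.
move=> h; have [_ mB _ B1 _] := h 0%N.
split => //; first by move=> x; exact: indic_norm_le1.
apply: (@Rintegral_limit0 _ _ _ leb2 kb (fun n z => step a c n z.1 * B z.2)) => //.
- by move=> n; apply: mcomp => //; apply: measurable_smooth; exact: smooth_step.
- by move=> n z; rewrite normrM mulr_ile1.
- by move=> z; apply: cvgM; [exact: cvg_step|exact: cvg_cst].
- by move=> n; have [] := h n.
Qed.

Let pair_lim2 a c A : (forall n, pair0 A (step a c n)) -> pair0 A (\1_(`]a, c[%classic : set R)).
Proof.
move=> h; have [mA _ A1 _ _] := h 0%N.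
split => //; first by move=> x; exact: indic_norm_le1.
apply: (@Rintegral_limit0 _ _ _ leb2 kb (fun n z => A z.1 * step a c n z.2)) => //.
- by move=> n; apply: mcomp => //; apply: measurable_smooth; exact: smooth_step.
- by move=> n z; rewrite normrM mulr_ile1.
- by move=> z; apply: cvgM; [exact: cvg_cst|exact: cvg_step].
- by move=> n; have [] := h n.
Qed.

(** The whole line is included because [dynkin_null] starts from the vanishing of the total
    integral. *)
Let basic : set (set R) := [set A | A = setT \/ open_intervals A].

Let pair_basic A B : basic A -> basic B -> pair0 (\1_A) (\1_B).
Proof.
have s1 : smooth (fun=> 1 : R) by move=> n; exact: smoothk_cst.
have n1 (x : R) : `|1 : R| <= 1 by rewrite normr1.
move=> [->|[a [c ->]]] [->|[a' [c' ->]]]; rewrite -?cst1_setT.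
- exact: pair_smooth.
- by apply: pair_lim2 => n; apply: pair_smooth => //; exact: smooth_step.
- by apply: pair_lim1 => n; apply: pair_smooth => //; exact: smooth_step.
- apply: pair_lim1 => n; apply: pair_lim2 => n'.
  by apply: pair_smooth => //; exact: smooth_step.
Qed.

Let basicT : basic setT. Proof. by left. Qed.

Let oiE : @measurable _ (measurableTypeR R) = <<s open_intervals >>.
Proof. exact: RGenOpens.measurableE. Qed.

Let ikw (A : bplane R -> R) : measurable_fun setT A -> (forall x : bplane R, `|A x| <= 1) ->
  leb2.-integrable setT (EFin \o (fun z => kb z * A z)).
Proof. by move=> mA A1; apply: integrableM_bounded => //; exact: ikb. Qed.

Let pair_meas1 A B : measurable A -> basic B -> pair0 (\1_A) (\1_B).
Proof.
move=> mA bB; have [_ mB _ B1 h0] := pair_basic basicT bB.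
split => //; first by move=> x; exact: indic_norm_le1.
rewrite (eq_Rintegral leb2 (g := fun z => (kb z * \1_B z.2) * \1_A z.1)); last first.
  by move=> z _; ring.
have mB2 : measurable_fun setT (fun z : bplane R => \1_B z.2 : R).
  by apply: (measurableT_comp mB); exact: measurable_snd.
apply: (@dynkin_null _ _ _ leb2 _ (measurableTypeR R) fst open_intervals) => //.
- exact: setI_open_intervals.
- by apply: ikw => // z; exact: B1.
- by rewrite -[RHS]h0; apply: eq_Rintegral => z _; rewrite [\1_setT _]indicE in_setT mul1r.
- move=> I oI; have [_ _ _ _ <-] := pair_basic (or_intror oI) bB.
  by apply: eq_Rintegral => z _; ring.
Qed.

Let pair_meas A B : measurable A -> measurable B -> pair0 (\1_A) (\1_B).
Proof.
move=> mA mB; have [mA' _ A1 _ h0] := pair_meas1 mA basicT.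
split => //; first by move=> x; exact: indic_norm_le1.
rewrite (eq_Rintegral leb2 (g := fun z => (kb z * \1_A z.1) * \1_B z.2)); last first.
  by move=> z _; ring.
have mA2 : measurable_fun setT (fun z : bplane R => \1_A z.1 : R).
  by apply: (measurableT_comp mA'); exact: measurable_fst.
apply: (@dynkin_null _ _ _ leb2 _ (measurableTypeR R) snd open_intervals) => //.
- exact: setI_open_intervals.
- by apply: ikw => // z; exact: A1.
- by rewrite -[RHS]h0; apply: eq_Rintegral => z _; rewrite [\1_setT _]indicE in_setT mulr1.
- move=> I oI; have [_ _ _ _ <-] := pair_meas1 mA (or_intror oI).
  by apply: eq_Rintegral => z _; ring.
Qed.

Lemma cutoff_null_ae : {ae leb2, forall z, k z * tens (bump (- N) N) (bump (- N) N) z = 0}.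
Proof.
apply: (@Rintegral_null_ae _ _ _ leb2 kb ikb) => A mA.
apply: (@dynkin_null _ _ _ leb2 _ (bplane R) id
  [set A1 `*` A2 | A1 in measurable & A2 in measurable]) => //.
- exact: measurable_prod_measurableType.
- move=> _ _ [A1 mA1 [A2 mA2 <-]] [B1 mB1 [B2 mB2 <-]].
  exists (A1 `&` B1); first exact: measurableI.
  by exists (A2 `&` B2); [exact: measurableI|rewrite setXI].
- have [_ _ _ _ <-] := pair_basic basicT basicT.
  by apply: eq_Rintegral => z _; rewrite !indicE !in_setT !mulr1.
- move=> _ [A1 mA1 [A2 mA2 <-]]; have [_ _ _ _ <-] := pair_meas mA1 mA2.
  by apply: eq_Rintegral => z _; rewrite !indicE in_setX; case: (_ \in A1); case: (_ \in A2); rewrite ?mulr1 ?mulr0.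
Qed.

End Cutoff.

Lemma test_null_ae : {ae leb2, forall z, k z = 0}.
Proof.
have := ae_foralln (fun n : nat => cutoff_null_ae n%:R).
apply: filterS => z h; pose n := (Num.truncn (`|z.1| + `|z.2|)).+1.
have hn := truncnS_gt (`|z.1| + `|z.2|); rewrite -/n in hn.
move: (h n); move=> /eqP; rewrite mulf_eq0 => /orP[/eqP//|].
have b0 (x : R) : `|x| < n%:R -> bump (- n%:R) n%:R x != 0.
  by move=> xn; rewrite gt_eqF// bump_gt0 -ltr_norml.
have z1 : `|z.1| < n%:R by rewrite (le_lt_trans _ hn)// lerDl.
have z2 : `|z.2| < n%:R by rewrite (le_lt_trans _ hn)// lerDr.
by rewrite /tens mulf_eq0 (negbTE (b0 _ z1)) (negbTE (b0 _ z2)).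
Qed.

End TestNull.

(** [grad] is an arbitrary choice of weak gradient; this identifies it almost everywhere with the
    gradient computed for the potential. *)
Lemma weak_gradient_unique (f : plane R -> R) g h : weak_gradient f g -> weak_gradient f h ->
  forall i, {ae leb2, forall z : bplane R, cd i (g z) = cd i (h z)}.
Proof.
move=> wg wh i; have [g2 hg] := weak_gradient_cd i wg.
have [h2 hh] := weak_gradient_cd i wh.
have k2 : square_integrable (fun z => cd i (g z) - cd i (h z)).
  have le12 : (1 <= 2%:E :> \bar R)%E by rewrite lee_fin ler1n.
  by have := rpredB (g2 : _ \in Lfun leb2 2%:E) (h2 : _ \in Lfun leb2 2%:E); exact.
suff k0 phi : test_function phi -> \int[leb2]_z ((cd i (g z) - cd i (h z)) * phi z) = 0.
  by have := test_null_ae k2 k0; apply: filterS => z /eqP; rewrite subr_eq0 => /eqP.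
move=> tp.
have [r r0 sr] := compactly_supported_box tp.2.
have cp : continuous phi := tp.1 0%N.
have p2 : (phi : bplane R -> R) \in Lfun leb2 2%:E by exact: supp_in_square_integrable sr.
have ig := square_integrable_prod g2 p2.
have ih := square_integrable_prod h2 p2.
rewrite (eq_Rintegral leb2 (g := fun z => cd i (g z) * phi z - cd i (h z) * phi z)); last first.
  by move=> z _; ring.
by rewrite RintegralB// -[X in X - _]opprK -[X in _ - X]opprK -hg// -hh// subrr.
Qed.

End WeakGradientUnique.

(** * Potentials of measures of power growth *)

Lemma sigma_finite_prod d1 d2 (T1 : measurableType d1) (T2 : measurableType d2) (R : realType)
    (m1 : {sigma_finite_measure set T1 -> \bar R})
    (m2 : {sigma_finite_measure set T2 -> \bar R}) : sigma_finite setT (m1 \x m2)%E.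
Proof.
have /sigma_finiteP[F [FT ndF hF]] := sigma_finiteT m1.
have /sigma_finiteP[G [GT ndG hG]] := sigma_finiteT m2.
exists (fun n => F n `*` G n); last first.
  move=> n; have [[mF Fn] [mG Gn]] := (hF n, hG n).
  split; first exact: measurableX.
  by rewrite product_measure1E// lte_mul_pinfty ?ge0_fin_numE.
apply/esym; rewrite -subTset => -[x y] _.
have [i _ Fi] : (\bigcup_i F i) x by rewrite -FT.
have [j _ Gj] : (\bigcup_i G i) y by rewrite -GT.
exists (maxn i j) => //; split => /=.
  by move: x Fi; apply/subsetPset/ndF; exact: leq_maxl.
by move: y Gj; apply/subsetPset/ndG; exact: leq_maxr.
Qed.

Lemma test_function_derive {R : realType} i (phi : plane R -> R) : test_function phi ->
  (forall z, derivable phi z (ev i)) /\ continuous (fun z => 'D_(ev i) phi z).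
Proof.
move=> [/(_ 1%N) /= [_ [d1 c1] [d2 c2]] _].
by case: i; [split; [exact: d2|exact: c2]|split; [exact: d1|exact: c1]].
Qed.

Lemma le_integralT d (T : measurableType d) (R : realType) (mu : {measure set T -> \bar R})
    (f g : T -> \bar R) : (forall x, 0 <= f x)%E -> measurable_fun setT f ->
  measurable_fun setT g -> (forall x, f x <= g x)%E ->
  (\int[mu]_x f x <= \int[mu]_x g x)%E.
Proof. by move=> f0 mf mg fg; apply: ge0_le_integral. Qed.

Lemma measurable_abs_EFin d (T : measurableType d) (R : realType) (f : T -> R) :
  measurable_fun setT f -> measurable_fun setT (fun x => `|f x|%:E).
Proof. by move=> mf; apply/measurable_EFinP; exact: measurableT_comp. Qed.

Lemma abs_EFin_ge0 (R : realType) (r : R) : (0 <= `|r|%:E)%E.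
Proof. by rewrite lee_fin. Qed.

Lemma ge0_integralD3 d (T : measurableType d) (R : realType) (mu : {measure set T -> \bar R})
    (f g h : T -> \bar R) : (forall x, 0 <= f x)%E -> (forall x, 0 <= g x)%E ->
  (forall x, 0 <= h x)%E -> measurable_fun setT f -> measurable_fun setT g ->
  measurable_fun setT h ->
  (\int[mu]_x (f x + g x + h x) = \int[mu]_x f x + \int[mu]_x g x + \int[mu]_x h x)%E.
Proof.
move=> f0 g0 h0 mf mg mh; rewrite ge0_integralD//.
- by rewrite ge0_integralD.
- by move=> x _; exact: adde_ge0.
- exact: emeasurable_funD.
Qed.

(** * Square-integrability of functions given by a kernel *)

Section KernelOperator.
Context d d' (T : measurableType d) (S : measurableType d') (R : realType).
Variables (m : {measure set T -> \bar R}) (nu : {measure set S -> \bar R}).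
Hypotheses (sm : sigma_finite setT m) (sn : sigma_finite setT nu).
Variables (q : T -> S -> R) (A : R).
Hypothesis mq : measurable_fun setT (fun z : T * S => q z.1 z.2).
Hypothesis q1 : (\int[m]_x \int[nu]_s `|q x s|%:E < +oo)%E.
Hypothesis A0 : 0 <= A.
Let a x : \bar R := (\int[nu]_s `|q x s|%:E)%E.
Hypothesis q2 : (\int[m]_x (a x * a x) <= A%:E)%E.

Let a0 x : (0 <= a x)%E. Proof. exact: integral_ge0. Qed.

Let ma : measurable_fun setT a.
Proof.
apply: (@sf_measurable_tonelli _ _ _ _ _ nu sn (fun z => `|q z.1 z.2|%:E)) => //.
by apply/measurable_EFinP; exact: measurableT_comp.
Qed.

Let ra x := fine (a x).

Let mra : measurable_fun setT ra.
Proof. exact: (measurableT_comp (@fine_measurable R _ measurableT) ma). Qed.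

Let ra2 : (\int[m]_x (ra x ^+ 2)%:E <= A%:E)%E.
Proof.
apply: le_trans q2; apply: ge0_le_integral => //.
- by move=> x _; rewrite lee_fin sqr_ge0.
- by apply/measurable_EFinP; exact: measurable_funX.
- exact: emeasurable_funM.
- move=> x _; rewrite /ra expr2 EFinM; have := a0 x.
  by case: (a x) => [r| |] //= _; rewrite mul0e leey.
Qed.

Let afin : {ae m, forall x, a x = (ra x)%:E}.
Proof.
have ia : m.-integrable setT a.
  apply/integrableP; split => //.
  by under eq_integral do rewrite gee0_abs//.
have := integrable_ae measurableT ia; apply: filterS => x /(_ I) h.
by rewrite /ra fineK.
Qed.

(** Cauchy-Schwarz in [x] between [w] and the absolute integral [a] of the kernel; [q1] makes [a]
    finite almost everywhere, so that its real part can replace it. *)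
Lemma kernel_pairing_le (w : T -> R) (c : R) : measurable_fun setT w -> 0 <= c ->
  (\int[m]_x (w x ^+ 2)%:E <= c%:E)%E ->
  (\int[m]_x \int[nu]_s `|q x s * w x|%:E <= (Num.sqrt A * Num.sqrt c)%:E)%E.
Proof.
move=> mw c0 wc; apply: le_trans (cauchy_schwarz_integral mra mw A0 c0 ra2 wc).
rewrite le_eqVlt; apply/orP; left; apply/eqP.
have E x : (\int[nu]_s `|q x s * w x|%:E = a x * `|w x|%:E)%E.
  rewrite /a -ge0_integralZr//.
    by apply: eq_integral => s _; rewrite normrM.
  apply/measurable_EFinP; apply: measurableT_comp => //.
  exact: (measurable_fun_pair2 x mq).
apply: ae_eq_integral => //.
- under eq_fun do rewrite E.
  by apply: emeasurable_funM => //; apply/measurable_EFinP; exact: measurableT_comp.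
- by apply/measurable_EFinP; apply: measurableT_comp => //; exact: measurable_funM.
apply: filterS afin => x hx _; rewrite E hx normrM EFinM; congr (_ * _)%E.
by rewrite ger0_norm// /ra fine_ge0.
Qed.

Lemma kernel_square_integrable : (fun x => \int[nu]_s q x s) \in Lfun m 2%:E.
Proof.
apply: (@square_integrable_le _ _ _ m _ ra).
- exact: (sf_measurable_Rsection sm sn mq q1).
- by apply/square_integrableP; split => //; rewrite (le_lt_trans ra2)// ltry.
- move=> x; rewrite [leRHS]ger0_norm ?fine_ge0//.
  by apply: normr_Rintegral_le; exact: (measurable_fun_pair2 x mq).
Qed.

End KernelOperator.

Section Potential.
Context {R : realType}.
Notation leb := (@lebesgue_measure R).
Variable mu : {sigma_finite_measure set (bplane R) -> \bar R}.
Variables (C th : R).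
Hypothesis muT : (mu setT < +oo)%E.
Hypothesis Cge0 : 0 <= C.
Hypothesis th01 : 0 < th <= 2^-1.
Hypothesis pot : forall s x, 0 < s ->
  (\int[mu]_y (pk s (x - y))%:E <= (C * s `^ (th - 1))%:E)%E.

Let S := (measurableTypeR R * bplane R)%type.
Let nu : {measure set S -> \bar R} := (leb \x mu)%E.

Let snu : sigma_finite setT nu.
Proof. exact: sigma_finite_prod. Qed.

(** Common form of the kernels and their bounds: [r] is a power of time and [c] the dilation of time
    coming from [pk_double]. The potential has kernel [Q 0 1], and its gradient is dominated by
    [2 * Q (- 2^-1) 2]. *)
Let Q r c (x : bplane R) (s : S) : R := wt s.1 * s.1 `^ r * pk (c * s.1) (x - s.2).

Let Q_ge0 r c x s : 0 <= Q r c x s.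
Proof. by apply: mulr_ge0; [apply: mulr_ge0; [exact: wt_ge0|exact: powR_ge0]|exact: pk_ge0]. Qed.

Let mQ r c : measurable_fun setT (fun z : bplane R * S => Q r c z.1 z.2).
Proof.
have m1 : measurable_fun setT (fun z : bplane R * S => z.2.1).
  by apply: (measurableT_comp measurable_fst); exact: measurable_snd.
have m2 : measurable_fun setT (fun z : bplane R * S => z.2.2).
  by apply: (measurableT_comp measurable_snd); exact: measurable_snd.
apply: measurable_funM.
  apply: measurable_funM; first exact: measurable_wt.
  exact: (measurableT_comp (measurable_powR _)).
apply: measurable_pk; first exact: measurable_funM.
by apply: measurable_planeB => //; exact: measurable_fst.
Qed.

Let mQx r c x : measurable_fun setT (fun s : S => Q r c x s).
Proof. exact: (measurable_fun_pair2 x (mQ r c)). Qed.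

(** By [pot], integration in [y] leaves the power r + th - 1 of time, which is integrable at 0 when
    r + th > 0, uniformly in [x]. *)
Let Q_bounded r c : 0 < c -> 0 < r + th <= 1 ->
  exists2 B : R, 0 < B & forall x, (\int[nu]_s (Q r c x s)%:E <= B%:E)%E.
Proof.
move=> c0 rth; pose I := (\int[leb]_t (wt t * t `^ (r + th - 1))%:E)%E.
have I0 : (0 <= I)%E by apply: integral_ge0 => t _; rewrite lee_fin mulr_ge0 ?wt_ge0 ?powR_ge0.
have IE : I = (fine I)%:E by rewrite fineK// ge0_fin_numE//; exact: integral_wt_powR.
have D0 : 0 <= C * c `^ (th - 1) by rewrite mulr_ge0 ?powR_ge0.
exists (C * c `^ (th - 1) * fine I + 1); first by rewrite ltr_wpDl// mulr_ge0 ?fine_ge0.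
move=> x; apply: (@le_trans _ _ (C * c `^ (th - 1) * fine I)%:E); last first.
  by rewrite lee_fin lerDl.
rewrite EFinM -IE /I -ge0_integralZl//; last 2 first.
- apply/measurable_EFinP; apply: measurable_funM; first exact: measurable_wt.
  exact: (measurableT_comp (measurable_powR _)).
- by move=> t _; rewrite lee_fin mulr_ge0 ?wt_ge0 ?powR_ge0.
rewrite (@fubini_tonelli1 _ _ _ _ _ leb mu (fun s => (Q r c x s)%:E))//; last 2 first.
- by apply/measurable_EFinP.
- by move=> s; rewrite lee_fin.
apply: ge0_le_integral => //.
- by move=> t _; apply: integral_ge0 => y _; rewrite lee_fin.
- apply: (@measurable_fun_fubini_tonelli_F _ _ _ _ _ mu (fun s => (Q r c x s)%:E)) => //.
    exact/measurable_EFinP.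
  by move=> s; rewrite lee_fin.
- apply: measurable_funeM; apply/measurable_EFinP; apply: measurable_funM; first exact: measurable_wt.
  exact: (measurableT_comp (measurable_powR _)).
move=> t _; rewrite /fubini_F/= /Q/=; have [t0|t0] := ltP 0 t; last first.
  by rewrite /wt ltNge t0/= !mul0r mule0; under eq_integral do rewrite !mul0r; rewrite integral0.
under eq_integral do rewrite EFinM.
rewrite ge0_integralZl//; last 3 first.
- apply/measurable_EFinP; apply: measurable_pk => //.
  by apply: measurable_planeB.
- by move=> y _; rewrite lee_fin pk_ge0.
- by rewrite lee_fin mulr_ge0 ?wt_ge0 ?powR_ge0.
have ct0 : 0 < c * t by rewrite mulr_gt0.
apply: le_trans (lee_pmul _ _ (lexx _) (pot x ct0)) _.
- by rewrite lee_fin mulr_ge0 ?wt_ge0 ?powR_ge0.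
- by apply: integral_ge0 => y _; rewrite lee_fin pk_ge0.
have e1 : t `^ (r + th - 1) = t `^ r * t `^ (th - 1).
  by rewrite -addrA [LHS]powRD// (gt_eqF t0) implybT.
have e2 : (c * t) `^ (th - 1) = c `^ (th - 1) * t `^ (th - 1) by rewrite powRM ?ltW.
rewrite -!EFinM lee_fin e1 e2.
by rewrite le_eqVlt; apply/orP; left; apply/eqP; ring.
Qed.

(** Integrated in [x] first, the heat kernel has mass 1 and only the power [r] of time is left, so r
    > -1 is enough here. *)
Let Q_mass r c : 0 < c -> 0 < r + 1 <= 1 ->
  (\int[leb2]_x \int[nu]_s (Q r c x s)%:E < +oo)%E.
Proof.
move=> c0 r01.
rewrite (@sf_tonelli _ _ _ _ _ leb2 nu sigma_finite_leb2 snu (fun z => (Q r c z.1 z.2)%:E))//=; last 2 first.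
- exact/measurable_EFinP.
- by move=> z; rewrite lee_fin.
have E s : (\int[leb2]_x (Q r c x s)%:E = (wt s.1 * s.1 `^ r)%:E)%E.
  have [t0|t0] := ltP 0 s.1; last first.
    by rewrite /Q /wt ltNge t0/= !mul0r; under eq_integral do rewrite !mul0r; rewrite integral0.
  rewrite /Q; under eq_integral do rewrite EFinM.
  rewrite ge0_integralZl//; last 3 first.
  - by apply/measurable_EFinP; exact: measurable_pk_x.
  - by move=> y _; rewrite lee_fin pk_ge0.
  - by rewrite lee_fin mulr_ge0 ?wt_ge0 ?powR_ge0.
  by rewrite integral_pk ?mule1// mulr_gt0.
under eq_integral do rewrite E.
have mf : measurable_fun setT (fun t : measurableTypeR R => wt t * t `^ r).
  apply: measurable_funM; first exact: measurable_wt.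
  exact: (measurableT_comp (measurable_powR _)).
have f0 (t : R) : 0 <= wt t * t `^ r by rewrite mulr_ge0 ?wt_ge0 ?powR_ge0.
rewrite (@fubini_tonelli1 _ _ _ _ _ leb mu (fun s => (wt s.1 * s.1 `^ r)%:E))//; last 2 first.
- by apply/measurable_EFinP; exact: (measurableT_comp mf measurable_fst).
- by move=> s; rewrite lee_fin.
rewrite /fubini_F/=; under eq_integral do rewrite integral_cst//.
rewrite ge0_integralZr//; last 2 first.
- by apply/measurable_EFinP.
- by move=> t _; rewrite lee_fin.
rewrite lte_mul_pinfty//.
- by apply: integral_ge0 => t _; rewrite lee_fin.
- rewrite ge0_fin_numE//; last by apply: integral_ge0 => t _; rewrite lee_fin.
  by have := integral_wt_powR r01; rewrite addrK.
Qed.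

Definition potential_kernel (x : bplane R) (s : S) : R := wt s.1 * pk s.1 (x - s.2).
Definition gradient_kernel i (x : bplane R) (s : S) : R := wt s.1 * Dk i s.1 (x - s.2).
Local Notation kq := potential_kernel.
Local Notation gq := gradient_kernel.

Let m1 : measurable_fun setT (fun z : bplane R * S => z.2.1).
Proof. by apply: (measurableT_comp measurable_fst); exact: measurable_snd. Qed.

Let m2 : measurable_fun setT (fun z : bplane R * S => z.1 - z.2.2 : bplane R).
Proof.
apply: measurable_planeB; first exact: measurable_fst.
by apply: (measurableT_comp measurable_snd); exact: measurable_snd.
Qed.

Let mk : measurable_fun setT (fun z : bplane R * S => kq z.1 z.2).
Proof. by apply: measurable_funM; [exact: measurable_wt|exact: measurable_pk]. Qed.

Let mg i : measurable_fun setT (fun z : bplane R * S => gq i z.1 z.2).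
Proof. by apply: measurable_funM; [exact: measurable_wt|exact: measurable_Dk]. Qed.

Let kqE x s : kq x s = Q 0 1 x s.
Proof. by rewrite /Q powRr0 mulr1 mul1r. Qed.

Let kq_ge0 x s : 0 <= kq x s. Proof. by rewrite kqE. Qed.

Let gq_le i x s : `|gq i x s| <= 2 * Q (- 2^-1) 2 x s.
Proof.
rewrite /gq /Q; have [t0|t0] := ltP 0 s.1; last first.
  by rewrite /wt ltNge t0/= !mul0r mulr0 normr0.
rewrite normrM ger0_norm ?wt_ge0// (le_trans (ler_wpM2l (wt_ge0 _) (Dk_le i _ t0)))//.
by rewrite le_eqVlt; apply/orP; left; apply/eqP; ring.
Qed.

Let th0 : 0 < th. Proof. by case/andP: th01. Qed.
Let th1 : th <= 2^-1. Proof. by case/andP: th01. Qed.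

Let fin_bound (z : \bar R) : (0 <= z)%E -> (z < +oo)%E -> exists2 A : R, 0 <= A & (z <= A%:E)%E.
Proof. by case: z => [r| |]//; rewrite lee_fin => r0 _; exists r. Qed.

(** The power t^(-1/2) is split unevenly. The square of the first factor carries t^(-th/2), still
    within reach of [Q_bounded]; the square of the second carries t^(th/2 - 1), still within reach
    of [Q_mass]. *)
Let Qhalf x s : Num.sqrt (Q (- (th / 2)) 2 x s) * Num.sqrt (Q (th / 2 - 1) 2 x s) =
  Q (- 2^-1) 2 x s.
Proof.
rewrite -sqrtrM//; have [t0|t0] := ltP 0 s.1; last first.
  by rewrite /Q /wt ltNge t0/= !mul0r sqrtr0.
have -> : Q (- (th / 2)) 2 x s * Q (th / 2 - 1) 2 x s = Q (- 2^-1) 2 x s ^+ 2.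
  rewrite /Q expr2.
  have -> : wt s.1 * s.1 `^ (- (th / 2)) * pk (2 * s.1) (x - s.2) *
      (wt s.1 * s.1 `^ (th / 2 - 1) * pk (2 * s.1) (x - s.2)) =
      wt s.1 ^+ 2 * pk (2 * s.1) (x - s.2) ^+ 2 * (s.1 `^ (- (th / 2)) * s.1 `^ (th / 2 - 1)).
    by ring.
  have -> : wt s.1 * s.1 `^ (- 2^-1) * pk (2 * s.1) (x - s.2) *
      (wt s.1 * s.1 `^ (- 2^-1) * pk (2 * s.1) (x - s.2)) =
      wt s.1 ^+ 2 * pk (2 * s.1) (x - s.2) ^+ 2 * (s.1 `^ (- 2^-1) * s.1 `^ (- 2^-1)).
    by ring.
  congr (_ * _); rewrite -!powRD ?(gt_eqF t0) ?implybT//; congr (_ `^ _).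
  by lra.
by rewrite sqrtr_sqr ger0_norm.
Qed.

Let mI (q : bplane R -> S -> R) : measurable_fun setT (fun z : bplane R * S => q z.1 z.2) ->
  (forall x s, 0 <= q x s) -> measurable_fun setT (fun x => \int[nu]_s (q x s)%:E)%E.
Proof.
move=> mq q0; apply: (@sf_measurable_tonelli _ _ _ _ _ nu snu (fun z => (q z.1 z.2)%:E)) => //.
  by apply/measurable_EFinP; exact: mq.
by move=> z; rewrite lee_fin.
Qed.

Let mIabs (q : bplane R -> S -> R) : measurable_fun setT (fun z : bplane R * S => q z.1 z.2) ->
  measurable_fun setT (fun x => \int[nu]_s `|q x s|%:E)%E.
Proof.
move=> mq; apply: (@mI (fun x s => `|q x s|)) => //.
exact: (measurableT_comp (@normr_measurable R setT) mq).
Qed.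

Let mIQ r c := mI (mQ r c) (Q_ge0 r c).

Let kq_ibound : exists2 B : R, 0 < B & forall x, (\int[nu]_s `|kq x s|%:E <= B%:E)%E.
Proof.
have [||B B0 hB] := @Q_bounded 0 1 => //; first by rewrite add0r th0 (le_trans th1)// invf_le1// ler1n.
exists B => // x; apply: le_trans (hB x).
by rewrite le_eqVlt; apply/orP; left; apply/eqP; apply: eq_integral => s _; rewrite (ger0_norm (kq_ge0 x s)) kqE.
Qed.

Let kq_fin : (\int[leb2]_x \int[nu]_s `|kq x s|%:E < +oo)%E.
Proof.
have fin := @Q_mass 0 1 ltac:(by []) ltac:(by rewrite add0r ltr01 lexx).
rewrite [ltLHS](_ : _ = (\int[leb2]_x \int[nu]_s (Q 0 1 x s)%:E)%E); first exact: fin.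
apply: eq_integral => x _; apply: eq_integral => s _.
by rewrite (ger0_norm (kq_ge0 x s)) kqE.
Qed.

Let gq_fin i : (\int[leb2]_x \int[nu]_s `|gq i x s|%:E < +oo)%E.
Proof.
have h : 0 < (- 2^-1 : R) + 1 <= 1.
  by apply/andP; split; lra.
have fin := @Q_mass (- 2^-1) 2 ltac:(by []) h.
apply: (@le_lt_trans _ _ (\int[leb2]_x (2%:E * \int[nu]_s (Q (- 2^-1) 2 x s)%:E))%E).
  apply: le_integralT.
  - by move=> x; apply: integral_ge0 => s _; exact: abs_EFin_ge0.
  - exact: (mIabs (mg i)).
  - by apply: measurable_funeM; exact: (mIQ (- 2^-1) 2).
  move=> x; rewrite -ge0_integralZl//; last 2 first.
  - exact/measurable_EFinP.
  - by move=> s _; rewrite lee_fin.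
  apply: le_integralT.
  - by move=> s; exact: abs_EFin_ge0.
  - exact: measurable_abs_EFin (measurable_fun_pair2 x (mg i)).
  - by apply: measurable_funeM; exact/measurable_EFinP.
  - by move=> s; rewrite -EFinM lee_fin gq_le.
rewrite ge0_integralZl//; last by move=> x _; apply: integral_ge0 => s _; rewrite lee_fin.
rewrite lte_mul_pinfty// ge0_fin_numE//.
Qed.

Let kq_sq : exists2 A : R, 0 <= A &
  (\int[leb2]_x ((\int[nu]_s `|kq x s|%:E) * (\int[nu]_s `|kq x s|%:E)) <= A%:E)%E.
Proof.
have [B B0 hB] := kq_ibound.
have a0 x : (0 <= \int[nu]_s `|kq x s|%:E)%E by exact: integral_ge0.
apply: fin_bound; first by apply: integral_ge0 => x _; rewrite mule_ge0.
have ma : measurable_fun setT (fun x => \int[nu]_s `|kq x s|%:E)%E.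
  exact: (mIabs (mk)).
apply: (@le_lt_trans _ _ (\int[leb2]_x (B%:E * \int[nu]_s `|kq x s|%:E))%E).
  apply: le_integralT.
  - by move=> x; rewrite mule_ge0.
  - exact: emeasurable_funM.
  - exact: measurable_funeM.
  - by move=> x; apply: lee_wpmul2r.
rewrite ge0_integralZl//; last by rewrite lee_fin ltW.
by rewrite lte_mul_pinfty ?lee_fin ?ltW.
Qed.

(** As th <= 1/2, [Q_bounded] does not cover the power -1/2 of the gradient kernel, and the estimate
    bounded times integrable used for the potential fails. Cauchy-Schwarz in [s] with the splitting
    [Qhalf] bounds the square by a constant times the integrable function [b]; the 4 is the square
    of the 2 in [gq_le]. *)
Let gq_sq i : exists2 A : R, 0 <= A &
  (\int[leb2]_x ((\int[nu]_s `|gq i x s|%:E) * (\int[nu]_s `|gq i x s|%:E)) <= A%:E)%E.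
Proof.
have h1 : 0 < - (th / 2) + th <= 1 by apply/andP; have := th0; have := th1; split; lra.
have [B B0 hB] := @Q_bounded (- (th / 2)) 2 ltac:(by []) h1.
have h2 : 0 < th / 2 - 1 + 1 <= 1 by apply/andP; have := th0; have := th1; split; lra.
have hm := @Q_mass (th / 2 - 1) 2 ltac:(by []) h2.
have a0 x : (0 <= \int[nu]_s `|gq i x s|%:E)%E by exact: integral_ge0.
pose b x := (\int[nu]_s (Q (th / 2 - 1) 2 x s)%:E)%E.
have b0 x : (0 <= b x)%E by apply: integral_ge0 => s _; rewrite lee_fin.
have mb : measurable_fun setT b := mIQ (th / 2 - 1) 2.
have ma : measurable_fun setT (fun x => \int[nu]_s `|gq i x s|%:E)%E.
  exact: (mIabs (mg i)).
have key x : ((\int[nu]_s `|gq i x s|%:E) * (\int[nu]_s `|gq i x s|%:E) <= (4 * B)%:E * b x)%E.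
  have [[r [r0 br]]|boo] : (exists r : R, 0 <= r /\ b x = r%:E) \/ b x = +oo%E.
  - by have := b0 x; case: (b x) => [r| |]//; [left; exists r|right].
  - have msq p : measurable_fun setT (fun s : S => Num.sqrt (Q p 2 x s)).
      by apply: (measurableT_comp (continuous_measurable_fun (@sqrt_continuous R))).
    have := @cauchy_schwarz_integral _ _ _ nu (fun s => Num.sqrt (Q (- (th / 2)) 2 x s))
      (fun s => Num.sqrt (Q (th / 2 - 1) 2 x s)) B r (msq _) (msq _) (ltW B0) r0.
    under eq_integral do rewrite sqr_sqrtr//.
    move=> /(_ (hB x)).
    under eq_integral do rewrite sqr_sqrtr//.
    rewrite -/(b x) br => /(_ (lexx _)).
    under eq_integral do rewrite Qhalf ger0_norm//.
    move=> cs.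
    have le1 : (\int[nu]_s `|gq i x s|%:E <= (2 * (Num.sqrt B * Num.sqrt r))%:E)%E.
      rewrite EFinM; apply: le_trans (lee_wpmul2l _ cs); last by [].
      rewrite -ge0_integralZl//; last 2 first.
      + exact/measurable_EFinP.
      + by move=> s _; rewrite lee_fin.
      apply: le_integralT.
      + by move=> s; exact: abs_EFin_ge0.
      + exact: measurable_abs_EFin (measurable_fun_pair2 x (mg i)).
      + by apply: measurable_funeM; exact/measurable_EFinP.
      + by move=> s; rewrite -EFinM lee_fin gq_le.
    apply: (le_trans (lee_pmul _ _ le1 le1)) => //.
    rewrite -!EFinM lee_fin.
    have hB2 := sqr_sqrtr (ltW B0); have hr2 := sqr_sqrtr r0.
    by rewrite le_eqVlt; apply/orP; left; apply/eqP; rewrite -[in RHS]hB2 -[in RHS]hr2; ring.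
  - by rewrite boo gt0_muley ?leey// lte_fin mulr_gt0.
apply: fin_bound; first by apply: integral_ge0 => x _; rewrite mule_ge0.
apply: (@le_lt_trans _ _ (\int[leb2]_x ((4 * B)%:E * b x))%E).
  apply: le_integralT.
  - by move=> x; rewrite mule_ge0.
  - exact: emeasurable_funM.
  - exact: measurable_funeM.
  - exact: key.
rewrite ge0_integralZl//; last by rewrite lee_fin mulr_ge0// ltW.
by rewrite lte_mul_pinfty ?lee_fin ?mulr_ge0 ?ltW.
Qed.

Definition potential (x : plane R) : R := \int[nu]_s kq x s.
Definition potential_gradient (x : plane R) : plane R :=
  (\int[nu]_s gq false x s, \int[nu]_s gq true x s).
Local Notation u := potential.
Local Notation gr := potential_gradient.

Let cd_gr i x : cd i (gr x) = \int[nu]_s gq i x s. Proof. by case: i. Qed.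

Lemma potential_bounded : exists B, forall x, `|u x| <= B.
Proof.
have [B B0 hB] := kq_ibound; exists B => x.
have mkx : measurable_fun setT (fun s => kq x s) := measurable_fun_pair2 x mk.
rewrite (le_trans (normr_Rintegral_le _ mkx))//.
have := hB x; have : (0 <= \int[nu]_s `|kq x s|%:E)%E by exact: integral_ge0.
rewrite /Rintegral; case: (integral _ _ _) => [r| |]//=.
Qed.

Lemma square_integrable_potential : square_integrable u.
Proof.
have [A A0 hA] := kq_sq.
exact: (kernel_square_integrable sigma_finite_leb2 snu mk kq_fin hA).
Qed.

Lemma square_integrable_potential_gradient i : square_integrable (fun z => cd i (gr z)).
Proof.
have [A A0 hA] := gq_sq i; under eq_fun do rewrite cd_gr.
exact: (kernel_square_integrable sigma_finite_leb2 snu (mg i) (gq_fin i) hA).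
Qed.

Lemma square_integral_bound (w : bplane R -> R) : w \in Lfun leb2 2%:E ->
  exists2 c : R, 0 <= c & (\int[leb2]_x (w x ^+ 2)%:E <= c%:E)%E.
Proof.
move=> /square_integrableP[mw wf]; apply: fin_bound => //.
by apply: integral_ge0 => x _; rewrite lee_fin sqr_ge0.
Qed.

(** Fubini on both sides reduces the identity to integration by parts for the smooth kernel at a
    fixed time and pole. *)
Lemma weak_gradient_potential : weak_gradient u gr.
Proof.
have main i phi : test_function phi ->
    \int[leb2]_z (u z * 'D_(ev i) phi z) = - (\int[leb2]_z (cd i (gr z) * phi z)).
  move=> tp; have [r r0 sr] := compactly_supported_box tp.2.
  have cp : continuous phi := tp.1 0%N.
  have [cd_ cD] : (forall z, derivable phi z (ev i)) /\ continuous (fun z => 'D_(ev i) phi z).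
    exact: test_function_derive.
  have dphi z : is_derive z (ev i) phi ('D_(ev i) phi z) by exact: derivableP.
  have sD : supp_in r (fun z => 'D_(ev i) phi z) := supp_in_derive sr dphi.
  have [c c0 hc] := square_integral_bound (supp_in_square_integrable cp sr).
  have [c' c'0 hc'] := square_integral_bound (supp_in_square_integrable cD sD).
  have mp : measurable_fun setT (phi : bplane R -> R) := continuous_plane_measurable cp.
  have mD : measurable_fun setT ((fun z => 'D_(ev i) phi z) : bplane R -> R) :=
    continuous_plane_measurable cD.
  have [A A0 hA] := kq_sq; have [A' A'0 hA'] := gq_sq i.
  have f1 := kernel_pairing_le snu mk kq_fin A0 hA mD c'0 hc'.
  have f2 := kernel_pairing_le snu (mg i) (gq_fin i) A'0 hA' mp c0 hc.
  have mkp : measurable_fun setT (fun z : bplane R * S => kq z.1 z.2 * 'D_(ev i) phi z.1).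
    by apply: measurable_funM => //; exact: (measurableT_comp mD measurable_fst).
  have mgp : measurable_fun setT (fun z : bplane R * S => gq i z.1 z.2 * phi z.1).
    by apply: measurable_funM => //; exact: (measurableT_comp mp measurable_fst).
  have F1 := sf_Rintegral_fubini sigma_finite_leb2 snu mkp (le_lt_trans f1 (ltry _)).
  have F2 := sf_Rintegral_fubini sigma_finite_leb2 snu mgp (le_lt_trans f2 (ltry _)).
  have mkx x : measurable_fun setT (fun s => kq x s) := measurable_fun_pair2 x mk.
  have mgx x : measurable_fun setT (fun s => gq i x s) := measurable_fun_pair2 x (mg i).
  rewrite (eq_Rintegral leb2 (g := fun x => \int[nu]_s (kq x s * 'D_(ev i) phi x))); last first.
    move=> x _; under [RHS]eq_Rintegral do rewrite mulrC.
    by rewrite RintegralZl_measurable// mulrC.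
  rewrite [in RHS](eq_Rintegral leb2 (g := fun x => \int[nu]_s (gq i x s * phi x))); last first.
    move=> x _; under [RHS]eq_Rintegral do rewrite mulrC.
    by rewrite RintegralZl_measurable// mulrC cd_gr.
  rewrite F1 F2 -[RHS]mulN1r -RintegralZl_measurable; last first.
    have fi := sf_iterated_abs_swap sigma_finite_leb2 snu mgp (le_lt_trans f2 (ltry _)).
    have mgp' : measurable_fun setT (fun z : S * bplane R => gq i z.2 z.1 * phi z.2).
      exact: (measurableT_comp mgp (@measurable_swap _ _ _ _)).
    exact: (sf_measurable_Rsection snu sigma_finite_leb2 mgp' fi).
  apply: eq_Rintegral => s _; rewrite mulN1r.
  have mdx : measurable_fun setT (fun x : bplane R => pk s.1 (x - s.2) * 'D_(ev i) phi x).
    by apply: measurable_funM => //; exact: measurable_pk_x.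
  have mdg : measurable_fun setT (fun x : bplane R => Dk i s.1 (x - s.2) * phi x).
    by apply: measurable_funM => //; exact: (continuous_plane_measurable (@continuous_Dk _ i s.1 s.2)).
  rewrite (eq_Rintegral leb2 (g := fun x => wt s.1 * (pk s.1 (x - s.2) * 'D_(ev i) phi x))); last first.
    by move=> x _; rewrite /kq mulrA.
  rewrite [in RHS](eq_Rintegral leb2 (g := fun x => wt s.1 * (Dk i s.1 (x - s.2) * phi x))); last first.
    by move=> x _; rewrite /gq mulrA.
  rewrite !RintegralZl_measurable// -mulrN; congr (_ * _).
  apply: (@ibp _ (ev i) _ _ _ _ r) => //.
  - by case: (i); [right|left].
  - by move=> z; exact: is_derive_pk.
  - exact: continuous_pk.
  - exact: continuous_Dk.
split; [exact: (square_integrable_potential_gradient false)|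
  exact: (square_integrable_potential_gradient true)|].
by move=> phi tp; split; [exact: (main false)|exact: (main true)].
Qed.

Let pairing (f : plane R -> R) (h : plane R -> plane R) (x : bplane R) (s : S) : R :=
  heat_kernel_pairing f h s.2 s.1 x.

Let pairingE f h x s : pairing f h x s =
  2^-1 * (gq false x s * cd false (h x) + gq true x s * cd true (h x)) + kq x s * f x.
Proof. by rewrite /pairing /heat_kernel_pairing /gq /kq; ring. Qed.

Section Pairing.
Variables (f : plane R -> R) (h : plane R -> plane R).
Hypotheses (Cf : C0 f) (f2 : square_integrable f) (wf : weak_gradient f h).

Let mf : measurable_fun setT (f : bplane R -> R) := continuous_plane_measurable Cf.1.
Let mh i : measurable_fun setT (fun x : bplane R => cd i (h x)).
Proof. by have [/square_integrableP[]] := weak_gradient_cd i wf. Qed.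

Let h2 i : square_integrable (fun x => cd i (h x)).
Proof. by have [] := weak_gradient_cd i wf. Qed.

Let mgh i : measurable_fun setT (fun z : bplane R * S => gq i z.1 z.2 * cd i (h z.1)).
Proof. by apply: measurable_funM => //; exact: (measurableT_comp (mh i) measurable_fst). Qed.

Let mkf : measurable_fun setT (fun z : bplane R * S => kq z.1 z.2 * f z.1).
Proof. by apply: measurable_funM => //; exact: (measurableT_comp mf measurable_fst). Qed.

Let mpair : measurable_fun setT (fun z : bplane R * S => pairing f h z.1 z.2).
Proof.
under eq_fun do rewrite pairingE.
apply: measurable_funD; last exact: mkf.
by apply: measurable_funM => //; apply: measurable_funD; exact: mgh.
Qed.

Lemma pairing_le (A c : R) : 0 <= A -> 0 <= c ->
  (forall i, (\int[leb2]_x ((\int[nu]_s `|gq i x s|%:E) * (\int[nu]_s `|gq i x s|%:E)) <= A%:E)%E) ->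
  (\int[leb2]_x ((\int[nu]_s `|kq x s|%:E) * (\int[nu]_s `|kq x s|%:E)) <= A%:E)%E ->
  (forall i, (\int[leb2]_x (cd i (h x) ^+ 2)%:E <= c%:E)%E) ->
  (\int[leb2]_x (f x ^+ 2)%:E <= c%:E)%E ->
  (\int[leb2]_x \int[nu]_s `|pairing f h x s|%:E <= (3 * (Num.sqrt A * Num.sqrt c))%:E)%E.
Proof.
move=> A0 c0 hgA hkA hc hfc.
have g1 i := kernel_pairing_le snu (mg i) (gq_fin i) A0 (hgA i) (mh i) c0 (hc i).
have k1 := kernel_pairing_le snu mk kq_fin A0 hkA mf c0 hfc.
have G0 i x : (0 <= \int[nu]_s `|gq i x s * cd i (h x)|%:E)%E by exact: integral_ge0.
have K0 x : (0 <= \int[nu]_s `|kq x s * f x|%:E)%E by exact: integral_ge0.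
have mG i := mIabs (q := fun x s => gq i x s * cd i (h x)) (mgh i).
have mK := mIabs (q := fun x s => kq x s * f x) mkf.
apply: (@le_trans _ _ (\int[leb2]_x (\int[nu]_s `|gq false x s * cd false (h x)|%:E +
  \int[nu]_s `|gq true x s * cd true (h x)|%:E + \int[nu]_s `|kq x s * f x|%:E))%E); last first.
  rewrite (ge0_integralD3 _ (G0 false) (G0 true) K0 (mG false) (mG true) mK).
  rewrite (_ : 3 * _ = Num.sqrt A * Num.sqrt c + Num.sqrt A * Num.sqrt c + Num.sqrt A * Num.sqrt c); last by ring.
  rewrite !EFinD; exact: leeD (leeD (g1 false) (g1 true)) k1.
apply: le_integralT.
- by move=> x; apply: integral_ge0 => s _; exact: abs_EFin_ge0.
- exact: (mIabs (q := fun x s => pairing f h x s) mpair).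
- by apply: emeasurable_funD; [apply: emeasurable_funD; exact: mG|exact: mK].
move=> x.
have mgx i : measurable_fun setT (fun s => (`|gq i x s * cd i (h x)|)%:E).
  exact: (measurable_abs_EFin (measurable_fun_pair2 x (mgh i))).
have mkx : measurable_fun setT (fun s => (`|kq x s * f x|)%:E).
  exact: (measurable_abs_EFin (measurable_fun_pair2 x mkf)).
rewrite -(ge0_integralD3 _ _ _ _ (mgx false) (mgx true) mkx); last 3 first.
- by move=> s; exact: abs_EFin_ge0.
- by move=> s; exact: abs_EFin_ge0.
- by move=> s; exact: abs_EFin_ge0.
apply: le_integralT.
- by move=> s; exact: abs_EFin_ge0.
- exact: (measurable_abs_EFin (measurable_fun_pair2 x mpair)).
- by apply: emeasurable_funD; [apply: emeasurable_funD|].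
move=> s; rewrite -!EFinD lee_fin pairingE (le_trans (ler_normD _ _))// lerD2r.
apply: (le_trans _ (ler_normD _ _)).
by rewrite normrM [`|2^-1|]ger0_norm ?invr_ge0// ler_piMl// invf_le1// ler1n.
Qed.

Hypothesis pfin : (\int[leb2]_x \int[nu]_s `|pairing f h x s|%:E < +oo)%E.

Let j (s : S) := \int[leb2]_x pairing f h x s.

Let mpair' : measurable_fun setT (fun z : S * bplane R => pairing f h z.2 z.1).
Proof. exact: (measurableT_comp mpair (@measurable_swap _ _ _ _)). Qed.

Let pfin' : (\int[nu]_s \int[leb2]_x `|pairing f h x s|%:E < +oo)%E.
Proof. exact: (sf_iterated_abs_swap sigma_finite_leb2 snu mpair pfin). Qed.

Let mj : measurable_fun setT j.
Proof. exact: (sf_measurable_Rsection snu sigma_finite_leb2 mpair' pfin'). Qed.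

Let absI (s : S) : \bar R := (\int[leb2]_x `|pairing f h x s|%:E)%E.

Let absI0 s : (0 <= absI s)%E. Proof. exact: integral_ge0. Qed.

Let mabsI : measurable_fun setT absI.
Proof.
apply: (@sf_measurable_tonelli _ _ _ _ _ leb2 sigma_finite_leb2 (fun z => `|pairing f h z.2 z.1|%:E)) => //.
by apply/measurable_EFinP; exact: measurableT_comp.
Qed.

Let j_le s : (`|j s|%:E <= absI s)%E.
Proof.
have ms : measurable_fun setT (fun x => pairing f h x s) := measurable_fun_pair1 s mpair.
have := normr_Rintegral_le leb2 ms; rewrite -lee_fin => /le_trans; apply.
rewrite /Rintegral -/(absI s); have := absI0 s; case: (absI s) => [r| |]//=.
Qed.

Let absI_iter : (\int[mu]_y \int[leb]_t absI (t, y) = \int[nu]_s absI s)%E.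
Proof. by rewrite (@fubini_tonelli2 _ _ _ _ _ leb mu absI). Qed.

Let represent y : (\int[leb]_t absI (t, y) < +oo)%E -> \int[leb]_t j (t, y) = f y.
Proof. exact: heat_representation. Qed.

Let mabsI2 : measurable_fun setT (fun y => (\int[leb]_t absI (t, y))%E).
Proof.
exact: (@measurable_fun_fubini_tonelli_G _ _ _ _ _ leb absI).
Qed.

Let mjt y : measurable_fun setT (fun t => j (t, y)).
Proof. exact: (measurable_fun_pair1 y mj). Qed.

Let mabst y : measurable_fun setT (fun t => absI (t, y)).
Proof. exact: (measurable_fun_pair1 y mabsI). Qed.

(** The finite energy inequality. Where the time integral of [absI] is finite it dominates |f y| by
    the representation; where it is infinite there is nothing to prove. *)
Lemma abs_le_pairing : (\int[mu]_y `|f y|%:E <= \int[leb2]_x \int[nu]_s `|pairing f h x s|%:E)%E.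
Proof.
rewrite (sf_tonelli sigma_finite_leb2 snu (f := fun z => `|pairing f h z.1 z.2|%:E))//; last first.
  by apply/measurable_EFinP; exact: measurableT_comp.
rewrite -[leRHS]absI_iter; apply: ge0_le_integral => //.
- by apply/measurable_EFinP; exact: measurableT_comp.
move=> y _; have [fin|] := ltP (\int[leb]_t absI (t, y))%E +oo%E; last first.
  by rewrite leye_eq => /eqP ->; rewrite leey.
rewrite -(represent fin).
have ij : leb.-integrable setT (fun t => (j (t, y))%:E).
  apply: (integrable_EFinP (mjt y)); apply: le_lt_trans fin; apply: le_integralT.
  - by move=> t; exact: abs_EFin_ge0.
  - exact: (measurable_abs_EFin (mjt y)).
  - exact: mabst.
  - by move=> t; exact: j_le.
apply: (@le_trans _ _ (\int[leb]_t `|j (t, y)|%:E)%E).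
  rewrite -[leRHS]Rintegral_fine; last exact: integrable_norm.
  by rewrite lee_fin; exact: le_normr_Rintegral.
apply: le_integralT.
- by move=> t; exact: abs_EFin_ge0.
- exact: (measurable_abs_EFin (mjt y)).
- exact: mabst.
- by move=> t; exact: j_le.
Qed.

(** With space innermost, then time, the representation evaluates the double integral to [f y];
    finiteness of the total absolute integral makes it available for [mu]-almost every y. *)
Lemma integral_pairing : \int[leb2]_x \int[nu]_s pairing f h x s = \int[mu]_y f y.
Proof.
have sfmu : sigma_finite setT mu := sigma_finiteT mu.
rewrite (sf_Rintegral_fubini sigma_finite_leb2 snu mpair pfin).
have mj' : measurable_fun setT (fun z => j (z.1, z.2)).
  by apply: (eq_measurable_fun j) => // -[].
have jfin : (\int[leb]_t \int[mu]_y `|j (t, y)|%:E < +oo)%E.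
  apply: le_lt_trans pfin'.
  rewrite -/(absI _) (@fubini_tonelli1 _ _ _ _ _ leb mu absI)//.
  apply: le_integralT.
  - by move=> t; apply: integral_ge0 => y _; exact: abs_EFin_ge0.
  - apply: (@measurable_fun_fubini_tonelli_F _ _ _ _ _ mu (fun s => `|j s|%:E)).
      exact: (measurable_abs_EFin mj).
    by move=> s; exact: abs_EFin_ge0.
  - exact: (@measurable_fun_fubini_tonelli_F _ _ _ _ _ mu absI mabsI absI0).
  move=> t; apply: le_integralT.
  - by move=> y; exact: abs_EFin_ge0.
  - exact: (measurable_abs_EFin (measurable_fun_pair2 t mj)).
  - exact: (measurable_fun_pair2 t mabsI).
  - by move=> y; exact: j_le.
transitivity (\int[leb]_t \int[mu]_y j (t, y)).
  rewrite {1}/Rintegral -(@Rintegral_fubini1 _ _ _ _ _ leb mu (fun t y => j (t, y)) mj' jfin).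
  by congr fine; apply: eq_integral => -[].
rewrite (@Rintegral_fubini _ _ _ _ _ leb mu (fun t y => j (t, y)) mj' jfin).
congr fine; apply: ae_eq_integral => //.
- apply/measurable_EFinP.
  have jfin' := @iterated_abs_swap _ _ _ _ _ leb mu (fun t y => j (t, y)) mj' jfin.
  have mjs : measurable_fun setT (fun z => j (z.2, z.1)).
    exact: (measurableT_comp mj (@measurable_swap _ _ _ _)).
  exact: (sf_measurable_Rsection (f := fun y t => j (t, y)) sfmu sigma_finite_leb mjs jfin').
- exact/measurable_EFinP.
have iabs : mu.-integrable setT (fun y => (\int[leb]_t absI (t, y))%E).
  apply/integrableP; split => //.
  under eq_integral do rewrite gee0_abs ?integral_ge0//.
  by rewrite absI_iter.
have := integrable_ae measurableT iabs; apply: filterS => y /(_ I) fy _.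
congr EFin; apply: represent; rewrite -ge0_fin_numE//; exact: integral_ge0.
Qed.

(** In the other order, with [s] innermost, the same integral recombines the potential and its
    gradient into E_1(U, f). *)
Lemma integral_pairing_gradient :
  \int[leb2]_x \int[nu]_s pairing f h x s =
  2^-1 * \int[leb2]_x dot (gr x) (h x) + \int[leb2]_x (u x * f x).
Proof.
have ip i : leb2.-integrable setT (EFin \o (fun x : bplane R => cd i (gr x) * cd i (h x))).
  exact: square_integrable_prod (square_integrable_potential_gradient i) (h2 i).
have iu : leb2.-integrable setT (EFin \o (fun x : bplane R => u x * f x)).
  exact: square_integrable_prod square_integrable_potential f2.
have md : measurable_fun setT (fun x : bplane R => dot (gr x) (h x)).
  by apply: measurable_funD; apply/measurable_EFinP; [case/integrableP: (ip false)|case/integrableP: (ip true)].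
have id_ : leb2.-integrable setT (EFin \o (fun x : bplane R => dot (gr x) (h x))).
  exact: (integrableD measurableT (ip false) (ip true)).
rewrite -RintegralZl_measurable// -RintegralD//; last exact: (integrableZl measurableT 2^-1 id_).
have ag i := sf_ae_section_integrable sigma_finite_leb2 snu (mg i) (gq_fin i).
have ak := sf_ae_section_integrable sigma_finite_leb2 snu mk kq_fin.
congr fine; apply: ae_eq_integral => //.
- by apply/measurable_EFinP; exact: (sf_measurable_Rsection sigma_finite_leb2 snu mpair pfin).
- apply/measurable_EFinP; apply: measurable_funD; first exact: measurable_funM.
  by apply/measurable_EFinP; case/integrableP: iu.
move: ak (ag true) (ag false); apply: filterS3 => x ik ig1 ig0 _.
congr EFin; rewrite (eq_Rintegral nu (g := fun s => (2^-1 * cd false (h x) * gq false x s +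
    2^-1 * cd true (h x) * gq true x s) + f x * kq x s)); last first.
  by move=> s _; rewrite pairingE; ring.
have i0 := integrableZl measurableT (2^-1 * cd false (h x)) ig0.
have i1 := integrableZl measurableT (2^-1 * cd true (h x)) ig1.
rewrite RintegralD//; last 2 first.
- exact: (integrableD measurableT i0 i1).
- exact: (integrableZl measurableT (f x) ik).
by rewrite RintegralD// !RintegralZl// /dot -!cd_gr /= /u; ring.
Qed.

End Pairing.

Let energy (f : plane R -> R) (h : plane R -> plane R) : R :=
  2^-1 * \int[leb2]_x dot (h x) (h x) + \int[leb2]_x (f x * f x).

Let pairing_bound : exists2 K, 0 <= K & forall f h, C0 f -> square_integrable f ->
  weak_gradient f h ->
  (\int[leb2]_x \int[nu]_s `|pairing f h x s|%:E <= (K * Num.sqrt (energy f h))%:E)%E.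
Proof.
(* The energy carries a factor 1/2 on the gradient, so each of the three square integrals is at most
   twice the energy. *)
have en (u v w : R) : 0 <= u -> 0 <= v -> 0 <= w -> [/\ u <= 2 * (2^-1 * (u + v) + w),
    v <= 2 * (2^-1 * (u + v) + w) & w <= 2 * (2^-1 * (u + v) + w)].
  by move=> *; split; lra.
have [A0 A00 hA0] := gq_sq false; have [A1 A10 hA1] := gq_sq true.
have [A2 A20 hA2] := kq_sq; pose A := A0 + A1 + A2.
have Age0 : 0 <= A by rewrite !addr_ge0.
have leA : [/\ A0 <= A, A1 <= A & A2 <= A] by rewrite /A; split; lra.
exists (3 * (Num.sqrt A * Num.sqrt 2)); first by rewrite !mulr_ge0 ?sqrtr_ge0.
move=> f h Cf f2 wf.
have h2 i : square_integrable (fun x => cd i (h x)) by have [] := weak_gradient_cd i wf.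
have sqE (w : bplane R -> R) : w \in Lfun leb2 2%:E ->
    (\int[leb2]_x (w x ^+ 2)%:E = (\int[leb2]_x (w x * w x))%:E)%E /\
    0 <= \int[leb2]_x (w x * w x).
  move=> w2; split; last by apply: Rintegral_ge0 => x _; rewrite -expr2 sqr_ge0.
  by rewrite Rintegral_fine; [apply: eq_integral|exact: square_integrable_prod].
have [e0 p0] := sqE _ (h2 false); have [e1 p1] := sqE _ (h2 true).
have [ef pf] := sqE _ f2.
have dE : \int[leb2]_x dot (h x) (h x) = \int[leb2]_x (cd false (h x) * cd false (h x)) +
    \int[leb2]_x (cd true (h x) * cd true (h x)).
  have i0 := square_integrable_prod (h2 false) (h2 false).
  have i1 := square_integrable_prod (h2 true) (h2 true).
  by rewrite -(RintegralD measurableT i0 i1).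
have E0 : 0 <= energy f h by rewrite /energy dE addr_ge0// mulr_ge0// addr_ge0.
have c0 : 0 <= 2 * energy f h by rewrite mulr_ge0.
rewrite [X in (_ <= X%:E)%E](_ : _ = 3 * (Num.sqrt A * Num.sqrt (2 * energy f h))); last first.
  by rewrite sqrtrM//; ring.
apply: pairing_le => //.
- case.
    by apply: le_trans hA1 _; rewrite lee_fin; case: leA.
  by apply: le_trans hA0 _; rewrite lee_fin; case: leA.
- by apply: le_trans hA2 _; rewrite lee_fin; case: leA.
- by case; rewrite ?e0 ?e1 lee_fin /energy dE; have [] := en _ _ _ p0 p1 pf.
- by rewrite ef lee_fin /energy dE; have [] := en _ _ _ p0 p1 pf.
Qed.

Let grad_weak (f : plane R -> R) : dirichlet_domain f -> weak_gradient f (grad f).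
Proof. by move=> [_ ex]; exact: (xgetPex (fun=> (0, 0)) ex). Qed.

Let dirichlet_potential : dirichlet_domain u.
Proof.
split; first exact: square_integrable_potential.
by exists gr; exact: weak_gradient_potential.
Qed.

Theorem S00_potential : S00 mu.
Proof.
have [K K0 hK] := pairing_bound.
have pfin (f : plane R -> R) : dirichlet_domain f -> C0 f ->
    (\int[leb2]_x \int[nu]_s `|pairing f (grad f) x s|%:E < +oo)%E.
  move=> df Cf; apply: le_lt_trans (hK _ _ Cf df.1 (grad_weak df)) _.
  exact: ltry.
split => //.
- split.
    move=> A cA; apply: le_lt_trans muT; apply: le_measure => //; rewrite inE//.
    exact: compact_plane_measurable.
  exists K => f df Cf.
  apply: le_trans (abs_le_pairing Cf (grad_weak df) (pfin _ df Cf)) _.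
  exact: (hK _ _ Cf df.1 (grad_weak df)).
- exists u.
    split; first exact: dirichlet_potential.
    move=> f df Cf.
    rewrite -(integral_pairing Cf (grad_weak df) (pfin _ df Cf)).
    rewrite (integral_pairing_gradient Cf df.1 (grad_weak df) (pfin _ df Cf)).
    rewrite /dirichlet1 /dirichlet; congr (_ * _ + _); congr fine.
    have wu := grad_weak dirichlet_potential.
    have a0 := weak_gradient_unique wu weak_gradient_potential false.
    have a1 := weak_gradient_unique wu weak_gradient_potential true.
    have md (g k : plane R -> plane R) : (forall i, square_integrable (fun x => cd i (g x))) ->
        (forall i, square_integrable (fun x => cd i (k x))) ->
        measurable_fun setT (fun x : bplane R => (dot (g x) (k x))%:E).
      move=> g2 k2; apply/measurable_EFinP; apply: measurable_funD; apply: measurable_funM.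
      - by have /square_integrableP[] := g2 false.
      - by have /square_integrableP[] := k2 false.
      - by have /square_integrableP[] := g2 true.
      - by have /square_integrableP[] := k2 true.
    have w2 (k : plane R -> R) g : weak_gradient k g -> forall i, square_integrable (fun x => cd i (g x)).
      by move=> w i; have [] := weak_gradient_cd i w.
    apply: ae_eq_integral => //.
    + by apply: md; [exact: (w2 _ _ wu)|exact: (w2 _ _ (grad_weak df))].
    + by apply: md; [exact: square_integrable_potential_gradient|exact: (w2 _ _ (grad_weak df))].
    move: a0 a1; apply: filterS2 => x; rewrite /cd /= => h0 h1 _.
    by rewrite /dot h0 h1.
- have [B hB] := potential_bounded.
  (* The maximum with 0 also serves the branch of [Lnorm] whose value is 0 by convention. *)
  apply: (@le_lt_trans _ _ (Num.max B 0)%:E); last exact: ltry.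
  rewrite unlock /Lnorm; case: ifP => _; last by rewrite lee_fin le_max lexx orbT.
  apply/ess_sup_inf.ess_supP; apply: nearW => x; rewrite /= lee_fin.
  by rewrite le_max hB.
Qed.

End Potential.

Theorem S00_growth {R : realType} (mu : {measure set (bplane R) -> \bar R}) (C al : R) :
  (mu setT < +oo)%E -> 0 < al <= 2 -> 0 <= C ->
  (forall x r, 0 < r <= 1 -> (mu (cbox x r) <= (C * r `^ al)%:E)%E) -> S00 mu.
Proof.
move=> muT al2 C0 hmu.
have [C' C'0 pot] := heat_potential_bound muT al2 C0 hmu.
have sf : sigma_finite setT mu by exists (fun=> setT) => //; rewrite bigcup_const.
have [nu munu] := as_sigma_finite sf; rewrite munu in muT pot *.
apply: (@S00_potential _ nu C' (al / 4)) => //.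
by move/andP: al2 => [a0 a2]; apply/andP; split; lra.
Qed.

(** * Exhaustion by boxes and exit times of continuous paths *)

Section Exhaustion.
Context {R : realType}.

Lemma compact_in_box (K : set (plane R)) : compact K -> exists r : R, K `<=` box r.
Proof.
move=> /compact_bounded[M [Mreal hM]]; exists (`|M| + 1) => z Kz.
have Mlt : M < `|M| + 1 by rewrite (le_lt_trans (ler_norm M))// ltrDl.
have zr : `|z| <= `|M| + 1 by exact: hM Kz.
move: zr; rewrite prod_normE ge_max => /andP[h1 h2].
by rewrite /box /= !in_itv/= -!ler_norml.
Qed.

Lemma le_box (r s : R) : r <= s -> box r `<=` box s.
Proof.
move=> rs z; rewrite /box /= !in_itv/= -!ler_norml => -[h1 h2].
by split; exact: le_trans rs.
Qed.

Lemma bigcup_box : \bigcup_(k : nat) (box k%:R : set (bplane R)) = setT.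
Proof.
apply/seteqP; split => // z _; exists (Num.truncn (`|z.1| + `|z.2|)).+1 => //.
have h := truncnS_gt (`|z.1| + `|z.2|).
rewrite /box /= !in_itv/= -!ler_norml; split; apply: le_trans (ltW h).
  by rewrite lerDl.
by rewrite lerDr.
Qed.

(** A continuous path on [0, T] has a compact image, hence stays in some box; the complements of all
    larger boxes are then hit at time T at the earliest. *)
Lemma hitting_time_box {d : measure_display} {W : measurableType d}
    (B : R -> W -> plane R) (w : W) :
  {within `[0, +oo[, continuous (fun t => B t w)} ->
  limn (fun k : nat => hitting_time B (~` box k%:R) w) = +oo%E.
Proof.
move=> cB; apply: cvg_lim => //; apply/cvgeyPge => T.
have cT : {within `[0, T]%classic, continuous (fun t => B t w)}.
  by apply: continuous_subspaceW cB => t /=; rewrite !in_itv/= => /andP[->].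
have [r hr] := compact_in_box (continuous_compact cT (@segment_compact R 0 T)).
exists (Num.truncn `|r|).+1 => // k /= hk.
apply: le_ereal_inf_tmp => _ [t [t0 nB] <-]; rewrite lee_fin leNgt; apply/negP => tT.
apply: nB; apply: (@le_box r); last first.
  by apply: hr; exists t => //; rewrite /= in_itv/= !ltW.
apply: (le_trans (ler_norm r)); apply: (le_trans (ltW (truncnS_gt _))).
by rewrite ler_nat.
Qed.

Theorem smooth_strict_growth {d : measure_display} {W : measurableType d}
    (PB : plane R -> probability W R) (B : R -> W -> plane R)
    (mu : {measure set (bplane R) -> \bar R}) :
  planar_brownian_motion PB B -> radon mu ->
  (forall k : nat, exists C al : R, [/\ 0 <= C, 0 < al <= 2 &
    forall x r, 0 < r <= 1 -> (mu (cbox x r `&` box k%:R) <= (C * r `^ al)%:E)%E]) ->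
  smooth_strict PB B mu.
Proof.
move=> bm rmu hmu.
exists (fun k => box k%:R), (fun k => measurable_box k%:R); split.
- by move=> i j ij; apply/subsetPset/le_box; rewrite ler_nat.
- exact: bigcup_box.
- move=> k; have [C [al [C0 al2 h]]] := hmu k.
  apply: (@S00_growth _ _ C al) => //.
  suff : (mu (setT `&` box k%:R) < +oo)%E by [].
  by rewrite setTI; apply: rmu; exact: compact_box.
- move=> x; have := bm_continuous bm x; apply: filterS => w cB.
  by rewrite hitting_time_box.
Qed.

End Exhaustion.

(** * The covariance kernel of the massive field *)

Lemma measurable_invr d (T : measurableType d) (R : realType) (f : T -> R) :
  measurable_fun setT f -> measurable_fun setT (fun x => (f x)^-1).
Proof.
move=> mf; have mpow (g : T -> R) : measurable_fun setT g -> measurable_fun setT (fun x => g x `^ (-1)).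
  by move=> mg; exact: (measurableT_comp (measurable_powR _) mg).
rewrite (_ : (fun x => (f x)^-1) = fun x => if 0 < f x then f x `^ (-1) else
    if f x < 0 then - ((- f x) `^ (-1)) else 0).
  apply: measurable_fun_ifT.
  - by apply: measurable_fun_ltr => //; exact: measurable_cst.
  - exact: mpow.
  apply: measurable_fun_ifT => //.
  - by apply: measurable_fun_ltr => //; exact: measurable_cst.
  - by apply: measurableT_comp => //; apply: mpow; exact: measurableT_comp.
apply/funext => x; case: (ltrgt0P (f x)) => [h|h|->]; last by rewrite invr0.
- by rewrite powR_inv1// ltW.
- by rewrite powR_inv1 ?invrN ?opprK// oppr_ge0 ltW.
Qed.

Section MassiveKernel.
Context {R : realType}.
Notation leb := (@lebesgue_measure R).
Let D : set (measurableTypeR R) := `]0, +oo[%classic.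
Let mD : measurable D. Proof. exact: measurable_itv. Qed.

Let mexp (l : R) (A : set R) : measurable A -> measurable_fun A (fun s : R => (expR (- (l * s)))%:E).
Proof.
move=> mA; apply/measurable_EFinP; apply: measurable_funTS.
apply: measurableT_comp => //; apply: measurableT_comp => //; exact: measurable_funM.
Qed.

Let integral_expRN (l : R) : 0 < l -> (\int[leb]_(s in D) (expR (- (l * s)))%:E = (l^-1)%:E)%E.
Proof.
move=> l0; rewrite /D integral_itv_obnd_cbnd; last by apply: mexp; exact: measurable_itv.
rewrite integral_mkcond.
transitivity (\int[leb]_s ((l^-1)%:E * (exponential_pdf l s)%:E))%E.
  apply: eq_integral => s _; rewrite patchE; case: ifPn => sD.
    rewrite exponential_pdfE; last by move: sD; rewrite inE /= in_itv/= andbT.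
    by rewrite -EFinM mulrA mulVf ?gt_eqF// mul1r mulNr.
  rewrite lt0_exponential_pdf ?mule0//; move: sD.
  by rewrite notin_setE /= in_itv/= andbT => /negP; rewrite -ltNge.
rewrite ge0_integralZl//.
- by rewrite integral_exponential_pdf// mule1.
- by apply/measurable_EFinP; exact: measurable_exponential_pdf.
- by move=> s _; rewrite lee_fin exponential_pdf_ge0// ltW.
- by rewrite lee_fin invr_ge0 ltW.
Qed.

Lemma integrable_expRN (l : R) : 0 < l ->
  leb.-integrable D (EFin \o (fun s => expR (- (l * s)))).
Proof.
move=> l0; apply/integrableP; split; first exact: mexp.
rewrite (_ : (\int[leb]_(s in D) _)%E = (l^-1)%:E) ?ltry// -(integral_expRN l0).
by apply: eq_integral => s _; rewrite gee0_abs// lee_fin expR_ge0.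
Qed.

Lemma Rintegral_expRN (l : R) : 0 < l -> \int[leb]_(s in D) expR (- (l * s)) = l^-1.
Proof. by move=> l0; rewrite /Rintegral integral_expRN. Qed.

Let phi (q s : R) : R := expR (- (q / (2 * s)) - s / 2).

Let mphi2 d (T : measurableType d) (fq fs : T -> R) : measurable_fun setT fq ->
  measurable_fun setT fs -> measurable_fun setT (fun x => phi (fq x) (fs x)).
Proof.
move=> mq ms; apply: measurableT_comp => //; apply: measurable_funB; last exact: measurable_funM.
apply: measurableT_comp => //; apply: measurable_funM => //.
by apply: measurable_invr; exact: measurable_funM.
Qed.

Let phi_le q s : 0 <= q -> D s -> phi q s <= expR (- (2^-1 * s)).
Proof.
rewrite /D /= in_itv/= andbT => q0 s0; rewrite ler_expR [s / 2]mulrC gerDr oppr_le0.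
by rewrite divr_ge0// mulr_ge0// ltW.
Qed.

Let half0 : 0 < 2^-1 :> R. Proof. by []. Qed.

Let iphi q : 0 <= q -> leb.-integrable D (EFin \o phi q).
Proof.
move=> q0; apply: (le_integrable mD _ _ (integrable_expRN half0)).
  by apply/measurable_EFinP; apply: measurable_funTS; exact: mphi2.
move=> s Ds; rewrite /= lee_fin !ger0_norm ?expR_ge0//; exact: phi_le.
Qed.

(* [km m z] as a function of [m ^+ 2 * sqnorm z]. *)
Definition kq (q : R) : R := 2^-1 * \int[leb]_(s in D) phi q s.

Lemma kmE m z : km m z = kq (m ^+ 2 * sqnorm z).
Proof.
rewrite /km /kq; congr (_ * _); apply: eq_Rintegral => s _.
by rewrite /phi mulrAC.
Qed.

Lemma kq_ge0 q : 0 <= kq q.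
Proof. by rewrite mulr_ge0// Rintegral_ge0// => s _; exact: expR_ge0. Qed.

Lemma kq_le1 q : 0 <= q -> kq q <= 1.
Proof.
move=> q0; have le s : D s -> phi q s <= expR (- (2^-1 * s)) := phi_le q0.
have e2 := Rintegral_expRN half0.
have := @le_Rintegral _ _ _ leb D (phi q) (fun s => expR (- (2^-1 * s))) mD (iphi q0) (integrable_expRN half0) le.
by rewrite e2 invrK /kq; lra.
Qed.

(** First exp(-q/(2s)) <= 2s/(2s + q), a concave function of s, bounded by its tangent A + B (s - 4)
    at s = 4. Then s <= 4 (e^(s/4) - 1) turns the linear term into an exponential that can be
    integrated. With the tangent taken at 4 the terms in B cancel after integration and A = (1 +
    q/8)^-1 is left. *)
Lemma kq_le q : 0 <= q -> kq q <= (1 + q / 8)^-1.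
Proof.
move=> q0; pose A := 8 / (8 + q); pose B := 2 * q / (8 + q) ^+ 2.
have w0 : 0 < 8 + q by rewrite ltr_pwDl.
have wn : 8 + q != 0 by rewrite gt_eqF.
have B0 : 0 <= B by rewrite divr_ge0 ?sqr_ge0 ?mulr_ge0.
have quarter0 : 0 < 4^-1 :> R by rewrite invr_gt0.
have i1 := integrableZl mD (A - 8 * B) (integrable_expRN half0).
have i2 := integrableZl mD (4 * B) (integrable_expRN quarter0).
have le s : D s -> phi q s <= (A - 8 * B) * expR (- (2^-1 * s)) + 4 * B * expR (- (4^-1 * s)).
  rewrite /D /= in_itv/= andbT => s0.
  have e1 : expR (- (q / (2 * s))) <= A + B * (s - 4).
    rewrite expRN; have s20 : 0 < 2 * s + q by rewrite ltr_pwDl// mulr_gt0.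
    have h1 : 1 + q / (2 * s) <= expR (q / (2 * s)) := expR_ge1Dx _.
    have h0 : 0 < 1 + q / (2 * s) by rewrite ltr_pwDl// divr_ge0// mulr_ge0// ltW.
    apply: (@le_trans _ _ (1 + q / (2 * s))^-1).
      by rewrite lef_pV2 ?posrE// expR_gt0.
    rewrite -subr_ge0 (_ : _ - _ = 4 * q * (s - 4) ^+ 2 / ((8 + q) ^+ 2 * (2 * s + q))); last first.
      rewrite /A /B; field; rewrite wn !gt_eqF// mulr_gt0//.
    apply: divr_ge0; first by apply: mulr_ge0; [apply: mulr_ge0|exact: sqr_ge0].
    by apply: mulr_ge0; [exact: sqr_ge0|exact: ltW].
  have e2 : s <= 4 * (expR (s / 4) - 1) by have := expR_ge1Dx (s / 4); lra.
  rewrite /phi expRD (_ : expR (- (4^-1 * s)) = expR (s / 4) * expR (- (s / 2))); last first.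
    by rewrite -expRD; congr expR; field.
  rewrite [2^-1 * s]mulrC [X in _ <= _ + X]mulrA -mulrDl ler_wpM2r ?expR_ge0//.
  apply: (le_trans e1); have := ler_wpM2l B0 e2; lra.
have := le_Rintegral mD (iphi q0) (integrableD mD i1 i2) le.
rewrite RintegralD// (RintegralZl _ mD (integrable_expRN half0)) (RintegralZl _ mD (integrable_expRN quarter0)).
have e2 := Rintegral_expRN half0; have e4 := Rintegral_expRN quarter0.
rewrite e2 e4 !invrK /kq => h.
rewrite (_ : (1 + q / 8)^-1 = A); last by rewrite /A; field; rewrite wn.
by lra.
Qed.

(** The range s < a is given up; beyond it q/(2s) <= a/2. The result e^(-a/2) - a/2 is at least 1 -
    a. *)
Lemma kq_ge q a : 0 <= q -> 0 <= a -> q <= a ^+ 2 -> 1 - a <= kq q.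
Proof.
move=> q0 a0 qa.
have i1 := integrableZl mD (expR (- (a / 2))) (integrable_expRN half0).
pose I : set R := `]0, a[%classic.
have Iint : (\int[leb]_(s in D) (\1_I s)%:E = a%:E)%E.
  transitivity (leb (I `&` D)); first exact: (integral_indic leb mD (measurable_itv _)).
  rewrite (setIidl (_ : I `<=` D)); last by move=> s; rewrite /I /D /= !in_itv/= andbT => /andP[].
  rewrite /I lebesgue_measure_itv/= lte_fin; case: ltP => h; first by rewrite sube0.
  by congr EFin; apply/eqP; rewrite eq_le h a0.
have mI : measurable_fun D (fun s : R => (\1_I s : R)%:E).
  by apply/measurable_EFinP; apply: measurable_funTS; exact: (measurable_indic (measurable_itv _)).
have ia : leb.-integrable D (EFin \o (\1_I : R -> R)).
  apply/integrableP; split; first exact: mI.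
  rewrite (_ : (\int[leb]_(s in D) _)%E = a%:E) ?ltry// -Iint.
  by apply: eq_integral => s _; rewrite gee0_abs// lee_fin.
have le s : D s -> expR (- (a / 2)) * expR (- (2^-1 * s)) - \1_I s <= phi q s.
  rewrite /D /= in_itv/= andbT => s0; rewrite indicE.
  have [sa|sa] := ltP s a.
    rewrite mem_set; last by rewrite /I /= in_itv/= s0 sa.
    rewrite (@le_trans _ _ 0) ?expR_ge0// subr_le0 -expRD -[leRHS]expR0 ler_expR.
    have : 0 <= 2^-1 * s by rewrite mulr_ge0// ltW.
    lra.
  rewrite memNset; last by rewrite /I /= in_itv/= s0/= => /lt_geF; rewrite sa.
  rewrite subr0 /phi [2^-1 * s]mulrC -expRD ler_expR lerD2r lerN2.
  rewrite ler_pdivrMr ?mulr_gt0// (le_trans qa)// expr2.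
  by rewrite (_ : a / 2 * (2 * s) = a * s) ?ler_wpM2l//; field.
have := @le_Rintegral _ _ _ leb D _ (phi q) mD (integrableB mD i1 ia) (iphi q0) le.
rewrite RintegralB// (RintegralZl _ mD (integrable_expRN half0)) (Rintegral_expRN half0) invrK.
have -> : \int[leb]_(s in D) (\1_I s : R) = a by rewrite /Rintegral Iint.
have := expR_ge1Dx (- (a / 2)); rewrite /kq; lra.
Qed.

Lemma measurable_kq d (T : measurableType d) (f : T -> R) : measurable_fun setT f ->
  (forall x, 0 <= f x) -> measurable_fun setT (fun x => kq (f x)).
Proof.
move=> mf f0; apply: measurable_funM => //.
have mphi : measurable_fun setT (fun z : T * measurableTypeR R =>
    (phi (f z.1) z.2 * \1_D z.2)%:E).
  apply/measurable_EFinP; apply: measurable_funM.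
    apply: mphi2; last exact: measurable_snd.
    by apply: (measurableT_comp mf); exact: measurable_fst.
  by apply: (measurableT_comp (measurable_indic mD)); exact: measurable_snd.
have mF := sf_measurable_tonelli sigma_finite_leb mphi.
apply: (eq_measurable_fun (fun x => fine (\int[leb]_s (phi (f x) s * \1_D s)%:E)%E)).
  move=> x _; rewrite /Rintegral; congr fine; rewrite [RHS]integral_mkcond.
  apply: eq_integral => s _; rewrite patchE indicE.
  by case: ifP => _; rewrite ?mulr1 ?mulr0.
apply: (measurableT_comp (@fine_measurable R _ measurableT)); apply: mF => z.
by rewrite lee_fin mulr_ge0 ?expR_ge0.
Qed.

Lemma integral_FTC_pos (F f : R -> R) (a b : R) :
  (forall s : R, 0 < s -> is_derive s 1 F (f s)) ->
  (forall s : R, 0 < s -> f x @[x --> s] --> f s) -> 0 < a -> a < b ->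
  (\int[leb]_(s in `[a, b]) (f s)%:E = (F b - F a)%:E)%E.
Proof.
move=> dF Cf a0 ab.
rewrite (@continuous_FTC2 _ f F)//.
- apply: continuous_in_subspaceT => t; rewrite inE/= in_itv/= => /andP[h _].
  by apply: Cf; exact: lt_le_trans h.
- split.
  + move=> t; rewrite in_itv/= => /andP[h _].
    by apply: (@ex_derive _ _ _ _ _ _ _ (dF _ _)); exact: lt_trans h.
  + by apply: cvg_at_right_filter; exact: is_derive1_cvg (dF _ a0).
  + by apply: cvg_at_left_filter; apply: is_derive1_cvg (dF _ _); exact: lt_trans ab.
- move=> t; rewrite in_itv/= => /andP[h _]; rewrite derive1E.
  by rewrite (@derive_val _ _ _ _ _ _ _ (dF _ (lt_trans a0 h))).
Qed.

Section Ycov.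
Variables (m : R) (x y : plane R).
Let Q := m ^+ 2 * sqnorm (x - y).
Let Q0 : 0 <= Q. Proof. by rewrite mulr_ge0 ?sqr_ge0 ?sqnorm_ge0. Qed.
Let kz (s : R) : R := km m (s *: (x - y)) / s.

Let kzE s : kz s = kq (Q * s ^+ 2) / s.
Proof.
rewrite /kz kmE; congr (kq _ / _); rewrite /Q -mulrA; congr (_ * _).
by rewrite /sqnorm /dot /=; rewrite /GRing.scale/=; ring.
Qed.

Let Qs0 s : 0 <= Q * s ^+ 2. Proof. by rewrite mulr_ge0 ?sqr_ge0. Qed.

Let mkz (A : set R) : measurable A -> measurable_fun A (fun s => (kz s)%:E).
Proof.
move=> mA; apply/measurable_EFinP; apply: measurable_funTS.
have -> : kz = fun s : measurableTypeR R => kq (Q * s ^+ 2) * s^-1.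
  by apply/funext => s; rewrite kzE.
apply: measurable_funM; last exact: measurable_invr.
apply: measurable_kq => //; apply: measurable_funM => //; exact: measurable_funX.
Qed.

Let kz_ge0 s : 0 < s -> 0 <= kz s.
Proof. by move=> s0; rewrite kzE divr_ge0 ?kq_ge0// ltW. Qed.

Let dln (s : R) : 0 < s -> is_derive s 1 (@ln R) s^-1.
Proof. exact: is_derive1_ln. Qed.

Let cinv (s : R) : 0 < s -> t^-1 @[t --> s] --> s^-1.
Proof. by move=> s0; apply: cvgV; [rewrite gt_eqF|exact: cvg_id]. Qed.

Let Iab (a b : R) : \bar R := (\int[leb]_(s in `[a, b]) (kz s)%:E)%E.

Let itv_pos (a b s : R) : 0 < a -> `[a, b]%classic s -> 0 < s.
Proof. by move=> a0; rewrite /= in_itv/= => /andP[h _]; exact: lt_le_trans h. Qed.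

Let Iab_le (F f : R -> R) (a b : R) : (forall s : R, 0 < s -> is_derive s 1 F (f s)) ->
  (forall s : R, 0 < s -> f x @[x --> s] --> f s) ->
  (forall s : R, 0 < s -> kz s <= f s) -> 0 < a -> a < b -> (Iab a b <= (F b - F a)%:E)%E.
Proof.
move=> dF Cf le a0 ab; rewrite -(integral_FTC_pos dF Cf a0 ab).
apply: ge0_le_integral => //.
- by move=> s /(itv_pos a0) s0; rewrite lee_fin kz_ge0.
- exact: mkz.
- apply/measurable_EFinP; apply: subspace_continuous_measurable_fun => //.
  apply: continuous_in_subspaceT => t; rewrite inE/= => /(itv_pos a0); exact: Cf.
- by move=> s /(itv_pos a0) s0; rewrite lee_fin le.
Qed.

Let kz_le_inv s : 0 < s -> kz s <= s^-1.
Proof.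
by move=> s0; rewrite kzE ler_piMl ?invr_ge0 ?(ltW s0)// kq_le1.
Qed.

Let Iab_fin a b : 0 < a -> a < b -> Iab a b = (Ycov m a b x y)%:E.
Proof.
move=> a0 ab; rewrite /Ycov /Rintegral fineK// ge0_fin_numE.
  exact: le_lt_trans (Iab_le dln cinv kz_le_inv a0 ab) (ltry _).
by apply: integral_ge0 => s /(itv_pos a0) s0; rewrite lee_fin kz_ge0.
Qed.

Lemma Ycov_ge0 a b : 0 < a -> a < b -> 0 <= Ycov m a b x y.
Proof.
move=> a0 ab; rewrite -lee_fin -Iab_fin//.
by apply: integral_ge0 => s /(itv_pos a0) s0; rewrite lee_fin kz_ge0.
Qed.

Lemma Ycov_le_ln a b : 0 < a -> a < b -> Ycov m a b x y <= ln b - ln a.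
Proof. by move=> a0 ab; rewrite -lee_fin -Iab_fin//; exact: (Iab_le dln cinv kz_le_inv). Qed.

(** Antiderivative of (1 + Q s^2/8)^-1 / s, the bound that [kq_le] gives for the integrand of the
    covariance. *)
Let F2 (s : R) := ln s - 2^-1 * ln (1 + Q / 8 * s ^+ 2).

Lemma Ycov_le a b : 0 < a -> a < b -> Ycov m a b x y <= F2 b - F2 a.
Proof.
move=> a0 ab; rewrite -lee_fin -Iab_fin//.
have Q80 : 0 <= Q / 8 by rewrite divr_ge0.
have w0 s : 0 < 1 + Q / 8 * s ^+ 2 by rewrite ltr_pwDl// mulr_ge0 ?sqr_ge0.
apply: (@Iab_le F2 (fun s => (1 + Q / 8 * s ^+ 2)^-1 / s)) => //.
- move=> s s0; have d1 := dln s0.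
  have dX : is_derive s 1 (fun t : R => 1 + Q / 8 * t ^+ 2) (Q / 8 * (2 * s)).
    have := is_deriveD (is_derive_cst (1 : R) s 1) (is_deriveZ (Q / 8) (is_deriveX 2 (is_derive_id s 1))).
    by move/is_derive_eq; apply; rewrite /GRing.scale/= expr1; ring.
  have d2 := @is_derive1_comp _ (@ln R) (fun t : R => 1 + Q / 8 * t ^+ 2) _ _ _ (is_derive1_ln (w0 s)) dX.
  have := is_deriveB d1 (is_deriveZ 2^-1 d2).
  move/is_derive_eq; apply; rewrite /GRing.scale/=.
  have w8 : 8 + Q * s ^+ 2 != 0 by rewrite gt_eqF// ltr_pwDl// mulr_ge0 ?sqr_ge0.
  have sn : s != 0 by rewrite gt_eqF.
  by field; rewrite ?w8 ?sn.
- move=> s s0; apply: cvgM; last exact: cinv.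
  apply: cvgV; first by rewrite gt_eqF.
  apply: cvgD; first exact: cvg_cst.
  apply: cvgM; first exact: cvg_cst.
  by under eq_fun do rewrite expr2; rewrite expr2; apply: cvgM; exact: cvg_id.
- move=> s s0; rewrite kzE ler_wpM2r ?invr_ge0 ?(ltW s0)//.
  by rewrite [Q / 8 * _]mulrAC; exact: kq_le.
Qed.

(** By [kq_ge] the integrand is at least 1/s - M, a useful bound only for s up to about 1/M; hence
    the free end point [b'], beyond which the integrand is merely nonnegative. *)
Lemma Ycov_ge (a b b' M : R) : 0 < a -> a < b' -> b' <= b -> 0 <= M -> Q <= M ^+ 2 ->
  ln b' - ln a - M * (b' - a) <= Ycov m a b x y.
Proof.
move=> a0 ab bb M0 QM; have ab' := lt_le_trans ab bb.
rewrite lerBlDr -lee_fin [X in (_ <= X)%E]EFinD -Iab_fin//.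
rewrite -(integral_FTC_pos dln cinv a0 ab).
apply: (@le_trans _ _ (\int[leb]_(s in `[a, b']) ((kz s)%:E + M%:E))%E).
  apply: ge0_le_integral => //.
  - by move=> s /(itv_pos a0) s0; rewrite lee_fin invr_ge0 ltW.
  - by apply/measurable_EFinP; apply: measurable_funTS; exact: measurable_invr.
  - by apply: emeasurable_funD => //; exact: mkz.
  move=> s /(itv_pos a0) s0; rewrite -EFinD lee_fin kzE.
  have h : 1 - M * s <= kq (Q * s ^+ 2).
    apply: kq_ge => //; first by rewrite mulr_ge0 ?(ltW s0).
    by rewrite exprMn ler_wpM2r ?sqr_ge0.
  rewrite -(ler_pM2r s0) mulVf ?gt_eqF// mulrDl mulfVK ?gt_eqF//; lra.
rewrite ge0_integralD//; last 2 first.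
- by move=> s /(itv_pos a0) s0; rewrite lee_fin kz_ge0.
- exact: mkz.
apply: leeD.
  apply: ge0_subset_integral => //; first exact: mkz.
    by move=> s /(itv_pos a0) s0; rewrite lee_fin kz_ge0.
  by move=> s /=; rewrite !in_itv/= => /andP[-> h]/=; exact: le_trans bb.
rewrite integral_cst// EFinM; apply: lee_wpmul2l; first by rewrite lee_fin.
have lE : leb (`[a, b']%classic : set R) = (b' - a)%:E := leb_itvcc (ltW ab).
by rewrite -lE.
Qed.

End Ycov.

Lemma Ycov_diag (m : R) (x : plane R) (a b : R) : 0 < a -> a < b -> Ycov m a b x x = ln b - ln a.
Proof.
move=> a0 ab; apply/eqP; rewrite eq_le Ycov_le_ln//=.
have := @Ycov_ge m x x a b b 0 a0 ab (lexx _) (lexx _).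
rewrite mul0r subr0; apply.
by rewrite subrr /sqnorm /dot /= !mulr0 addr0 mulr0 expr0n.
Qed.

End MassiveKernel.

(** * Exponential moments of Gaussian fields *)

Lemma measurable_setlt d (T : measurableType d) (R : realType) (f g : T -> R) :
  measurable_fun setT f -> measurable_fun setT g -> measurable [set x | f x < g x].
Proof.
move=> mf mg; rewrite -[X in measurable X]setTI.
under eq_set => x do rewrite -lte_fin.
by apply: measurable_lte => //; exact/measurable_EFinP.
Qed.

Section LayerCake.
Context d (T : measurableType d) (R : realType).
Notation leb := (@lebesgue_measure R).

(** Laws and independence are given on events, so integrals are reached through superlevel sets. The
    condition [0 <= u] lets the layer-cake integral run over the whole line. *)
Definition superlevel (f : T -> R) (u : R) : set T := [set x | 0 <= u < f x].

Lemma measurable_superlevel2 (f : T -> R) : measurable_fun setT f ->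
  measurable_fun setT (fun z : T * measurableTypeR R => \1_(superlevel f z.2) z.1 : R).
Proof.
move=> mf; have -> : (fun z : T * measurableTypeR R => \1_(superlevel f z.2) z.1 : R) =
    \1_[set z : T * measurableTypeR R | 0 <= z.2 < f z.1].
  apply/funext => z; rewrite !indicE; congr (_%:R); congr nat_of_bool.
apply: measurable_indic.
rewrite (_ : [set z | _] = [set z | 0 <= z.2] `&` [set z | z.2 < f z.1]); last first.
  by apply/seteqP; split => z /=; [move/andP|move=> /andP].
have m2 : measurable_fun setT (snd : T * measurableTypeR R -> R) by exact: measurable_snd.
have m1 : measurable_fun setT (fun z : T * measurableTypeR R => f z.1).
  by apply: (measurableT_comp mf); exact: measurable_fst.
apply: measurableI; last exact: measurable_setlt.
rewrite -[X in measurable X]setTI.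
by apply: measurable_fun_le => //; exact: measurable_cst.
Qed.

Lemma measurable_superlevel (f : T -> R) u : measurable_fun setT f -> measurable (superlevel f u).
Proof.
move=> mf; have := measurable_fun_pair1 u (measurable_superlevel2 mf).
have [u0|u0] := leP 0 u; last first.
  move=> _; rewrite (_ : superlevel f u = set0)//; apply/seteqP; split => // x /= /andP[].
  by rewrite leNgt u0.
move=> _; rewrite (_ : superlevel f u = [set x | u < f x]).
  by apply: measurable_setlt => //; exact: measurable_cst.
by apply/seteqP; split => x /=; rewrite /superlevel/= u0.
Qed.

Lemma layer_cake_fun (f : T -> R) x : 0 <= f x ->
  ((f x)%:E = \int[leb]_u (\1_(superlevel f u) x)%:E)%E.
Proof.
move=> f0; have -> : (fun u : R => (\1_(superlevel f u) x : R)%:E) =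
    (fun u => (\1_(`[0, f x[%classic : set R) u)%:E).
  apply/funext => u; rewrite !indicE; congr (_%:R%:E); congr nat_of_bool.
pose I : set R := `[0, f x[%classic.
have -> : (\int[leb]_u (\1_I u)%:E = leb I)%E.
  rewrite -[in RHS](setIT I); exact: (integral_indic leb measurableT (measurable_itv _)).
rewrite /I.
rewrite lebesgue_measure_itv/= lte_fin; case: ltP => h; first by rewrite sube0.
by congr EFin; apply/eqP; rewrite eq_le h f0.
Qed.

Lemma layer_cake (mu : {measure set T -> \bar R}) (f : T -> R) : sigma_finite setT mu ->
  measurable_fun setT f -> (forall x, 0 <= f x) ->
  (\int[mu]_x (f x)%:E = \int[leb]_u mu (superlevel f u))%E.
Proof.
move=> smu mf f0; under eq_integral do rewrite layer_cake_fun//.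
rewrite (sf_tonelli smu sigma_finite_leb (f := fun z => (\1_(superlevel f z.2) z.1)%:E))//.
- apply: eq_integral => u _; rewrite integral_indic ?setIT//; exact: measurable_superlevel.
- by apply/measurable_EFinP; exact: measurable_superlevel2.
Qed.

Lemma layer_cake_prod (mu : {measure set T -> \bar R}) (f g : T -> R) : sigma_finite setT mu ->
  measurable_fun setT f -> (forall x, 0 <= f x) ->
  measurable_fun setT g -> (forall x, 0 <= g x) ->
  (\int[mu]_x (g x * f x)%:E = \int[leb]_u \int[mu]_x (g x * \1_(superlevel f u) x)%:E)%E.
Proof.
move=> smu mf f0 mg g0.
rewrite (eq_integral (fun x => \int[leb]_u (g x * \1_(superlevel f u) x)%:E)%E).
  rewrite (sf_tonelli smu sigma_finite_leb (f := fun z => (g z.1 * \1_(superlevel f z.2) z.1)%:E))//.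
  - apply/measurable_EFinP; apply: measurable_funM; last exact: measurable_superlevel2.
    by apply: (measurableT_comp mg); exact: measurable_fst.
  - by move=> z; rewrite lee_fin mulr_ge0.
move=> x _; rewrite EFinM (layer_cake_fun (f0 x)) -ge0_integralZl//.
  by apply/measurable_EFinP; exact: (measurable_fun_pair2 x (measurable_superlevel2 mf)).
by rewrite lee_fin.
Qed.

End LayerCake.

Section NormalMgf.
Context {R : realType}.
Notation leb := (@lebesgue_measure R).

Lemma normal_pdf_tilt (s a x : R) : s != 0 ->
  expR (a * x) * normal_pdf 0 s x = expR (a ^+ 2 * s ^+ 2 / 2) * normal_pdf (a * s ^+ 2) s x.
Proof.
move=> s0; rewrite !normal_pdfE// mulrCA [RHS]mulrCA; congr (_ * _).
rewrite /normal_fun -!expRD; congr expR; rewrite subr0.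
by field.
Qed.

Lemma measurable_expRZ d (T : measurableType d) (a : R) (X : T -> R) : measurable_fun setT X ->
  measurable_fun setT (fun x => expR (a * X x)).
Proof. by move=> mX; apply: measurableT_comp => //; exact: measurable_funM. Qed.

(** The layer-cake formula transfers the law of [X] from events to the exponential; completing the
    square in the density then gives a normal density with a shifted mean. *)
Lemma centered_gaussian_mgf d (T : measurableType d) (P : probability T R) (X : T -> R) :
  centered_gaussian P X ->
  exists v : R, forall a : R,
    (\int[P]_w (expR (a * X w))%:E = (expR (a ^+ 2 * v / 2))%:E)%E.
Proof.
move=> [mX [s lawX]]; exists (s ^+ 2) => a; have sP : sigma_finite setT P := sigma_finiteT P.
(* The Dirac case: [X] vanishes almost surely. *)
have [s0|s0] := eqVneq s 0.
  rewrite s0 expr0n/= mulr0 mul0r expR0 -[RHS](probability_setT P).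
  rewrite -[RHS]mul1e -integral_cst//; apply: ae_eq_integral => //.
    by apply/measurable_EFinP; exact: measurable_expRZ.
  exists (X @^-1` (~` [set 0])); split.
  - by rewrite -[X in measurable X]setTI; apply: mX => //; exact: measurableC.
  - apply: (etrans (lawX _ _)); first exact: measurableC.
    by rewrite s0 eqxx diracE/= memNset//; apply.
  - move=> w /= h /eqP X0; apply: h => _.
    by rewrite /= in X0 *; move/eqP: X0 => ->; rewrite mulr0 expR0.
rewrite layer_cake//; last exact: measurable_expRZ.
pose f (x : measurableTypeR R) : R := expR (a * x).
have mf : measurable_fun setT f by exact: measurable_expRZ.
transitivity (\int[leb]_u \int[leb]_x (normal_pdf 0 s x * \1_(superlevel f u) x)%:E)%E.
  apply: eq_integral => u _.
  rewrite (_ : superlevel _ u = X @^-1` (superlevel f u))//.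
  rewrite [LHS](lawX _ (measurable_superlevel u mf)) (negbTE s0) /normal_prob integral_mkcond; apply: eq_integral => x _.
  by rewrite patchE indicE; case: ifP => _; rewrite ?mulr1 ?mulr0.
rewrite -layer_cake_prod//; first last.
- by move=> x; exact: normal_pdf_ge0.
- exact: measurable_normal_pdf.
- by move=> x; exact: expR_ge0.
- exact: sigma_finite_leb.
transitivity (\int[leb]_x ((expR (a ^+ 2 * s ^+ 2 / 2))%:E * (normal_pdf (a * s ^+ 2) s x)%:E))%E.
  by apply: eq_integral => x _; rewrite -EFinM -normal_pdf_tilt// mulrC.
rewrite ge0_integralZl//.
- by rewrite integral_normal_pdf// mule1.
- by apply/measurable_EFinP; exact: measurable_normal_pdf.
- by move=> x _; rewrite lee_fin normal_pdf_ge0.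
Qed.

End NormalMgf.

Section SecondMoment.
Context {R : realType}.

(** The second difference of the exponential is the square of e^(y/2) - e^(-y/2), and it is compared
    with y^2 up to a relative error which tends to 1 with y. *)
Lemma cosh_bounds (y : R) :
  y ^+ 2 * expR (- `|y|) <= expR y + expR (- y) - 2 <= y ^+ 2 * expR `|y|.
Proof.
wlog y0 : y / 0 <= y => [h|].
  have [|/ltW y0] := leP 0 y; first exact: h.
  have := h (- y); rewrite oppr_ge0 => /(_ y0).
  by rewrite opprK normrN sqrrN [expR (- y) + _]addrC.
rewrite ger0_norm//; pose u := y / 2; have yu : y = u + u by rewrite /u; field.
have u0 : 0 <= u by rewrite divr_ge0.
have eu := expR_gt0 u; have eu' := expR_gt0 (- u).
have uu : expR u * expR (- u) = 1 by rewrite -expRD subrr expR0.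
have -> : expR y + expR (- y) - 2 = (expR u - expR (- u)) ^+ 2.
  rewrite yu opprD !expRD; rewrite [X in _ - X](_ : 2 = 2 * (expR u * expR (- u))); last by rewrite uu mulr1.
  by ring.
have -> : y ^+ 2 * expR (- y) = (2 * u * expR (- u)) ^+ 2 by rewrite yu opprD expRD; ring.
have -> : y ^+ 2 * expR y = (2 * u * expR u) ^+ 2 by rewrite yu expRD; ring.
have h1 : 2 * u * expR (- u) <= expR u - expR (- u).
  rewrite -(ler_pM2r eu) mulrBl -!mulrA [expR (- u) * expR u]mulrC uu mulr1 -expRD.
  have := expR_ge1Dx (u + u); lra.
have h2 : expR u - expR (- u) <= 2 * u * expR u.
  rewrite -(ler_pM2r eu') mulrBl -!mulrA uu mulr1 -expRD.
  have := expR_ge1Dx (- u - u); lra.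
have h0 : 0 <= 2 * u * expR (- u) by rewrite !mulr_ge0// ltW.
have h3 : 0 <= expR u - expR (- u) := le_trans h0 h1.
by rewrite !lerXn2r ?nnegrE// (le_trans h3).
Qed.

Lemma expRB1_bounds (w : R) : w <= expR w - 1 <= w * expR w.
Proof.
have := expR_ge1Dx w; have := expR_ge1Dx (- w); have := expR_gt0 w => e0 h1 h2.
apply/andP; split; first lra.
move: h1; rewrite -(ler_pM2r e0) -expRD addNr expR0 mulrDl mul1r mulNr; lra.
Qed.

Lemma cvg_expR_div (c : R) : expR (c / n.+1%:R) @[n --> \oo] --> (1 : R).
Proof.
rewrite (_ : nbhs (1 : R) = nbhs (expR (c * 0))); last by rewrite mulr0 expR0.
have h : (c / n.+1%:R) @[n --> \oo] --> c * 0 by apply: cvgM; [exact: cvg_cst|exact: cvg_harmonic].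
exact: (cvg_comp (fun n => c / n.+1%:R) expR h (@continuous_expR R _)).
Qed.

Section Mgf.
Context d (T : measurableType d) (P : probability T R) (X : T -> R) (v : R).
Hypothesis mX : measurable_fun setT X.
Hypothesis mgf : forall a : R,
    (\int[P]_w (expR (a * X w))%:E = (expR (a ^+ 2 * v / 2))%:E)%E.

Lemma mgf_integrable a : P.-integrable setT (EFin \o (fun w => expR (a * X w))).
Proof.
apply: integrable_EFinP; first exact: measurable_expRZ.
under eq_integral do rewrite ger0_norm ?expR_ge0//.
by rewrite mgf ltry.
Qed.

Let mgfR a : \int[P]_w expR (a * X w) = expR (a ^+ 2 * v / 2).
Proof. by rewrite /Rintegral mgf. Qed.

Let dom w : R := 4 * expR (2 * X w) + 4 * expR (- 2 * X w).

Let idom : P.-integrable setT (EFin \o dom).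
Proof.
exact: (integrableD measurableT (integrableZl measurableT 4 (mgf_integrable 2))
  (integrableZl measurableT 4 (mgf_integrable (- 2)))).
Qed.

Let sqr_dom w : X w ^+ 2 * expR `|X w| <= dom w.
Proof.
set x := X w; have h : `|x| <= 2 * expR (`|x| / 2).
  have := expR_ge1Dx (`|x| / 2); lra.
have h2 : x ^+ 2 <= 4 * expR `|x|.
  rewrite -[x ^+ 2]real_normK ?num_real// (le_trans (lerXn2r 2 _ _ h)) ?nnegrE//.
  rewrite expr2 mulrACA -expRD -splitr ler_wpM2r ?expR_ge0//; lra.
apply: (@le_trans _ _ (4 * expR (2 * `|x|))).
  apply: (le_trans (ler_wpM2r (expR_ge0 _) h2)).
  by rewrite -mulrA -expRD (_ : 2 * `|x| = `|x| + `|x|)//; ring.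
rewrite /dom -/x; case: (ler0P x) => _.
  by rewrite mulrN -mulNr lerDr mulr_ge0 ?expR_ge0.
by rewrite lerDl mulr_ge0 ?expR_ge0.
Qed.

Let f n w : R := n.+1%:R ^+ 2 * (expR (n.+1%:R^-1 * X w) + expR (- n.+1%:R^-1 * X w) - 2).

Let f_bounds n w : X w ^+ 2 * expR (- `|X w| / n.+1%:R) <= f n w <= X w ^+ 2 * expR (`|X w| / n.+1%:R).
Proof.
have n0 : n.+1%:R != 0 :> R by rewrite pnatr_eq0.
have n1 : 0 <= n.+1%:R ^+ 2 :> R by rewrite sqr_ge0.
have /andP[h1 h2] := cosh_bounds (n.+1%:R^-1 * X w).
have e : `|n.+1%:R^-1 * X w| = `|X w| / n.+1%:R by rewrite normrM ger0_norm// mulrC.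
have q : (n.+1%:R^-1 * X w) ^+ 2 = X w ^+ 2 / n.+1%:R ^+ 2 by rewrite exprMn exprVn mulrC.
have s z : X w ^+ 2 * z = n.+1%:R ^+ 2 * (X w ^+ 2 / n.+1%:R ^+ 2 * z) by field.
move: h1 h2; rewrite e q -!mulNr => h1 h2; rewrite /f.
by rewrite (s (expR (- `|X w| / n.+1%:R))) (s (expR (`|X w| / n.+1%:R))) !ler_wpM2l.
Qed.

(** The second moment is the second derivative at 0 of the moment generating function, obtained as
    the limit of the expectations of the second difference quotients [f n] of step 1/(n+1),
    dominated by [dom]. *)
Lemma mgf_second_moment : (\int[P]_w (X w ^+ 2)%:E = v%:E)%E.
Proof.
have isq : P.-integrable setT (EFin \o (fun w => X w ^+ 2)).
  apply: (le_integrable measurableT _ _ idom).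
    by apply/measurable_EFinP; exact: measurable_funX.
  move=> w _; rewrite /= lee_fin [leLHS]ger0_norm ?sqr_ge0// (le_trans _ (ler_norm _))//.
  apply: le_trans (sqr_dom w); rewrite ler_peMr ?sqr_ge0//.
  by have := expR_ge1Dx `|X w|; apply: le_trans; rewrite lerDl.
rewrite -(Rintegral_fine isq); congr EFin.
have mf n : measurable_fun setT (f n).
  apply: measurable_funM => //; apply: measurable_funB => //.
  by apply: measurable_funD; exact: measurable_expRZ.
have L1 : \int[P]_w f n w @[n --> \oo] --> \int[P]_w (X w ^+ 2).
  apply: (Rintegral_dominated_cvg mf _ idom).
  - move=> w; apply: (@squeeze_cvgr _ _ _ _ (fun n => X w ^+ 2 * expR (- `|X w| / n.+1%:R))
      (fun n => X w ^+ 2 * expR (`|X w| / n.+1%:R))).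
    + by apply: nearW => n; exact: f_bounds.
    + by rewrite -[X in _ --> X]mulr1; apply: cvgM; [exact: cvg_cst|exact: cvg_expR_div].
    + by rewrite -[X in _ --> X]mulr1; apply: cvgM; [exact: cvg_cst|exact: cvg_expR_div].
  - move=> n w; have /andP[h1 h2] := f_bounds n w.
    rewrite ger0_norm; last by rewrite (le_trans _ h1)// mulr_ge0 ?sqr_ge0 ?expR_ge0.
    apply: le_trans h2 (le_trans _ (sqr_dom w)).
    by rewrite ler_wpM2l ?sqr_ge0// ler_expR ler_pdivrMr// ler_peMr// ler1n.
have E n : \int[P]_w f n w = 2 * n.+1%:R ^+ 2 * (expR (v / 2 / n.+1%:R ^+ 2) - 1).
  have i1 := mgf_integrable n.+1%:R^-1; have i2 := mgf_integrable (- n.+1%:R^-1).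
  have i3 := integrableD measurableT i1 i2.
  have ic : P.-integrable setT (EFin \o (fun=> 2 : R)) by exact: finite_measure_integrable_cst.
  rewrite /f RintegralZl//; last exact: (integrableB measurableT i3 ic).
  rewrite (RintegralB measurableT i3 ic) (RintegralD measurableT i1 i2) !mgfR Rintegral_cst//.
  have P1 : fine (P setT) = 1 by rewrite probability_setT.
  rewrite P1 mulr1.
  rewrite sqrrN exprVn (_ : _^-1 * v / 2 = v / 2 / n.+1%:R ^+ 2); last by ring.
  by ring.
have L2 : \int[P]_w f n w @[n --> \oo] --> v.
  under eq_fun do rewrite E.
  have nz n : n.+1%:R ^+ 2 != 0 :> R by rewrite expf_neq0// pnatr_eq0.
  apply: (@squeeze_cvgr _ _ _ _ (fun n => v) (fun n => v * expR (v / 2 / n.+1%:R ^+ 2))).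
  - apply: nearW => n; have /andP[h1 h2] := expRB1_bounds (v / 2 / n.+1%:R ^+ 2).
    have n1 : 0 <= 2 * n.+1%:R ^+ 2 :> R by rewrite mulr_ge0 ?sqr_ge0.
    have s z : v * z = 2 * n.+1%:R ^+ 2 * (v / 2 / n.+1%:R ^+ 2 * z) by field.
    have s1 : v = 2 * n.+1%:R ^+ 2 * (v / 2 / n.+1%:R ^+ 2) by field.
    rewrite (s (expR _)); apply/andP; split; last by rewrite ler_wpM2l.
    by rewrite [leLHS]s1 ler_wpM2l.
  - exact: cvg_cst.
  - rewrite -[X in _ --> X]mulr1; apply: cvgM; first exact: cvg_cst.
    rewrite (_ : nbhs (1 : R) = nbhs (expR (v / 2 * 0))); last by rewrite mulr0 expR0.
    have h : (v / 2 / n.+1%:R ^+ 2) @[n --> \oo] --> v / 2 * 0.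
      apply: cvgM; first exact: cvg_cst.
      rewrite (_ : (fun x => _) = fun n => n.+1%:R^-1 * n.+1%:R^-1).
        have hh : (n.+1%:R^-1 * n.+1%:R^-1 : R) @[n --> \oo] --> (0 * 0 : R).
          by apply: cvgM; exact: cvg_harmonic.
        by rewrite mulr0 in hh.
      by apply/funext => k; rewrite -exprVn expr2.
    exact: (cvg_comp (fun n => v / 2 / n.+1%:R ^+ 2) expR h (@continuous_expR R _)).
exact: (cvg_unique _ L1 L2).
Qed.

End Mgf.

End SecondMoment.

(** * Expectation of a product of independent nonnegative variables *)

Section IndependentProduct.
Context d (T : measurableType d) (R : realType) (P : probability T R).
Notation leb := (@lebesgue_measure R).
Variables (F : nat -> set (set T)) (f : nat -> T -> R).
Hypothesis indF : independent P F.
Hypothesis mf : forall k, measurable_fun setT (f k).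
Hypothesis f0 : forall k w, 0 <= f k w.
Hypothesis Ff : forall k u, F k (superlevel (f k) u).

(** Hybrid factors for an induction on [j]: the first [j] are the variables, the remaining ones are
    indicators of independent events. *)
Let h (j : nat) (B : nat -> set T) (k : nat) (w : T) : R :=
  if (k < j)%N then f k w else \1_(B k) w.

Let h0 j B k w : 0 <= h j B k w.
Proof. by rewrite /h; case: ifP => // _; rewrite indicE. Qed.

Let mh j B k : (forall k, measurable (B k)) -> measurable_fun setT (h j B k).
Proof. by move=> mB; rewrite /h; case: (k < j)%N => //; exact: measurable_indic. Qed.

Let sP : sigma_finite setT P := sigma_finiteT P.

Let step n j : (j <= n)%N -> forall B, (forall k, measurable (B k)) -> (forall k, F k (B k)) ->
  (\int[P]_w (\prod_(k < n) h j B k w)%:E = \prod_(k < n) \int[P]_w (h j B k w)%:E)%E.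
Proof.
elim: j => [_|j ih jn] B mB FB.
  (* With indicators only, the claim is the independence of the events. *)
  transitivity (P (\bigcap_(k < n) B k)).
    have mI : measurable (\bigcap_(k < n) B k).
      by apply: bigcap_measurableType => k _; exact: mB.
    rewrite -[in RHS](setIT (\bigcap_(k < n) B k)) -integral_indic//.
    apply: eq_integral => w _; congr EFin; rewrite indicE.
    have [|wB] := boolP (w \in _).
      rewrite inE => wB; rewrite big1// => i _.
      by rewrite /h ltn0 indicE mem_set//; apply: wB => /=.
    rewrite notin_setE in wB; move/existsNP: wB => [i /not_implyP[/= ni nB]].
    apply/eqP/prodf_eq0; exists (Ordinal ni) => //.
    by rewrite /h ltn0 indicE memNset.
  rewrite indF//; apply: eq_bigr => k _.
  by rewrite /h ltn0 integral_indic// setIT.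
pose i0 := Ordinal jn.
pose G w := \prod_(k < n | k != i0) h j.+1 B k w.
have G0 w : 0 <= G w by apply: prodr_ge0 => k _; exact: h0.
have mG : measurable_fun setT G.
  rewrite /G; under eq_fun do rewrite big_mkcond/=.
  by apply: measurable_prod => k _; case: (k != i0) => //; exact: mh.
(* Layer cake replaces the factor [f j] by the indicator of a superlevel set, which the induction
   hypothesis accepts as the event of index [j]. *)
pose Bu u (k : nat) := if k == j then superlevel (f j) u else B k.
have hj u k w : k != i0 -> h j (Bu u) k w = h j.+1 B k w.
  move=> ki; have kj : (k : nat) != j by apply: contra ki => /eqP e; apply/eqP/val_inj.
  by rewrite /h /Bu (negbTE kj) ltnS [(k <= j)%N]leq_eqVlt (negbTE kj).
have hij u w : h j (Bu u) i0 w = \1_(superlevel (f j) u) w by rewrite /h /Bu /= ltnn eqxx.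
transitivity (\int[P]_w (G w * f j w)%:E)%E.
  apply: eq_integral => w _; rewrite (bigD1 i0)//= mulrC /h ltnSn; congr (_ * _)%:E.
rewrite layer_cake_prod//.
have E u : (\int[P]_w (G w * \1_(superlevel (f j) u) w)%:E =
    P (superlevel (f j) u) * \prod_(k < n | k != i0) \int[P]_w (h j.+1 B k w)%:E)%E.
  have mBu k : measurable (Bu u k).
    by rewrite /Bu; case: ifP => // _; exact: measurable_superlevel.
  have FBu k : F k (Bu u k).
    by rewrite /Bu; case: eqP => [->|].
  transitivity (\int[P]_w (\prod_(k < n) h j (Bu u) k w)%:E)%E.
    apply: eq_integral => w _; rewrite (bigD1 i0)//= hij mulrC; congr (_ * _)%:E.
    by apply: eq_bigr => k ki; rewrite hj.
  rewrite ih ?(ltnW jn)// (bigD1 i0)//=; congr (_ * _)%E.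
    under eq_integral do rewrite hij.
    by rewrite integral_indic ?setIT//; exact: measurable_superlevel.
  by apply: eq_bigr => k ki; apply: eq_integral => w _; rewrite hj.
under eq_integral do rewrite E.
rewrite ge0_integralZr//.
- by rewrite -layer_cake// [RHS](bigD1 i0)//= /h ltnSn.
- apply: (eq_measurable_fun (fun u => \int[P]_w (\1_(superlevel (f j) u) w)%:E)%E).
    by move=> u _; rewrite integral_indic ?setIT//; exact: measurable_superlevel.
  have ms : measurable_fun setT (fun z : measurableTypeR R * T => (\1_(superlevel (f j) z.1) z.2 : R)%:E).
    apply/measurable_EFinP.
    exact: (measurableT_comp (measurable_superlevel2 (mf j)) (@measurable_swap _ _ _ _)).
  exact: (sf_measurable_tonelli (f := fun z => (\1_(superlevel (f j) z.1) z.2)%:E) sP ms).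
- by apply: prode_ge0 => k _; apply: integral_ge0 => w _; rewrite lee_fin.
Qed.

Lemma independent_integral_prod n :
  (\int[P]_w (\prod_(k < n) f k w)%:E = \prod_(k < n) \int[P]_w (f k w)%:E)%E.
Proof.
have mB0 k : measurable (superlevel (f k) 0) by exact: measurable_superlevel.
have := step (leqnn n) mB0 (fun k => Ff k 0).
rewrite (eq_integral (fun w => (\prod_(k < n) f k w)%:E)); last first.
  by move=> w _; congr EFin; apply: eq_bigr => k _; rewrite /h ltn_ord.
by move=> ->; apply: eq_bigr => k _; rewrite /h ltn_ord.
Qed.

End IndependentProduct.

Lemma Rintegral_sum_ord d (T : measurableType d) (R : realType) (mu : {measure set T -> \bar R})
    n (f : 'I_n -> T -> R) : (forall i, mu.-integrable setT (EFin \o f i)) ->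
  \int[mu]_x (\sum_(i < n) f i x) = \sum_(i < n) \int[mu]_x f i x.
Proof.
elim: n f => [|n ih] f fi.
  by rewrite big_ord0; under eq_Rintegral do rewrite big_ord0; rewrite Rintegral_cst// mul0r.
rewrite big_ord_recr/=; under eq_Rintegral do rewrite big_ord_recr/=.
rewrite RintegralD// ?ih//.
rewrite (_ : _ \o _ = fun x => (\sum_(i < n) (f (widen_ord (leqnSn n) i) x)%:E)%E).
  by apply: integrable_sum => // i _; exact: fi.
by apply/funext => x; rewrite /= sumEFin.
Qed.

Lemma Rintegral_cstM d (T : measurableType d) (R : realType) (mu : {measure set T -> \bar R})
  (c : R) (f : T -> R) : mu.-integrable setT (EFin \o f) ->
  \int[mu]_x (c * f x) = c * \int[mu]_x f x.
Proof. by move=> fi; rewrite RintegralZl. Qed.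

Section Field.
Context {R : realType} {d : measure_display} {T : measurableType d}.
Context (P : probability T R) (m : R) (c : nat -> R) (Y : nat -> plane R -> T -> R).
Hypothesis gff : massive_gff_fields P m c Y.

Lemma measurable_Y k z : measurable_fun setT (Y k z).
Proof.
have := Y_gaussian gff k (fun=> z : plane R) (fun=> 1 : R) (n := 1).
by move=> [+ _]; under eq_fun do rewrite big_ord1 mul1r.
Qed.

Lemma Y_square_integrable k z : Y k z \in Lfun P 2%:E.
Proof.
have gY := Y_gaussian gff k (fun=> z : plane R) (fun=> 1 : R) (n := 1).
have e : (fun w => \sum_(i < 1) 1 * Y k z w) = Y k z by apply/funext => w; rewrite big_ord1 mul1r.
rewrite e in gY; have [v hv] := centered_gaussian_mgf gY.
apply/square_integrableP; split; first exact: measurable_Y.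
by rewrite (mgf_second_moment (measurable_Y k z) hv) ltry.
Qed.

(** The Gaussian parameter [v] is identified with the second moment of the combination, which
    [Y_covariance] expands as a quadratic form. *)
Lemma Y_mgf k N (z : 'I_N -> plane R) (a : 'I_N -> R) :
  (\int[P]_w (expR (\sum_(i < N) a i * Y k (z i) w))%:E =
   (expR (2^-1 * \sum_(i < N) \sum_(j < N) a i * a j * Ycov m (c k) (c k.+1) (z i) (z j)))%:E)%E.
Proof.
have gW := Y_gaussian gff k z a; set W := (fun w => _) in gW.
have [mW _] := gW; have [v hv] := centered_gaussian_mgf gW.
have := mgf_second_moment mW hv; have := hv 1; rewrite expr1n mul1r.
under eq_integral do rewrite mul1r; move=> -> W2; congr (expR _)%:E; rewrite mulrC; congr (_ * _).
have iYY i j : P.-integrable setT (EFin \o (fun w => Y k (z i) w * Y k (z j) w)).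
  by apply: square_integrable_prod; exact: Y_square_integrable.
have cov i j : \int[P]_w (Y k (z i) w * Y k (z j) w) = Ycov m (c k) (c k.+1) (z i) (z j).
  have := Y_covariance gff k (z i) (z j); rewrite unlock => h.
  by rewrite /Rintegral h.
have : \int[P]_w (W w ^+ 2) = v by rewrite /Rintegral W2.
move=> <-; rewrite (eq_Rintegral P (g := fun w =>
   \sum_(i < N) \sum_(j < N) a i * a j * (Y k (z i) w * Y k (z j) w))); last first.
  move=> w _; rewrite /W expr2 mulr_suml; apply: eq_bigr => i _.
  by rewrite mulr_sumr; apply: eq_bigr => j _; ring.
have is_ i : P.-integrable setT (EFin \o (fun w => \sum_(j < N) a i * a j * (Y k (z i) w * Y k (z j) w))).
  rewrite (_ : _ \o _ = fun w => (\sum_(j < N) (a i * a j * (Y k (z i) w * Y k (z j) w))%:E)%E).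
    apply: integrable_sum => // j _.
    exact: (integrableZl measurableT (a i * a j) (iYY i j)).
  by apply/funext => w /=; rewrite sumEFin.
rewrite Rintegral_sum_ord//; apply: eq_bigr => i _.
rewrite Rintegral_sum_ord//; last by move=> j; exact: (integrableZl measurableT (a i * a j) (iYY i j)).
by apply: eq_bigr => j _; rewrite Rintegral_cstM// cov.
Qed.

Definition Xcov n (x y : plane R) : R := \sum_(k < n) Ycov m (c k) (c k.+1) x y.

Let superlevel_field k N (z : 'I_N -> plane R) (a : 'I_N -> R) u :
  field_sigma (Y k) (superlevel (fun w => expR (\sum_(i < N) a i * Y k (z i) w)) u).
Proof.
rewrite /field_sigma; set G := [set A | _].
(* Measurability is stated on the space carrying the generated sigma-algebra, so that the superlevel
   set lands in [field_sigma]. *)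
have mY x : measurable_fun setT (Y k x : g_sigma_algebraType G -> R).
  move=> _ U mU; rewrite setTI; apply: sub_sigma_algebra.
  by exists x, U.
have mf : measurable_fun setT
    ((fun w => expR (\sum_(i < N) a i * Y k (z i) w)) : g_sigma_algebraType G -> R).
  apply: measurableT_comp => //; apply: measurable_sum => i.
  exact: measurable_funM.
exact: (measurable_superlevel u mf).
Qed.

Lemma partial_field_mgf n N (z : 'I_N -> plane R) (a : 'I_N -> R) :
  (\int[P]_w (expR (\sum_(i < N) a i * partial_field Y n (z i) w))%:E =
   (expR (2^-1 * \sum_(i < N) \sum_(j < N) a i * a j * Xcov n (z i) (z j)))%:E)%E.
Proof.
pose f k w := expR (\sum_(i < N) a i * Y k (z i) w).
transitivity (\int[P]_w (\prod_(k < n) f k w)%:E)%E.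
  apply: eq_integral => w _; congr EFin; rewrite /f -expR_sum; congr expR.
  rewrite exchange_big/=; apply: eq_bigr => i _.
  by rewrite /partial_field mulr_sumr.
rewrite (independent_integral_prod (Y_independent gff)).
- under eq_bigr do rewrite Y_mgf.
  rewrite prodEFin -expR_sum; congr (expR _)%:E.
  rewrite -mulr_sumr; congr (_ * _); rewrite exchange_big/=; apply: eq_bigr => i _.
  rewrite exchange_big/=; apply: eq_bigr => j _.
  by rewrite /Xcov mulr_sumr.
- move=> k; apply: measurableT_comp => //; apply: measurable_sum => i.
  by apply: measurable_funM => //; exact: measurable_Y.
- by move=> k w; exact: expR_ge0.
- by move=> k u; exact: superlevel_field.
Qed.

Lemma measurable_partial_field n z : measurable_fun setT (partial_field Y n z).
Proof. by apply: measurable_sum => k; exact: measurable_Y. Qed.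

Lemma partial_field_variance n z :
  'E_P[fun w => (partial_field Y n z w ^+ 2)%R]%E = (Xcov n z z)%:E.
Proof.
rewrite unlock; apply: mgf_second_moment; first exact: measurable_partial_field.
move=> a; have := @partial_field_mgf n 1 (fun=> z) (fun=> a).
under eq_integral do rewrite big_ord1.
by rewrite !big_ord1 => ->; congr (expR _)%:E; rewrite expr2; ring.
Qed.

End Field.

(** * Logarithmic bounds for the covariance of the cut-off field, uniform in the cut-off *)

Section CovarianceBounds.
Context {R : realType}.
Variables (m : R) (c : nat -> R).
Hypotheses (m0 : 0 < m) (c0 : c 0%N = 1) (cS : forall k, c k < c k.+1).

Lemma c_ge1 k : 1 <= c k.
Proof. by elim: k => [|k ih]; rewrite ?c0// (le_trans ih)// ltW. Qed.

Lemma c_gt0 k : 0 < c k.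
Proof. exact: lt_le_trans (c_ge1 k). Qed.

Let telescope (G : R -> R) n : \sum_(k < n) (G (c k.+1) - G (c k)) = G (c n) - G 1.
Proof.
rewrite -(big_mkord xpredT (fun k => G (c k.+1) - G (c k))).
by rewrite (telescope_sumr (fun k => G (c k)))// c0.
Qed.

Lemma Xcov_diag n x : Xcov m c n x x = ln (c n).
Proof.
rewrite /Xcov; under eq_bigr do rewrite (Ycov_diag m x (c_gt0 _) (cS _)).
by rewrite telescope ln1 subr0.
Qed.

Lemma Xcov_le_ln n x y : Xcov m c n x y <= ln (c n).
Proof.
apply: (@le_trans _ _ (\sum_(k < n) (ln (c k.+1) - ln (c k)))).
  by apply: ler_sum => k _; apply: Ycov_le_ln; [exact: c_gt0|exact: cS].
by rewrite telescope ln1 subr0.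
Qed.

(** With B = m^2 |x - y|^2 / 8, the telescoped bound is ln c_n - ln(1 + B c_n^2)/2 + ln(1 + B)/2.
    The first two terms are at most -ln(B)/2 whatever n, and rho <= 1 bounds (1 + B)/B by the
    constant over rho^2. *)
Lemma Xcov_le_dist n (x y : plane R) rho : 0 < rho <= 1 -> rho ^+ 2 <= sqnorm (x - y) ->
  Xcov m c n x y <= 2^-1 * ln ((8 + m ^+ 2) / m ^+ 2) - ln rho.
Proof.
move=> /andP[r0 r1] hr; set sq := sqnorm _ in hr.
pose B := m ^+ 2 * sq / 8; pose F2 (s : R) := ln s - 2^-1 * ln (1 + B * s ^+ 2).
have r20 : 0 < rho ^+ 2 by rewrite exprn_gt0.
have m20 : 0 < m ^+ 2 by rewrite exprn_gt0.
have sq0 : 0 < sq by rewrite (lt_le_trans r20).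
have B0 : 0 < B by rewrite divr_gt0// mulr_gt0.
apply: (@le_trans _ _ (\sum_(k < n) (F2 (c k.+1) - F2 (c k)))).
  by apply: ler_sum => k _; apply: Ycov_le; [exact: c_gt0|exact: cS].
rewrite telescope /F2 ln1 expr1n mulr1; have cn := c_gt0 n.
have c2 : 0 < c n ^+ 2 by rewrite exprn_gt0.
have h1 : ln B + 2 * ln (c n) <= ln (1 + B * c n ^+ 2).
  rewrite (_ : 2 * ln (c n) = ln (c n ^+ 2)); last by rewrite lnXn// mulr_natl.
  rewrite -lnM ?posrE// ler_ln ?posrE ?mulr_gt0//; first by rewrite lerDr.
  by rewrite ltr_pwDl// ltW// mulr_gt0.
have h2 : ln (1 + B) - ln B <= ln ((8 + m ^+ 2) / m ^+ 2) - 2 * ln rho.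
  rewrite (_ : 2 * ln rho = ln (rho ^+ 2)); last by rewrite lnXn// mulr_natl.
  have w0 : 0 < 8 + m ^+ 2 by rewrite ltr_wpDr// ltW.
  have B10 : 0 < 1 + B by rewrite ltr_pwDl// ltW.
  have u1 : ln (1 + B) - ln B = ln ((1 + B) / B) by rewrite ln_div ?posrE.
  have wm0 : 0 < (8 + m ^+ 2) / m ^+ 2 by rewrite divr_gt0.
  have u2 : ln ((8 + m ^+ 2) / m ^+ 2) - ln (rho ^+ 2) = ln ((8 + m ^+ 2) / m ^+ 2 / rho ^+ 2).
    by rewrite [RHS]ln_div ?posrE.
  have b1 : 0 < (1 + B) / B by rewrite divr_gt0.
  have b2 : 0 < (8 + m ^+ 2) / m ^+ 2 / rho ^+ 2 by rewrite divr_gt0.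
  rewrite u1 u2 ler_ln ?posrE//.
  have -> : (1 + B) / B = 8 / m ^+ 2 / sq + 1.
    by rewrite /B; field; rewrite !gt_eqF.
  have -> : (8 + m ^+ 2) / m ^+ 2 / rho ^+ 2 = 8 / m ^+ 2 / rho ^+ 2 + (rho ^+ 2)^-1.
    by field; rewrite !gt_eqF.
  have ri : (rho ^+ 2)^-1 >= sq^-1 by rewrite lef_pV2.
  have r1' : 1 <= (rho ^+ 2)^-1 by rewrite invf_ge1// expr_le1// ltW.
  by rewrite lerD// ler_wpM2l// divr_ge0// ltW.
lra.
Qed.

(** The lower bound is accumulated only up to the scale [t]: truncation by a minimum makes the sum
    telescope, and the intervals beyond [t] contribute at least 0. *)
Lemma Xcov_ge n (x y : plane R) r (t : R) : 0 <= r -> sqnorm (x - y) <= r ^+ 2 ->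
  1 <= t <= c n -> ln t - m * r * t <= Xcov m c n x y.
Proof.
move=> r0 hr /andP[t1 tc]; pose M := m * r.
have M0 : 0 <= M by rewrite mulr_ge0// ltW.
have hQ : m ^+ 2 * sqnorm (x - y) <= M ^+ 2 by rewrite exprMn ler_wpM2l ?sqr_ge0.
pose G (s : R) := ln (Num.min s t) - M * Num.min s t.
apply: (@le_trans _ _ (\sum_(k < n) (G (c k.+1) - G (c k)))).
  rewrite telescope /G (min_idPr tc) (min_idPl t1) ln1 -/M; lra.
apply: ler_sum => k _; rewrite /G; have ck := c_gt0 k; have ckS := cS k.
have [tk|kt] := leP t (c k).
  rewrite (min_idPr (le_trans tk (ltW ckS))) subrr; exact: Ycov_ge0.
have [kSt|tkS] := leP (c k.+1) t.
  have := @Ycov_ge _ m x y (c k) (c k.+1) (c k.+1) M ck ckS (lexx _) M0 hQ; lra.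
have := @Ycov_ge _ m x y (c k) (c k.+1) t M ck kt (ltW tkS) M0 hQ; lra.
Qed.

End CovarianceBounds.

(** * Tail of the chaos measure of a small square *)

Section LogSums.
Context {R : realType}.

(** ln(N/d), the excess of the covariance of two averaging points at lag d; lag 0 is handled apart,
    whence the value 0. *)
Definition lrat (N d : nat) : R := if d == 0%N then 0 else ln N%:R - ln d%:R.

Lemma lrat_ge0 N d : (d <= N)%N -> 0 <= lrat N d.
Proof.
rewrite /lrat; case: eqP => // /eqP; rewrite -lt0n => d0 dN.
by rewrite subr_ge0 ler_ln ?posrE ?ltr0n ?(leq_trans d0)// ler_nat.
Qed.

(** Discrete form of int_0^1 ln(1/u) du = 1. From N to N + 1, each of the N terms with d between 1
    and N grows by ln(1 + 1/N) <= 1/N. *)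
Lemma sum_lrat N : \sum_(0 <= d < N.+1) lrat N d <= N%:R.
Proof.
elim: N => [|N ih]; first by rewrite big_nat1 /lrat eqxx.
rewrite big_nat_recr//= {2}/lrat /= subrr addr0.
have [->|N0] := posnP N; first by rewrite big_nat1 /lrat eqxx.
rewrite -natr1 (eq_bigr (fun d => lrat N d + (if d == 0%N then 0 else ln N.+1%:R - ln N%:R))); last first.
  by move=> d _; rewrite /lrat; case: eqP => _; [rewrite addr0|ring].
rewrite big_split/=; apply: lerD => //.
rewrite big_nat_recl//= add0r big_const_nat subn0 iter_addr_0.
have NR : 0 < N%:R :> R by rewrite ltr0n.
have : ln N.+1%:R - ln N%:R <= N%:R^-1 :> R.
  rewrite -ln_div ?posrE ?ltr0n// -natr1 mulrDl divff ?gt_eqF// mul1r.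
  by apply: le_ln1Dx; rewrite (lt_le_trans (ltrN10 _))// invr_ge0 ltW.
set x := _ - _ => h; rewrite -[x *+ N]mulr_natr.
have := ler_wpM2r (ltW NR) h; rewrite mulVf ?gt_eqF//.
Qed.

Lemma sum_lrat_le N n : (n <= N.+1)%N -> \sum_(0 <= d < n) lrat N d <= N%:R.
Proof.
move=> nN; apply: le_trans (sum_lrat N); rewrite (big_cat_nat (leq0n _) nN)//= lerDl.
rewrite big_seq_cond; apply: sumr_ge0 => d; rewrite mem_index_iota andbT => /andP[_ dN].
by apply: lrat_ge0; rewrite -ltnS.
Qed.

(** The sum of the two truncated differences is |i - j|; each side of [i] is bounded by one copy of
    [sum_lrat_le]. *)
Lemma sum_lrat_dist N i : (i < N)%N ->
  \sum_(0 <= j < N) lrat N ((i - j) + (j - i)) <= 2 * N%:R.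
Proof.
move=> iN; rewrite (big_cat_nat (leq0n _) (ltnW iN))//= mulr_natl mulr2n.
apply: lerD.
  rewrite big_nat_rev/= add0n.
  apply: le_trans (sum_lrat_le (n := i.+1) (ltnW iN)).
  rewrite [leRHS]big_nat_recl//= /lrat eqxx add0r -/lrat.
  rewrite le_eqVlt; apply/orP; left; apply/eqP; apply: eq_big_nat => j /andP[_ ji].
  have -> : (i - (i - j.+1) + (i - j.+1 - i) = j.+1)%N.
    by rewrite subKn// (eqP (_ : i - j.+1 - i == 0)%N) ?addn0// subn_eq0 leq_subr.
  by [].
rewrite -{1}[i]add0n big_addn.
apply: le_trans (sum_lrat_le (n := N - i) _); last by rewrite leqW// leq_subr.
rewrite le_eqVlt; apply/orP; left; apply/eqP; apply: eq_bigr => j _.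
by congr lrat; rewrite addnK (eqP (_ : i - (j + i) == 0)%N) ?add0n// subn_eq0 leq_addl.
Qed.

End LogSums.

Lemma leb2_cbox {R : realType} (x : plane R) (r : R) : 0 <= r ->
  leb2 (cbox x r) = (4 * r ^+ 2)%:E.
Proof.
move=> r0; rewrite /leb2 [LHS](product_measure1E (@lebesgue_measure R) (@lebesgue_measure R))//.
have h (a : R) : lebesgue_measure (`[a - r, a + r]%classic : set R) = (2 * r)%:E.
  by rewrite leb_itvcc; [congr EFin; ring|lra].
by rewrite [X in (X * _)%E]h [X in (_ * X)%E]h -EFinM; congr EFin; ring.
Qed.

(** * One-scale and multi-scale tail estimates for an abstract log-correlated field *)

Section LogCorrelated.
Context {R : realType} {d : measure_display} {Om : measurableType d}.
Variables (P : probability Om R) (X : plane R -> Om -> R) (K : plane R -> plane R -> R).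
Variables (l m C1 : R).
Hypothesis mX : measurable_fun setT (fun z : bplane R * Om => X z.1 z.2).
Hypothesis mgfX : forall N (z : 'I_N -> plane R) (a : 'I_N -> R),
  (\int[P]_w (expR (\sum_(i < N) a i * X (z i) w))%:E =
   (expR (2^-1 * \sum_(i < N) \sum_(j < N) a i * a j * K (z i) (z j)))%:E)%E.
Hypotheses (m0 : 0 <= m) (C10 : 0 <= C1) (l0 : 0 <= l).
Hypothesis Kdiag : forall x, K x x = l.
Hypothesis Kle : forall x y, K x y <= l.
Hypothesis Kdist : forall x y rho, 0 < rho <= 1 -> rho ^+ 2 <= sqnorm (x - y) ->
  K x y <= C1 - ln rho.
Hypothesis Kge : forall x y r t, 0 <= r -> sqnorm (x - y) <= r ^+ 2 -> 1 <= t <= expR l ->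
  ln t - m * r * t <= K x y.

Lemma mgf_seq (s : seq (R * plane R)) :
  (\int[P]_w (expR (\sum_(p <- s) p.1 * X p.2 w))%:E =
   (expR (2^-1 * \sum_(p <- s) \sum_(q <- s) p.1 * q.1 * K p.2 q.2))%:E)%E.
Proof.
pose p0 : R * plane R := (0, (0, 0)).
have := @mgfX (size s) (fun i => (nth p0 s i).2) (fun i => (nth p0 s i).1).
rewrite (big_nth p0) big_mkord => h.
under [in RHS]eq_bigr do rewrite (big_nth p0) big_mkord.
rewrite -h; apply: eq_integral => w _.
by rewrite (big_nth p0) big_mkord.
Qed.

Section Scale.
Variables (rho : R) (N : nat) (x : plane R).
Hypotheses (rho01 : 0 < rho <= 1) (N0 : (0 < N)%N) (lN : l <= N%:R).
Hypothesis rhol : (2 * rho)^-1 <= expR l.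
Let L := - ln rho.

Let rho0 : 0 < rho. Proof. by case/andP: rho01. Qed.
Let NR : 0 < N%:R :> R. Proof. by rewrite ltr0n. Qed.

Let L0 : 0 <= L.
Proof. by rewrite /L oppr_ge0 ln_le0//; case/andP: rho01. Qed.

(** Points evenly spaced on the horizontal segment of length [rho] issued from [x], with [x] itself
    left out. As N >= l, the diagonal terms of the variance of the average contribute at most 1. *)
Definition zpt (i : nat) : plane R := (x.1 + i.+1%:R * rho / N%:R, x.2).

Let Kdist_lrat (y z : plane R) e : (0 < e <= N)%N -> sqnorm (y - z) = (e%:R * rho / N%:R) ^+ 2 ->
  K y z <= C1 + L + lrat N e.
Proof.
move=> /andP[e0 eN] hs; have eR : 0 < e%:R :> R by rewrite ltr0n.
have r0 : 0 < e%:R * rho / N%:R by rewrite divr_gt0// mulr_gt0.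
have r1 : e%:R * rho / N%:R <= 1.
  rewrite ler_pdivrMr// mul1r (@le_trans _ _ (e%:R * 1))//; last by rewrite mulr1 ler_nat.
  by rewrite ler_wpM2l//; case/andP: rho01.
have := @Kdist y z _ (introT andP (conj r0 r1)); rewrite hs => /(_ (lexx _)).
rewrite ln_div ?posrE ?mulr_gt0// lnM ?posrE// /lrat gtn_eqF//.
by rewrite /L; lra.
Qed.

Let zpt_sqnorm i j : sqnorm (zpt i - zpt j) = (((i - j) + (j - i))%N%:R * rho / N%:R) ^+ 2.
Proof.
rewrite /sqnorm /dot /= subrr mulr0 addr0 natrD.
have -> : x.1 + i.+1%:R * rho / N%:R - (x.1 + j.+1%:R * rho / N%:R) =
    (i%:R - j%:R) * rho / N%:R.
  by rewrite -[i.+1%:R]natr1 -[j.+1%:R]natr1; ring.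
have [ij|ji] := leqP i j.
  by rewrite (eqP ij) add0r natrB// expr2; ring.
by rewrite (eqP (ltnW ji)) addr0 natrB ?(ltnW ji)// expr2.
Qed.

(** In each row the diagonal gives at most N and the logarithmic excess at most 2 N, which is the
    3. *)
Lemma sum_K_zz : \sum_(0 <= i < N) \sum_(0 <= j < N) K (zpt i) (zpt j) <=
  N%:R ^+ 2 * (L + C1 + 3).
Proof.
have row i : (i < N)%N -> \sum_(0 <= j < N) K (zpt i) (zpt j) <= N%:R * (L + C1 + 3).
  move=> iN.
  apply: (@le_trans _ _ (\sum_(0 <= j < N) ((if j == i then N%:R else 0) + (C1 + L) +
      lrat N ((i - j) + (j - i))))).
    rewrite !big_nat; apply: ler_sum => j /andP[_ jN]; case: eqP => [->|/eqP ji].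
      rewrite subnn /lrat addn0 eqxx addr0 Kdiag (le_trans lN)// lerDl addr_ge0//.
    rewrite add0r; apply: Kdist_lrat; last exact: zpt_sqnorm.
    have [ij|ij] := ltnP i j.
      by rewrite (eqP (ltnW ij)) add0n subn_gt0 ij/= (leq_trans (leq_subr _ _))// ltnW.
    have ij' : (j < i)%N by rewrite ltn_neqAle ji.
    by rewrite (eqP ij) addn0 subn_gt0 ij'/= (leq_trans (leq_subr _ _))// ltnW.
  rewrite big_split/= big_split/= -big_mkcond/=.
  have -> : \sum_(0 <= j < N | j == i) N%:R = N%:R :> R.
    by rewrite big_mkord (big_pred1 (Ordinal iN)).
  have := @sum_lrat_dist R N i iN.
  rewrite big_const_nat subn0 iter_addr_0 -[(C1 + L) *+ N]mulr_natr; lra.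
rewrite expr2 -mulrA.
apply: (@le_trans _ _ (\sum_(0 <= i < N) N%:R * (L + C1 + 3))).
  by rewrite !big_nat; apply: ler_sum => i /andP[_ iN]; exact: row.
by rewrite big_const_nat subn0 iter_addr_0 -[leLHS]mulr_natl.
Qed.

Lemma sum_K_xz : \sum_(0 <= i < N) K x (zpt i) <= N%:R * (L + C1 + 3) /\
  \sum_(0 <= i < N) K (zpt i) x <= N%:R * (L + C1 + 3).
Proof.
have S : \sum_(0 <= i < N) (C1 + L + lrat N i.+1) <= N%:R * (L + C1 + 3).
  rewrite big_split/= big_const_nat subn0 iter_addr_0 -[(C1 + L) *+ N]mulr_natr.
  have : \sum_(0 <= i < N) lrat N i.+1 <= N%:R :> R.
    by apply: le_trans (@sum_lrat R N); rewrite [leRHS]big_nat_recl//= lerDr /lrat eqxx.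
  by have := NR; lra.
split; apply: le_trans S; rewrite !big_nat; apply: ler_sum => i /andP[_ iN];
  apply: Kdist_lrat; rewrite ?iN// /sqnorm /dot /= subrr mulr0 addr0 expr2; ring.
Qed.

Lemma sum_K_yz (y : plane R) : cbox x rho y ->
  N%:R * (L - ln 2 - 3 * m) <= \sum_(0 <= i < N) K y (zpt i) /\
  N%:R * (L - ln 2 - 3 * m) <= \sum_(0 <= i < N) K (zpt i) y.
Proof.
move=> /cboxP[h1 h2].
(* The resolution at which [Kge] is applied: [rhol] keeps it within the cut-off, rho t <= 1 bounds
   the loss, and ln t >= L - ln 2. Points of the square and of the segment are within 2 rho and rho
   in the two coordinates, hence within 3 rho. *)
pose t := Num.max 1 (2 * rho)^-1.
have t1 : 1 <= t <= expR l.
  by rewrite /t le_max lexx/= ge_max rhol andbT -expR0 ler_expR.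
have trho : rho * t <= 1.
  rewrite /t; have [h|h] := leP 1 (2 * rho)^-1; last by rewrite mulr1; case/andP: rho01.
  rewrite invfM mulrCA divff ?gt_eqF// mulr1; lra.
have lnt : L - ln 2 <= ln t.
  have -> : L - ln 2 = ln (2 * rho)^-1 by rewrite lnV ?posrE ?mulr_gt0// lnM ?posrE//; rewrite /L; ring.
  by rewrite ler_ln ?posrE ?invr_gt0 ?mulr_gt0// ?le_max ?lexx ?orbT// (lt_le_trans ltr01)//; case/andP: t1.
have key u v : sqnorm (u - v) <= (3 * rho) ^+ 2 -> L - ln 2 - 3 * m <= K u v.
  move=> huv; have r30 : 0 <= 3 * rho by rewrite mulr_ge0// ltW.
  apply: le_trans (Kge r30 huv t1); have : m * (rho * t) <= m * 1 by rewrite ler_wpM2l.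
  by rewrite mulr1 => hm; lra.
have dist i : (i < N)%N -> sqnorm (y - zpt i) <= (3 * rho) ^+ 2 /\ sqnorm (zpt i - y) <= (3 * rho) ^+ 2.
  move=> iN; have a0 : 0 <= i.+1%:R * rho / N%:R by rewrite divr_ge0 ?mulr_ge0// ltW.
  have a1 : i.+1%:R * rho / N%:R <= rho.
    by rewrite ler_pdivrMr// mulrC ler_wpM2l ?ler_nat// ltW.
  move: h1 h2 a0 a1; rewrite !ler_norml; set a := _ / _ => /andP[p1 p2] /andP[p3 p4] a0 a1.
  rewrite /sqnorm /dot /= -/a; split; nra.
split; rewrite mulr_natl -[N in _ *+ N]subn0 -iter_addr_0 -big_const_nat !big_nat; apply: ler_sum => i /andP[_ iN];
  by apply: key; have [] := dist i iN.
Qed.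

Definition Zavg (w : Om) : R := N%:R^-1 * \sum_(0 <= i < N) X (zpt i) w.

Let quad a1 a2 b (y1 y2 : plane R) : R :=
  a1 ^+ 2 * K y1 y1 + a1 * a2 * (K y1 y2 + K y2 y1) + a2 ^+ 2 * K y2 y2 +
  a1 * b / N%:R * (\sum_(0 <= i < N) K y1 (zpt i) + \sum_(0 <= i < N) K (zpt i) y1) +
  a2 * b / N%:R * (\sum_(0 <= i < N) K y2 (zpt i) + \sum_(0 <= i < N) K (zpt i) y2) +
  b ^+ 2 / N%:R ^+ 2 * \sum_(0 <= i < N) \sum_(0 <= j < N) K (zpt i) (zpt j).

Lemma mgf_avg a1 a2 b (y1 y2 : plane R) :
  (\int[P]_w (expR (a1 * X y1 w + a2 * X y2 w + b * Zavg w))%:E =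
   (expR (2^-1 * quad a1 a2 b y1 y2))%:E)%E.
Proof.
pose s := [:: (a1, y1), (a2, y2) & [seq (b / N%:R, zpt i) | i <- index_iota 0 N]].
have := mgf_seq s; rewrite /s => h.
transitivity (\int[P]_w (expR (\sum_(p <- s) p.1 * X p.2 w))%:E)%E.
  apply: eq_integral => w _; rewrite /s !big_cons big_map /= -mulr_sumr /Zavg.
  by congr (expR _)%:E; ring.
rewrite h; congr (expR _)%:E; congr (_ * _).
have lin (a : R) (y : plane R) : \sum_(0 <= i < N) a * (b / N%:R) * K y (zpt i) =
    a * b / N%:R * \sum_(0 <= i < N) K y (zpt i).
  by rewrite -mulr_sumr; ring.
rewrite !big_cons !big_map /= !lin.
have -> : \sum_(0 <= i < N) \sum_(q <- [:: (a1, y1), (a2, y2) & [seq (b / N%:R, zpt i) | i <- index_iota 0 N]])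
     (b / N%:R * q.1 * K (zpt i) q.2) =
   \sum_(0 <= i < N) (b / N%:R * a1 * K (zpt i) y1 + (b / N%:R * a2 * K (zpt i) y2 +
     b / N%:R * (b / N%:R) * \sum_(0 <= j < N) K (zpt i) (zpt j))).
  by apply: eq_bigr => i _; rewrite !big_cons big_map /= -mulr_sumr.
rewrite !big_split/= -!mulr_sumr /quad; field.
by rewrite gt_eqF.
Qed.

Section Moments.
Variable gamma : R.
Let H (z : plane R) (w : Om) : R := expR (gamma * X z w - gamma ^+ 2 / 2 * l).
Let C2 := C1 + 3.
Let C3 := ln 2 + 3 * m.

Let Szz : N%:R^-1 ^+ 2 * \sum_(0 <= i < N) \sum_(0 <= j < N) K (zpt i) (zpt j) <= L + C2.
Proof.
rewrite exprVn mulrC ler_pdivrMr ?exprn_gt0// mulrC /C2 addrA; exact: sum_K_zz.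
Qed.

Let mean (f : nat -> R) : R := N%:R^-1 * \sum_(0 <= i < N) f i.

Let mean_le (f : nat -> R) b : \sum_(0 <= i < N) f i <= N%:R * b -> mean f <= b.
Proof. by move=> h; rewrite /mean mulrC ler_pdivrMr// mulrC. Qed.

Let mean_ge (f : nat -> R) b : N%:R * b <= \sum_(0 <= i < N) f i -> b <= mean f.
Proof. by move=> h; rewrite /mean mulrC ler_pdivlMr// mulrC. Qed.

Let mgf_shift a1 a2 b (y1 y2 : plane R) c0 :
  (\int[P]_w (expR (a1 * X y1 w + a2 * X y2 w + b * Zavg w + c0))%:E =
   (expR (2^-1 * quad a1 a2 b y1 y2 + c0))%:E)%E.
Proof.
under eq_integral do rewrite expRD mulrC EFinM.
rewrite ge0_integralZl//.
- by rewrite mgf_avg -EFinM -expRD addrC.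
- apply/measurable_EFinP; apply: measurableT_comp => //.
  have mXz z : measurable_fun setT (X z) := measurable_fun_pair2 z mX.
  apply: measurable_funD; first by apply: measurable_funD; exact: measurable_funM.
  apply: measurable_funM => //; apply: measurable_funM => //.
  by apply: measurable_sum => i; exact: mXz.
Qed.

(** Up to constants the pair covariance gives 2 L, the four cross terms with Z take off 4 L, and the
    variance of Z adds L. Subtracting gamma Z thus leaves a gain gamma^2 L / 2 where the pair alone
    would cost gamma^2 L. *)
Lemma mean_two_points (y : plane R) C4 : cbox x rho y -> K x y <= L + C4 -> K y x <= L + C4 ->
  (\int[P]_w (H x w * H y w * expR (- (gamma * Zavg w)))%:E <=
   (expR (gamma ^+ 2 / 2 * (2 * C4 + 4 * C3 + C2 - L)))%:E)%E.
Proof.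
move=> yx Kxy Kyx.
have xx : cbox x rho x by apply/cboxP; rewrite !subrr normr0 ltW.
have [/mean_ge sy1 /mean_ge sy2] := sum_K_yz yx.
have [/mean_ge sx1 /mean_ge sx2] := sum_K_yz xx.
rewrite (eq_integral (fun w => (expR (gamma * X x w + gamma * X y w + (- gamma) * Zavg w +
    - (gamma ^+ 2 * l)))%:E)); last first.
  by move=> w _; rewrite /H -!expRD; congr (expR _)%:E; field.
rewrite mgf_shift lee_fin ler_expR.
have -> : 2^-1 * quad gamma gamma (- gamma) x y + - (gamma ^+ 2 * l) =
    gamma ^+ 2 / 2 * (K x y + K y x - (mean (fun i => K x (zpt i)) + mean (fun i => K (zpt i) x))
     - (mean (fun i => K y (zpt i)) + mean (fun i => K (zpt i) y)) +
     N%:R^-1 ^+ 2 * \sum_(0 <= i < N) \sum_(0 <= j < N) K (zpt i) (zpt j)).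
  by rewrite /quad /mean !Kdiag; field; rewrite gt_eqF.
apply: ler_wpM2l; first by rewrite divr_ge0 ?sqr_ge0.
have := Szz; rewrite /C3; lra.
Qed.

(** Under the tilt by the chaos weight at x, gamma Z has mean and variance at most gamma^2 L up to
    constants; this is its Laplace transform at [dl]. *)
Lemma mean_one_point (dl : R) : 0 <= dl ->
  (\int[P]_w (H x w * expR (dl * (gamma * Zavg w)))%:E <=
   (expR ((dl * gamma ^+ 2 + dl ^+ 2 * gamma ^+ 2 / 2) * (L + C2)))%:E)%E.
Proof.
move=> dl0; have [/mean_le sx1 /mean_le sx2] := sum_K_xz.
rewrite (eq_integral (fun w => (expR (gamma * X x w + 0 * X x w + (dl * gamma) * Zavg w +
    - (gamma ^+ 2 / 2 * l)))%:E)); last first.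
  by move=> w _; rewrite /H -!expRD; congr (expR _)%:E; ring.
rewrite mgf_shift lee_fin ler_expR.
have -> : 2^-1 * quad gamma 0 (dl * gamma) x x + - (gamma ^+ 2 / 2 * l) =
    dl * gamma ^+ 2 / 2 * (mean (fun i => K x (zpt i)) + mean (fun i => K (zpt i) x)) +
    dl ^+ 2 * gamma ^+ 2 / 2 *
      (N%:R^-1 ^+ 2 * \sum_(0 <= i < N) \sum_(0 <= j < N) K (zpt i) (zpt j)).
  by rewrite /quad /mean !Kdiag; field; rewrite gt_eqF.
have c1 : 0 <= dl * gamma ^+ 2 / 2 by rewrite divr_ge0// mulr_ge0// sqr_ge0.
have c2 : 0 <= dl ^+ 2 * gamma ^+ 2 / 2 by rewrite divr_ge0// mulr_ge0// sqr_ge0.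
rewrite mulrDl; apply: lerD; last by rewrite ler_wpM2l.
rewrite (_ : dl * gamma ^+ 2 * (L + C2) = dl * gamma ^+ 2 / 2 * ((L + C2) + (L + C2))); last by field.
by rewrite ler_wpM2l// lerD// /C2 addrA ?sx1 ?sx2.
Qed.

Section Core.
Variables (A : set (bplane R)) (C4 : R).
Hypotheses (mA : measurable A) (gamma02 : 0 < gamma < 2) (Abox : A `<=` cbox x rho).
Hypothesis KA : forall y, A y -> K x y <= L + C4 /\ K y x <= L + C4.
(** The gap between 2 + gamma^2/2 and gamma^2. The threshold [a] makes the two-point term,
    integrated over an area of order rho^2, equal to e^(-2 eta L) up to constants; [dl] is the
    Chernoff parameter for the complementary event. *)
Let t := 2 - gamma ^+ 2 / 2.
Let dl := t / 8.
Let eta := t ^+ 2 / 32.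
Let a := L * (2 + gamma ^+ 2 / 2 - 2 * eta).
Let MA w := (\int[leb2]_z (\1_A z * H z w)%:E)%E.

Let mZ : measurable_fun setT Zavg.
Proof.
apply: measurable_funM => //; apply: measurable_sum => i.
exact: measurable_fun_pair2 (zpt i) mX.
Qed.

Let mH : measurable_fun setT (fun z : Om * bplane R => H z.2 z.1).
Proof.
apply: measurableT_comp => //; apply: measurable_funB => //; apply: measurable_funM => //.
exact: (measurableT_comp mX (@measurable_swap _ _ _ _)).
Qed.

Let mHx y : measurable_fun setT (H y).
Proof. exact: measurable_fun_pair1 y mH. Qed.

Let mAH : measurable_fun setT (fun z : Om * bplane R => \1_A z.2 * H z.2 z.1).
Proof.
apply: measurable_funM => //.
exact: (measurableT_comp (measurable_indic mA) (@measurable_snd _ _ _ _)).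
Qed.

Let H0 y w : 0 <= H y w. Proof. exact: expR_ge0. Qed.

Let f2 (z : Om * bplane R) : R :=
  \1_A z.2 * (H x z.1 * H z.2 z.1 * expR (- (gamma * Zavg z.1))) * expR a.

Let f20 z : 0 <= f2 z. Proof. by rewrite /f2 !mulr_ge0 ?expR_ge0. Qed.

Let mf2 : measurable_fun setT f2.
Proof.
rewrite /f2; apply: measurable_funM => //; apply: measurable_funM => //.
  exact: (measurableT_comp (measurable_indic mA) (@measurable_snd _ _ _ _)).
apply: measurable_funM => //.
  by apply: measurable_funM => //; exact: (measurableT_comp (mHx x) (@measurable_fst _ _ _ _)).
apply: (measurableT_comp (f := fun w => expR (- (gamma * Zavg w)))); last exact: measurable_fst.
by apply: measurableT_comp => //; apply: measurableT_comp => //; exact: measurable_funM.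
Qed.

(* Let [v := expR (gamma * Zavg w - a)]: if [MA w > lam := expR (- (eta * L))], then
   either [MA w >= v], whence [1 <= MA w / v], or [v > lam], whence
   [1 <= (v / lam) `^ dl]. *)
Let pointwise w :
  ((H x w * \1_[set w | ((expR (- (eta * L)))%:E < MA w)%E] w)%:E <=
   \int[leb2]_y (f2 (w, y))%:E +
   (H x w * expR (dl * (gamma * Zavg w)) * expR (dl * (eta * L - a)))%:E)%E.
Proof.
have I0 : (0 <= \int[leb2]_y (f2 (w, y))%:E)%E.
  by apply: integral_ge0 => y _; rewrite lee_fin.
rewrite indicE; have [|_] := boolP (w \in _); last first.
  by rewrite mulr0 adde_ge0// lee_fin !mulr_ge0 ?expR_ge0.
rewrite inE /= mulr1 => wM.
have e : (\int[leb2]_y (f2 (w, y))%:E = (H x w)%:E * ((expR (a - gamma * Zavg w))%:E * MA w))%E.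
  rewrite /MA muleA -EFinM -ge0_integralZl//.
  - apply: eq_integral => y _; rewrite -EFinM /f2/=; congr EFin; rewrite expRD; ring.
  - by apply/measurable_EFinP; exact: measurable_fun_pair2 w mAH.
  - by move=> y _; rewrite lee_fin mulr_ge0.
  - by rewrite lee_fin mulr_ge0 ?expR_ge0.
have MA0 : (0 <= MA w)%E by apply: integral_ge0 => y _; rewrite lee_fin mulr_ge0.
have [h|h] := leP 1%:E ((expR (a - gamma * Zavg w))%:E * MA w)%E.
  apply: (@le_trans _ _ ((H x w)%:E * 1%:E + 0)%E); first by rewrite mule1 adde0.
  rewrite e; apply: leeD; first by apply: lee_wpmul2l => //; rewrite lee_fin.
  by rewrite lee_fin !mulr_ge0 ?expR_ge0.
apply: (@le_trans _ _ (0 + (H x w)%:E)%E); first by rewrite add0e.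
apply: leeD => //; rewrite lee_fin -mulrA ler_peMr// -expRD -[leLHS]expR0 ler_expR.
have MAf : MA w \is a fin_num.
  rewrite ge0_fin_numE//; case: (MA w) h MA0 => [r _ _|h _|_ //]; first exact: ltry.
  by move: h; rewrite gt0_muley ?lte_fin ?expR_gt0// ltNge leey.
move: wM h; rewrite -(fineK MAf) -EFinM !lte_fin => h1 h2.
have h3 : expR (a - gamma * Zavg w) * expR (- (eta * L)) < 1.
  by apply: le_lt_trans h2; rewrite ler_wpM2l ?expR_ge0// ltW.
move: h3; rewrite -expRD expR_lt1 => h3.
rewrite -mulrDr mulr_ge0//; last lra.
by rewrite /dl divr_ge0// /t; move: gamma02 => /andP[g0 g2]; nra.
Qed.

Lemma core_estimate :
  (\int[P]_w (H x w * \1_[set w | ((expR (- (eta * L)))%:E < MA w)%E] w)%:E <=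
   ((4 * expR (gamma ^+ 2 / 2 * (2 * C4 + 4 * C3 + C2)) +
     expR ((dl * gamma ^+ 2 + dl ^+ 2 * gamma ^+ 2 / 2) * C2)) * expR (- (2 * eta * L)))%:E)%E.
Proof.
have /andP[g0 g2] := gamma02.
have t0 : 0 < t by rewrite /t; nra.
have t2 : t <= 2 by rewrite /t lerBlDr lerDl divr_ge0// sqr_ge0.
have dl0 : 0 <= dl by rewrite divr_ge0// ltW.
have sP : sigma_finite setT P := sigma_finiteT P.
have mI : measurable_fun setT (fun w => (\int[leb2]_y (f2 (w, y))%:E)%E).
  apply: (sf_measurable_tonelli sigma_finite_leb2 (f := fun z => (f2 z)%:E)).
    exact/measurable_EFinP.
  by move=> z; rewrite lee_fin.
have mMA : measurable_fun setT MA.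
  apply: (sf_measurable_tonelli sigma_finite_leb2 (f := fun z : Om * bplane R => (\1_A z.2 * H z.2 z.1)%:E)).
    exact/measurable_EFinP.
  by move=> z; rewrite lee_fin mulr_ge0.
have mB : measurable [set w | ((expR (- (eta * L)))%:E < MA w)%E].
  by rewrite -[X in measurable X]setTI; exact: measurable_lte.
pose g2f w := H x w * expR (dl * (gamma * Zavg w)) * expR (dl * (eta * L - a)).
have mg2 : measurable_fun setT g2f.
  apply: measurable_funM => //; apply: measurable_funM => //.
  by apply: measurableT_comp => //; apply: measurable_funM => //; exact: measurable_funM.
apply: (@le_trans _ _ (\int[P]_w (\int[leb2]_y (f2 (w, y))%:E + (g2f w)%:E))%E).
  apply: (ge0_le_integral P measurableT).
  - by move=> w _; rewrite lee_fin mulr_ge0.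
  - by apply/measurable_EFinP; apply: measurable_funM (mHx x) (measurable_indic mB).
  - by apply: (emeasurable_funD mI); exact/measurable_EFinP.
  - by move=> w _; exact: pointwise.
rewrite (ge0_integralD P measurableT); last 4 first.
- by move=> w _; apply: integral_ge0 => y _; rewrite lee_fin.
- exact: mI.
- by move=> w _; rewrite lee_fin !mulr_ge0 ?expR_ge0.
- exact/measurable_EFinP.
rewrite mulrDl EFinD; apply: leeD.
  rewrite (sf_tonelli sP sigma_finite_leb2 (f := fun z => (f2 z)%:E)); last 2 first.
  - exact/measurable_EFinP.
  - by move=> z; rewrite lee_fin.
  pose D := expR (gamma ^+ 2 / 2 * (2 * C4 + 4 * C3 + C2 - L)) * expR a.
  apply: (@le_trans _ _ (\int[leb2]_y (D%:E * (\1_A y)%:E))%E).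
    apply: ge0_le_integral => //.
    - by move=> y _; apply: integral_ge0 => w _; rewrite lee_fin.
    - apply: (sf_measurable_tonelli sP (f := fun z : bplane R * Om => (f2 (z.2, z.1))%:E)).
        by apply/measurable_EFinP; exact: (measurableT_comp mf2 (@measurable_swap _ _ _ _)).
      by move=> z; rewrite lee_fin.
    - by apply/measurable_EFinP; apply: measurable_funM => //; exact: measurable_indic.
    move=> y _; rewrite /f2/= indicE; have [|yA] := boolP (y \in A); last first.
      by rewrite integral0_eq ?mule0// => w _; rewrite !mul0r.
    rewrite inE mule1 => yA; have [k1 k2] := KA yA.
    rewrite /D EFinM muleC.
    apply: le_trans (lee_wpmul2l _ (mean_two_points (Abox yA) k1 k2)); last first.
      by rewrite lee_fin expR_ge0.
    rewrite -ge0_integralZl//.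
    - by rewrite le_eqVlt; apply/orP; left; apply/eqP; apply: eq_integral => w _; rewrite mul1r mulrC EFinM.
    - apply/measurable_EFinP; apply: measurable_funM; first exact: measurable_funM.
      by apply: measurableT_comp => //; apply: measurableT_comp => //; exact: measurable_funM.
    - by move=> w _; rewrite lee_fin !mulr_ge0 ?expR_ge0.
  have D0 : 0 <= D by rewrite mulr_ge0 ?expR_ge0.
  rewrite ge0_integralZl//; last by apply/measurable_EFinP; exact: measurable_indic.
  rewrite integral_indic// setIT.
  (* [A] lies in a square of area 4 rho^2 = 4 e^(-2 L). *)
  apply: (@le_trans _ _ (D%:E * (4 * rho ^+ 2)%:E)%E).
    apply: lee_wpmul2l; first by rewrite lee_fin.
    rewrite -(leb2_cbox x (ltW rho0)).
    by apply: le_measure; rewrite ?inE//; exact: measurable_cbox.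
  have -> : rho ^+ 2 = expR (- (2 * L)) by rewrite /L mulrN opprK expRM_natl lnK.
  rewrite -EFinM lee_fin /D; set E1 := expR _; set E2 := expR _; set E3 := expR (- (2 * L)).
  rewrite (_ : E1 * E2 * (4 * E3) = 4 * (E1 * E2 * E3)); last by ring.
  rewrite -[leRHS]mulrA ler_wpM2l// /E1 /E2 /E3 -!expRD ler_expR /a; lra.
rewrite /g2f; under eq_integral do rewrite mulrC EFinM.
rewrite ge0_integralZl//; last 2 first.
- apply/measurable_EFinP; apply: measurable_funM => //.
  by apply: measurableT_comp => //; apply: measurable_funM => //; exact: measurable_funM.
- by move=> w _; rewrite lee_fin !mulr_ge0 ?expR_ge0.
apply: le_trans (@lee_wpmul2l _ _ _ _ _ (mean_one_point dl0)) _; first by rewrite lee_fin expR_ge0.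
rewrite -EFinM lee_fin -!expRD ler_expR.
(* The Chernoff exponent per unit of L. As t <= 2, 3 eta <= 3t/16, and dl gamma^2/2 <= t/4, so the
   bracket is at most -9t/16; times dl = t/8 this is -9 t^2/128, below -2 eta = -8 t^2/128. *)
have hc : dl * (3 * eta - t + dl * gamma ^+ 2 / 2) <= - (2 * eta).
  have hg : gamma ^+ 2 / 2 <= 2 by nra.
  have h1 : dl * (gamma ^+ 2 / 2) <= dl * 2 by rewrite ler_wpM2l.
  have h2 : 3 * eta - t + dl * gamma ^+ 2 / 2 <= - (9 / 16 * t).
    move: h1; rewrite /eta /dl; nra.
  apply: le_trans (ler_wpM2l dl0 h2) _; rewrite /dl /eta; have := sqr_ge0 t; lra.
have := ler_wpM2r L0 hc; rewrite /a (_ : gamma ^+ 2 = 2 * (2 - t)); last by rewrite /t; field.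
move=> h; apply: le_trans (_ : _ <= dl * (3 * eta - t + dl * (2 * (2 - t)) / 2) * L +
  (dl * (2 * (2 - t)) + dl ^+ 2 * (2 * (2 - t)) / 2) * C2) _; last by lra.
rewrite le_eqVlt; apply/orP; left; apply/eqP; by field.
Qed.

End Core.

End Moments.

End Scale.

Section Chain.
Variable gamma : R.
Hypothesis gamma02 : 0 < gamma < 2.

Definition chaos (z : plane R) (w : Om) : R := expR (gamma * X z w - gamma ^+ 2 / 2 * l).

Definition chaos_mass (A : set (bplane R)) (w : Om) : \bar R :=
  (\int[leb2]_z (\1_A z * chaos z w)%:E)%E.

Definition growth_exponent : R := (2 - gamma ^+ 2 / 2) ^+ 2 / 32.
Let eta := growth_exponent.

(** The constant of [core_estimate] for [C4 = C1 + ln 2], where ln 2 comes from the ratio between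
    the two radii of an annulus. *)
Definition chain_constant : R :=
  4 * expR (gamma ^+ 2 / 2 * (2 * (C1 + ln 2) + 4 * (ln 2 + 3 * m) + (C1 + 3))) +
  expR (((2 - gamma ^+ 2 / 2) / 8 * gamma ^+ 2 +
    ((2 - gamma ^+ 2 / 2) / 8) ^+ 2 * gamma ^+ 2 / 2) * (C1 + 3)).

Lemma growth_exponent_gt0 : 0 < growth_exponent.
Proof.
rewrite /growth_exponent divr_gt0// exprn_gt0//; case/andP: gamma02 => g0 g2; nra.
Qed.

Lemma growth_exponent_le2 : growth_exponent <= 2.
Proof.
rewrite /growth_exponent; case/andP: gamma02 => g0 g2.
set t := 2 - _; have t0 : 0 <= t by rewrite /t; nra.
have t2 : t <= 2 by rewrite /t lerBlDr lerDl divr_ge0// sqr_ge0.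
nra.
Qed.

Lemma chaos_ge0 z w : 0 <= chaos z w. Proof. exact: expR_ge0. Qed.

Lemma measurable_chaos : measurable_fun setT (fun z : Om * bplane R => chaos z.2 z.1).
Proof.
apply: measurableT_comp => //; apply: measurable_funB => //; apply: measurable_funM => //.
exact: (measurableT_comp mX (@measurable_swap _ _ _ _)).
Qed.

Lemma measurable_chaos_indic (A : set (bplane R)) : measurable A ->
  measurable_fun setT (fun z : Om * bplane R => \1_A z.2 * chaos z.2 z.1).
Proof.
move=> mA; apply: measurable_funM; last exact: measurable_chaos.
exact: (measurableT_comp (measurable_indic mA) (@measurable_snd _ _ _ _)).
Qed.

Lemma measurable_chaos_mass (A : set (bplane R)) : measurable A ->
  measurable_fun setT (chaos_mass A).
Proof.
move=> mA.
apply: (sf_measurable_tonelli sigma_finite_leb2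
  (f := fun z : Om * bplane R => (\1_A z.2 * chaos z.2 z.1)%:E)).
  by apply/measurable_EFinP; exact: measurable_chaos_indic.
by move=> z; rewrite lee_fin mulr_ge0 ?chaos_ge0.
Qed.

Let measurable_chaos_mass_gt (A : set (bplane R)) (b : R) : measurable A ->
  measurable [set w | (b%:E < chaos_mass A w)%E].
Proof.
move=> mA; rewrite -[X in measurable X]setTI; apply: measurable_lte => //.
exact: measurable_chaos_mass.
Qed.

Lemma chaos_tail_one_scale (rho : R) (x : plane R) (A : set (bplane R)) :
  0 < rho <= 1 -> (2 * rho)^-1 <= expR l -> measurable A -> A `<=` cbox x rho ->
  (forall y, A y -> K x y <= C1 + ln 2 - ln rho /\ K y x <= C1 + ln 2 - ln rho) ->
  (\int[P]_w (chaos x w * \1_[set w | ((expR (eta * ln rho))%:E < chaos_mass A w)%E] w)%:E <=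
   (chain_constant * expR (2 * eta * ln rho))%:E)%E.
Proof.
move=> r01 hl mA Ax KA; have N0 : (0 < (Num.truncn l).+1)%N by [].
have lN : l <= (Num.truncn l).+1%:R by rewrite ltW// truncnS_gt.
have KA' y : A y -> K x y <= - ln rho + (C1 + ln 2) /\ K y x <= - ln rho + (C1 + ln 2).
  by move=> /KA; rewrite [- _ + _]addrC.
have := core_estimate r01 N0 lN hl mA gamma02 Ax KA'.
by rewrite !mulrN !opprK.
Qed.

Let geom (q : R) n : 0 <= q < 1 -> \sum_(i < n) q ^+ i <= (1 - q)^-1.
Proof.
move=> /andP[q0 q1]; have q1' : 0 < 1 - q by rewrite subr_gt0.
rewrite -[leRHS]mul1r ler_pdivlMr// mulrC.
have -> : (1 - q) * (\sum_(i < n) q ^+ i) = 1 - q ^+ n.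
  by rewrite -opprB mulNr -subrX1 opprB.
by rewrite lerBlDr lerDl exprn_ge0.
Qed.

Let q := expR (- (eta * ln 2)).

Definition chain_factor : R := (1 - expR (- (growth_exponent * ln 2)))^-1.
Let Lam := chain_factor.

Let ln2 : 0 < ln 2 :> R. Proof. by rewrite ln_gt0// ltr1n. Qed.
Let q01 : 0 <= q < 1.
Proof.
by rewrite expR_ge0 expR_lt1 oppr_lt0 mulr_gt0// growth_exponent_gt0.
Qed.

Lemma chain_factor_gt0 : 0 < chain_factor.
Proof. by rewrite invr_gt0 subr_gt0; case/andP: q01. Qed.

Lemma chain_constant_ge0 : 0 <= chain_constant.
Proof. by rewrite addr_ge0// ?mulr_ge0// expR_ge0. Qed.

(* If [S] is heavy then so is, for every [x] in [S], its trace on one of the dyadic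
   annuli around [x]: the weights [2^-(i eta)] sum to [chain_factor]. Integrating in
   [x] against the mass of [S] turns Markov's inequality into a sum of one-scale
   estimates. *)
Lemma chaos_tail (S : set (bplane R)) (r : R) : measurable S -> 0 < r <= 1 ->
  r^-1 <= expR l -> (forall x, S x -> S `<=` cbox x r) -> (leb2 S <= (r ^+ 2)%:E)%E ->
  (P [set w | ((chain_factor * expR (growth_exponent * ln r))%:E < chaos_mass S w)%E] <=
   (chain_constant * expR ((2 + growth_exponent) * ln r))%:E)%E.
Proof.
move=> mS /andP[r0 r1] rl Sr leS.
rewrite -/Lam -/eta; set B := [set w | _].
have mB : measurable B by exact: measurable_chaos_mass_gt.
have Lam0 : 0 < Lam := chain_factor_gt0.
have cc0 := chain_constant_ge0.
pose rh i : R := r * 2^-1 ^+ i.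
have rh0 i : 0 < rh i by rewrite mulr_gt0// exprn_gt0// invr_gt0.
have rhS i : rh i.+1 = rh i / 2 by rewrite /rh exprSr mulrA.
have rh1 i : rh i <= 1.
  by rewrite (le_trans _ r1)// ler_piMr ?(ltW r0)// exprn_ile1// invf_le1// ler1n.
have lnrh i : ln (rh i) = ln r - i%:R * ln 2.
  by rewrite lnM ?posrE ?exprn_gt0 ?invr_gt0// lnXn ?invr_gt0// lnV ?posrE// mulNrn mulr_natl.
have e0 : 0 < expR (- l) by exact: expR_gt0.
have exI : exists i, rh i <= expR (- l).
  exists (Num.truncn (expR (- l))^-1).+1.
  rewrite /rh (@le_trans _ _ (2^-1 ^+ (Num.truncn (expR (- l))^-1).+1))//.
    by rewrite ler_piMl// exprn_ge0// invr_ge0.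
  rewrite exprVn -[leRHS]invrK lef_pV2 ?posrE ?exprn_gt0 ?invr_gt0//.
  apply: le_trans (ltW (truncnS_gt _)) _.
  by rewrite -natrX ler_nat ltnW// ltn_expl.
(* The first dyadic radius below the resolution e^-l of the cut-off; there the bound K <= l takes
   over and no finer annulus is cut. *)
have [I hI Imin] := ex_minnP exI.
(* By minimality of [I], the radii up to index [I] stay above half the resolution, as the one-scale
   estimate requires. *)
have rhl i : (i <= I)%N -> (2 * rh i)^-1 <= expR l.
  move=> iI; have h : expR (- l) / 2 <= rh i.
    case: i iI => [_|i iI].
      have : expR (- l) <= r by rewrite expRN -[leRHS]invrK lef_pV2 ?posrE ?expR_gt0 ?invr_gt0.
      by rewrite /rh expr0 mulr1; have := e0; lra.
    rewrite rhS ler_wpM2r ?invr_ge0//.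
    by rewrite leNgt; apply/negP => /ltW /Imin; rewrite leqNgt iI.
  rewrite -[leRHS]invrK -expRN lef_pV2 ?posrE ?mulr_gt0//; lra.
(* Annuli around [x] traced on [S]; the last one, of index [I], is a full square. *)
pose A (x : plane R) i : set (bplane R) :=
  (S `&` cbox x (rh i)) `\` (if (i < I)%N then cbox x (rh i.+1) else set0).
have mAx x i : measurable (A x i).
  apply: measurableD; first by apply: measurableI => //; exact: measurable_cbox.
  by case: ifP => // _; exact: measurable_cbox.
have Abox x i : A x i `<=` cbox x (rh i) by move=> y [[]].
have KA x i : (i <= I)%N -> forall y, A x i y ->
    K x y <= C1 + ln 2 - ln (rh i) /\ K y x <= C1 + ln 2 - ln (rh i).
  rewrite leq_eqVlt => /orP[/eqP -> y _|iI y].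
    have : l <= - ln (rh I).
      by rewrite lerNr -[leRHS]expRK ler_ln ?posrE ?expR_gt0.
    move=> h; have hc : l <= C1 + ln 2 - ln (rh I) by rewrite (le_trans h)// lerDr; apply: addr_ge0 C10 (ltW ln2).
    by split; apply: le_trans hc; exact: Kle.
  rewrite /A iI => -[_ /= /(contra_not (proj2 (cboxP _ _ _)))].
  have hr : 0 < rh i.+1 <= 1 by rewrite rh0 rh1.
  have hl : C1 - ln (rh i.+1) = C1 + ln 2 - ln (rh i).
    by rewrite !lnrh -[i.+1%:R]natr1; ring.
  rewrite -hl => hy.
  have hs : rh i.+1 ^+ 2 <= sqnorm (x - y) /\ rh i.+1 ^+ 2 <= sqnorm (y - x).
    rewrite /sqnorm /dot /= -!expr2 -[(y.1 - x.1) ^+ 2]sqrrN opprB -[(y.2 - x.2) ^+ 2]sqrrN opprB.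
    suff : rh i.+1 ^+ 2 <= (x.1 - y.1) ^+ 2 + (x.2 - y.2) ^+ 2 by [].
    have [h1|h1] := leP `|x.1 - y.1| (rh i.+1); last first.
      rewrite -[leLHS]addr0 lerD ?sqr_ge0// -[leRHS]real_normK ?num_real//.
      by rewrite lerXn2r ?nnegrE ?(ltW h1)// ltW.
    have [h2|h2] := leP `|x.2 - y.2| (rh i.+1); first by case: hy.
    rewrite -[leLHS]add0r lerD ?sqr_ge0// -[leRHS]real_normK ?num_real//.
    by rewrite lerXn2r ?nnegrE ?(ltW h2)// ltW.
  by split; apply: Kdist => //; case: hs.
have cover x y : S x -> S y -> exists2 i, (i < I.+1)%N & A x i y.
  move=> Sx Sy; have [yI|yI] := pselect (cbox x (rh I) y).
    by exists I => //; split => //; rewrite ltnn.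
  (* The first square around [x] that misses [y] has a positive index, since all of [S] lies in the
     square of index 0; its predecessor gives the annulus. *)
  have ex : exists i, ~~ `[< cbox x (rh i) y >] by exists I; apply/asboolPn.
  have [j hj jmin] := ex_minnP ex.
  have jI : (j <= I)%N by apply: jmin; apply/asboolPn.
  case: j hj jmin jI => [|j] hj jmin jI.
    by exfalso; move/asboolPn: hj; apply; rewrite /rh expr0 mulr1; exact: Sr.
  exists j; first exact: leqW.
  rewrite /A jI; split; last by move/asboolPn: hj.
  split => //; apply: contrapT => /asboolPn /jmin; by rewrite ltnn.
pose Bi x i := [set w | ((expR (eta * ln (rh i)))%:E < chaos_mass (A x i) w)%E].
have mBi x i : measurable (Bi x i) by exact: measurable_chaos_mass_gt.
have BBi x w : S x -> B w -> exists2 i, (i < I.+1)%N & Bi x i w.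
  move=> Sx Bw; apply: contrapT => hn.
  have hle i : (i < I.+1)%N -> (chaos_mass (A x i) w <= (expR (eta * ln (rh i)))%:E)%E.
    by move=> iI; rewrite leNgt; apply/negP => h; apply: hn; exists i.
  move: Bw; rewrite /B /= ltNge => /negP; apply.
  apply: (@le_trans _ _ (\sum_(i < I.+1) chaos_mass (A x i) w)%E).
    rewrite /chaos_mass -(ge0_integral_sum leb2 measurableT).
    - apply: ge0_le_integral => //.
      + by move=> y _; rewrite lee_fin mulr_ge0 ?chaos_ge0.
      + by apply/measurable_EFinP; exact: measurable_fun_pair2 w (measurable_chaos_indic mS).
      + apply: emeasurable_sum => i.
        by apply/measurable_EFinP; exact: measurable_fun_pair2 w (measurable_chaos_indic (mAx x i)).
      move=> y _; have t0 i : (0 <= (\1_(A x i) y * chaos y w)%:E)%E.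
        by rewrite lee_fin mulr_ge0 ?chaos_ge0.
      rewrite [in leLHS]indicE; have [|_] := boolP (y \in S); last first.
        by rewrite mul0r sume_ge0.
      rewrite inE => Sy; have [i iI Ai] := cover x y Sx Sy.
      by rewrite (bigD1 (Ordinal iI))//= indicE mem_set// leeDl// sume_ge0.
    - by move=> i; apply/measurable_EFinP; exact: measurable_fun_pair2 w (measurable_chaos_indic (mAx x i)).
    - by move=> i y _; rewrite lee_fin mulr_ge0 ?chaos_ge0.
  apply: (@le_trans _ _ (\sum_(i < I.+1) (expR (eta * ln (rh i)))%:E)%E).
    by apply: lee_sum => i _; exact: hle.
  rewrite sumEFin lee_fin.
  under eq_bigr => i _ do rewrite lnrh mulrBr expRD mulrCA -mulrN -/q expRM_natl -/q.
  by rewrite -mulr_sumr mulrC ler_wpM2r ?expR_ge0// geom.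
have step x : (\int[P]_w (\1_S x * (chaos x w * \1_B w))%:E <=
    (Lam * (chain_constant * expR (2 * eta * ln r)))%:E * (\1_S x)%:E)%E.
  rewrite [\1_S x]indicE; have [|_] := boolP (x \in S); last first.
    by rewrite mule0 integral0_eq// => w _; rewrite mul0r.
  rewrite inE mule1 => Sx.
  apply: (@le_trans _ _ (\int[P]_w \sum_(i < I.+1) (chaos x w * \1_(Bi x i) w)%:E)%E).
    apply: (ge0_le_integral P measurableT).
    - by move=> w _; rewrite lee_fin mul1r mulr_ge0 ?chaos_ge0.
    - apply/measurable_EFinP; under eq_fun do rewrite mul1r.
      by apply: measurable_funM (measurable_fun_pair1 x measurable_chaos) (measurable_indic mB).
    - apply: emeasurable_sum => i; apply/measurable_EFinP.
      exact: measurable_funM (measurable_fun_pair1 x measurable_chaos) (measurable_indic (mBi x i)).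
    move=> w _; have t0 i : (0 <= (chaos x w * \1_(Bi x i) w)%:E)%E.
      by rewrite lee_fin mulr_ge0 ?chaos_ge0.
    rewrite mul1r [in leLHS]indicE; have [|_] := boolP (w \in B); last first.
      by rewrite mulr0 sume_ge0.
    rewrite inE => Bw; have [i iI Biw] := BBi x w Sx Bw.
    by rewrite (bigD1 (Ordinal iI))//= indicE mem_set// leeDl// sume_ge0.
  rewrite (ge0_integral_sum P measurableT); last 2 first.
  - move=> i; apply/measurable_EFinP.
    exact: measurable_funM (measurable_fun_pair1 x measurable_chaos) (measurable_indic (mBi x i)).
  - by move=> i w _; rewrite lee_fin mulr_ge0 ?chaos_ge0.
  apply: (@le_trans _ _ (\sum_(i < I.+1) (chain_constant * expR (2 * eta * ln (rh i)))%:E)%E).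
    apply: lee_sum => i _; apply: chaos_tail_one_scale => //.
    - by rewrite rh0 rh1.
    - by apply: rhl; rewrite -ltnS.
    - by apply: KA; rewrite -ltnS.
  rewrite sumEFin lee_fin -mulr_sumr [leRHS]mulrCA ler_wpM2l//.
  apply: (@le_trans _ _ (\sum_(i < I.+1) expR (2 * eta * ln r) * q ^+ i)).
    apply: ler_sum => i _.
    rewrite lnrh mulrBr expRD ler_wpM2l ?expR_ge0// -expRM_natl ler_expR.
    have : 0 <= i%:R * (eta * ln 2) by apply: mulr_ge0 => //; exact: mulr_ge0 (ltW growth_exponent_gt0) (ltW ln2).
    lra.
  by rewrite -mulr_sumr mulrC ler_wpM2r ?expR_ge0// geom.
have sP : sigma_finite setT P := sigma_finiteT P.
pose F3 (z : Om * bplane R) := \1_S z.2 * (chaos z.2 z.1 * \1_B z.1).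
have mF3 : measurable_fun setT F3.
  apply: measurable_funM.
    exact: (measurableT_comp (measurable_indic mS) (@measurable_snd _ _ _ _)).
  apply: measurable_funM; first exact: measurable_chaos.
  exact: (measurableT_comp (measurable_indic mB) (@measurable_fst _ _ _ _)).
have F30 z : 0 <= F3 z by rewrite !mulr_ge0 ?chaos_ge0.
(* Both sides of the integral of [F3], the mass of [S] on the event [B]: from below the mass exceeds
   the threshold on [B], from above [step] is integrated over [S], of area at most r^2. *)
have main : ((Lam * expR (eta * ln r))%:E * P B <=
    (Lam * (chain_constant * expR (2 * eta * ln r)))%:E * (r ^+ 2)%:E)%E.
  apply: (@le_trans _ _ (\int[P]_w \int[leb2]_x (F3 (w, x))%:E)%E).
    rewrite -[B]setIT -integral_indic// -ge0_integralZl//; last 2 first.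
    - by apply/measurable_EFinP; exact: measurable_indic.
    - by rewrite lee_fin mulr_ge0 ?expR_ge0// ltW.
    apply: (ge0_le_integral P measurableT).
    - by move=> w _; rewrite -EFinM lee_fin !mulr_ge0 ?expR_ge0// ltW.
    - by apply/measurable_EFinP; apply: measurable_funM => //; exact: measurable_indic.
    - apply: (sf_measurable_tonelli sigma_finite_leb2 (f := fun z => (F3 z)%:E)).
        exact/measurable_EFinP.
      by move=> z; rewrite lee_fin.
    move=> w _; rewrite indicE; have [|_] := boolP (w \in B); last first.
      by rewrite mule0 integral_ge0// => x _; rewrite lee_fin.
    rewrite inE mule1 => Bw; have B1 : \1_B w = 1 :> R by rewrite indicE mem_set.
    rewrite ltW//; apply: lt_le_trans Bw _.
    rewrite le_eqVlt; apply/orP; left; apply/eqP; apply: eq_integral => x _.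
    by rewrite /F3/= B1 mulr1.
  rewrite (sf_tonelli sP sigma_finite_leb2 (f := fun z => (F3 z)%:E)); last 2 first.
  - exact/measurable_EFinP.
  - by move=> z; rewrite lee_fin.
  have D0 : (0 <= (Lam * (chain_constant * expR (2 * eta * ln r)))%:E :> \bar R)%E.
    by rewrite lee_fin !mulr_ge0 ?expR_ge0// ltW.
  apply: le_trans (lee_wpmul2l D0 leS).
  rewrite -[S in leRHS]setIT -integral_indic// -ge0_integralZl//; last first.
    by apply/measurable_EFinP; exact: measurable_indic.
  apply: (ge0_le_integral leb2 measurableT).
  - by move=> x _; apply: integral_ge0 => w _; rewrite lee_fin.
  - apply: (sf_measurable_tonelli sP (f := fun z : bplane R * Om => (F3 (z.2, z.1))%:E)).
      by apply/measurable_EFinP; exact: (measurableT_comp mF3 (@measurable_swap _ _ _ _)).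
    by move=> z; rewrite lee_fin.
  - by apply/measurable_EFinP; apply: measurable_funM => //; exact: measurable_indic.
  - by move=> x _; exact: step.
have PB : P B \is a fin_num by exact: fin_num_measure.
move: main; rewrite -(fineK PB) -!EFinM !lee_fin.
rewrite -[leLHS]mulrA -[leRHS]mulrA ler_pM2l// => h.
rewrite -(ler_pM2l (expR_gt0 (eta * ln r))); apply: le_trans h _.
have -> : r ^+ 2 = expR (2 * ln r) by rewrite expRM_natl lnK.
rewrite -[leLHS]mulrA [leRHS]mulrCA ler_wpM2l// -!expRD ler_expR; lra.
Qed.

End Chain.

End LogCorrelated.

(** * Growth of the Liouville measure *)

Section Density.
Context d (T : measurableType d) (R : realType) (mu : {measure set T -> \bar R}).

Definition density_copy (f : T -> \bar R) of measurable_fun setT f & (forall x, (0 <= f x)%E) :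
  set T -> \bar R := fun A => (\int[mu]_(x in A) f x)%E.

Section Copy.
Variable f : T -> \bar R.
Hypotheses (mf : measurable_fun setT f) (f0 : forall x, (0 <= f x)%E).
Local Notation cp := (density_copy mf f0).
Let cp0 : cp set0 = 0%E. Proof. exact: integral_set0. Qed.
Let cp_ge0 A : (0 <= cp A)%E. Proof. exact: integral_ge0. Qed.
Let cp_sigma : semi_sigma_additive cp.
Proof. exact: semi_sigma_additive_nng_induced. Qed.
HB.instance Definition _ := isMeasure.Build _ _ _ cp cp0 cp_ge0 cp_sigma.
End Copy.

(** [liouville_approx] is a bare set function; presenting it as a measure gives access to the
    monotonicity of its integral. *)
Lemma density_measure (f : T -> \bar R) : measurable_fun setT f -> (forall x, (0 <= f x)%E) ->
  exists nu : {measure set T -> \bar R}, forall A, nu A = (\int[mu]_(x in A) f x)%E.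
Proof. by move=> mf f0; exists (density_copy mf f0). Qed.

End Density.

(* Borel-Cantelli for the events [liminf_n G j n], whose probabilities are bounded
   by Fatou's lemma. *)
Lemma ae_infinitely_often_notin d (T : measurableType d) (R : realType) (P : probability T R)
    (G : nat -> nat -> set T) (a q : R) : 0 <= a -> 0 < q < 1 ->
  (forall j n, measurable (G j n)) ->
  (forall j, \forall n \near \oo, (P (G j n) <= (a * q ^+ j)%:E)%E) ->
  {ae P, forall w, exists J, forall j, (J <= j)%N -> forall N,
    exists2 n, (N <= n)%N & ~ G j n w}.
Proof.
move=> a0 /andP[q0 q1] mG hG.
pose I j N := \bigcap_(n in [set n | (N <= n)%N]) G j n.
pose F j := \bigcup_N I j N.
have mI j N : measurable (I j N) by apply: bigcap_measurable => //; exists N => /=.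
have mF j : measurable (F j) by exact: bigcup_measurable.
have PF j : (P (F j) <= (a * q ^+ j)%:E)%E.
  have cvI : (P \o I j) @ \oo --> P (F j).
    apply: (nondecreasing_cvg_mu (mI j) (mF j)) => n1 n2 n12.
    by apply/subsetPset => w h n /= n2n; apply: h => /=; exact: leq_trans n2n.
  apply: cvge_le cvI.
  have [N _ hN] := hG j; near=> n.
  apply: (@le_trans _ _ (P (G j (maxn n N)))); last by apply: hN; exact: leq_maxr.
  apply: le_measure; rewrite ?inE// => w; apply; exact: leq_maxl.
exists (lim_sup_set F); split.
- by apply: bigcap_measurable => // k _; exact: bigcup_measurable.
- apply: lim_sup_set_cvg0 => //.
  apply: (@le_lt_trans _ _ (a * (1 - q)^-1)%:E); last exact: ltry.
  apply: lime_le; first exact: is_cvg_nneseries.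
  apply: nearW => n; apply: (@le_trans _ _ (\sum_(0 <= j < n) (a * q ^+ j)%:E)%E).
    by apply: lee_sum => j _; exact: PF.
  rewrite sumEFin lee_fin.
  by apply: (geometric_le_lim n a0 q0); rewrite gtr0_norm.
- move=> w /= nh J _; apply: contrapT => h; apply: nh; exists J => j Jj N.
  apply: contrapT => h2; apply: h; exists j => //; exists N => // n /= Nn.
  by apply: contrapT => nG; apply: h2; exists n.
Unshelve. all: by end_near. Qed.

Section Tent.
Context {R : realType}.

(** A continuous function between the indicators of the squares of half-sides r and 2 r, since the
    cut-off measures converge only against [C0] functions; balls of the sup norm are squares. *)
Definition tent (x : plane R) (r : R) (z : plane R) : R :=
  Num.max 0 (Num.min 1 (2 - `|z - x| / r)).

Lemma tent_ge0 x r z : 0 <= tent x r z.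
Proof. by rewrite /tent le_max lexx. Qed.

Lemma tent_le1 x r z : tent x r z <= 1.
Proof. by rewrite /tent ge_max ler01 ge_min lexx. Qed.

Lemma plane_norm_cbox (x z : plane R) r : (`|z - x| <= r) <-> cbox x r z.
Proof.
rewrite prod_normE ge_max cboxP /= [`|x.1 - _|]distrC [`|x.2 - _|]distrC.
by split=> [/andP[]//|[-> ->]].
Qed.

Lemma tent_eq1 x r z : 0 < r -> cbox x r z -> tent x r z = 1.
Proof.
move=> r0 /plane_norm_cbox h; rewrite /tent min_l.
  by rewrite max_r.
have : `|z - x| / r <= 1 by rewrite ler_pdivrMr// mul1r.
lra.
Qed.

Lemma tent_eq0 x r z : 0 < r -> ~ cbox x (2 * r) z -> tent x r z = 0.
Proof.
move=> r0 h; rewrite /tent max_l// ge_min; apply/orP; right.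
rewrite subr_le0 ler_pdivlMr//; apply/ltW; rewrite ltNge; apply/negP.
by move/plane_norm_cbox.
Qed.

Lemma continuous_tent x r : continuous (tent x r).
Proof.
move=> z; pose u (z : plane R) : R := 2 - `|z - x| / r.
have cu : {for z, continuous (u : plane R -> R^o)}.
  apply: cvgB; first exact: cvg_cst.
  apply: cvgM; last exact: cvg_cst.
  apply: (continuous_comp (f := fun z : plane R => z - x)); last exact: norm_continuous.
  by apply: cvgB; [exact: cvg_id|exact: cvg_cst].
have c1 : {for z, continuous ((fun=> 1) : plane R -> R^o)} by exact: cvg_cst.
have c0 : {for z, continuous ((fun=> 0) : plane R -> R^o)} by exact: cvg_cst.
exact: (continuous_max c0 (continuous_min c1 cu)).
Qed.

Lemma C0_tent x r : 0 < r -> C0 (tent x r).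
Proof.
move=> r0; split; first exact: continuous_tent.
apply: (@supp_in_compactly _ (`|x| + 2 * r)) => z h; apply: tent_eq0 => //.
apply: contra_not h => /plane_norm_cbox h.
have : `|z| <= `|x| + 2 * r.
  by rewrite -[z](subrK x) (le_trans (ler_normD _ _))// addrC lerD2l.
rewrite [X in X <= _]prod_normE ge_max => /andP[h1 h2].
by rewrite /box /= !in_itv/= -!ler_norml.
Qed.

End Tent.

(** Borel-Cantelli bounds the masses only for infinitely many n; as convergence is given, this is
    enough for the limit. *)
Lemma frequently_cvge_le (R : realType) (u : nat -> \bar R) (l b : \bar R) :
  u n @[n --> \oo] --> l -> (forall N, exists2 n, (N <= n)%N & (u n <= b)%E) -> (l <= b)%E.
Proof.
move=> ul ub; rewrite leNgt; apply/negP => bl.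
have [N _ hN] := ul _ (open_ereal_gt' bl).
have [n Nn] := ub N; rewrite leNgt => /negP; apply; exact: hN.
Qed.

Section Grid.
Context {R : realType}.

(** A grid of mesh 2^-j / 8 on the box of half-side k + 1, one unit larger than the box to be
    covered because centres of small squares meeting it may lie outside. *)
Definition grid_point (k j a b : nat) : plane R :=
  (- k.+1%:R + a%:R * (2^-1 ^+ j / 8), - k.+1%:R + b%:R * (2^-1 ^+ j / 8)).

Definition grid_size (k j : nat) : nat := (16 * k.+1 * 2 ^ j).+1.

(** With h_j = 2^-j / 8 and j the least index with h_(j+1) < r, a square of half-side r <= h_j
    meeting the box lies in the square of half-side 2 h_j = 2^-j / 4 around the grid point at the
    lower corner of its centre's cell, and 2^-j = 16 h_(j+1) < 16 r explains the 16. Radii above h_J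
    are covered by the mass of the whole box. *)
Lemma grid_growth (mu : {measure set (bplane R) -> \bar R}) (k J : nat) (C eta : R) :
  radon mu -> 0 < eta <= 2 -> 0 <= C ->
  (forall j a b, (J <= j)%N -> (a < grid_size k j)%N -> (b < grid_size k j)%N ->
    (mu (cbox (grid_point k j a b) (2^-1 ^+ j / 4)) <= (C * (2^-1 ^+ j) `^ eta)%:E)%E) ->
  exists C' al : R, [/\ 0 <= C', 0 < al <= 2 &
    forall x r, 0 < r <= 1 -> (mu (cbox x r `&` box k%:R) <= (C' * r `^ al)%:E)%E].
Proof.
move=> rmu eta02 C0 hmu; have /andP[eta0 eta2] := eta02.
have muk : (mu (box k%:R) < +oo)%E by apply: rmu; exact: compact_box.
have [M M0 hM] : exists2 M, 0 <= M & (mu (box k%:R) <= M%:E)%E.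
  exists (fine (mu (box k%:R))); first exact: fine_ge0.
  by rewrite fineK// ge0_fin_numE.
pose h j : R := 2^-1 ^+ j / 8.
have h0 j : 0 < h j by rewrite divr_gt0// exprn_gt0// invr_gt0.
have hS j : h j.+1 = h j / 2 by rewrite /h exprSr; field.
have hmono i j : (i <= j)%N -> h j <= h i.
  by move=> ij; rewrite ler_wpM2r ?invr_ge0// ler_wiXn2l ?invr_ge0// invf_le1// ler1n.
exists (M * h J `^ (- eta) + C * 16 `^ eta), eta; split => //.
  by rewrite addr_ge0// mulr_ge0// powR_ge0.
move=> x r /andP[r0 r1].
have rp : 0 <= r `^ eta := powR_ge0 _ _.
have [rJ|rJ] := ltP (h J) r.
  apply: (@le_trans _ _ M%:E).
    apply: le_trans hM; apply: le_measure; rewrite ?inE//.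
    - by apply: measurableI; [exact: measurable_cbox|exact: measurable_box].
    - exact: measurable_box.
  rewrite lee_fin mulrDl -[leLHS]addr0 lerD//; last by rewrite !mulr_ge0 ?powR_ge0.
  rewrite -mulrA ler_peMr//.
  rewrite powRN mulrC ler_pdivlMr ?powR_gt0// mul1r.
  by apply: ge0_ler_powR; rewrite ?nnegrE ltW.
have ex : exists j, h j.+1 < r.
  exists (Num.truncn r^-1); rewrite /h (@le_lt_trans _ _ (2^-1 ^+ (Num.truncn r^-1).+1))//.
    by rewrite ler_pdivrMr// ler_peMr ?ler1n// exprn_ge0// invr_ge0.
  rewrite exprVn -[ltRHS]invrK ltf_pV2 ?posrE ?exprn_gt0 ?invr_gt0//.
  apply: lt_trans (truncnS_gt _) _.
  by rewrite -natrX ltr_nat ltn_expl.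
have [j hj jmin] := ex_minnP ex.
have rj : r <= h j.
  case: j hj jmin => [_ _|j hj jmin]; first by apply: le_trans rJ _; exact: hmono.
  by rewrite leNgt; apply/negP => /jmin; rewrite ltnn.
have Jj : (J <= j)%N.
  rewrite -ltnS ltnNge; apply/negP => /hmono; rewrite leNgt => /negP; apply.
  exact: lt_le_trans hj rJ.
have [[y [/cboxP[xy1 xy2] yk]]|ny] := pselect (exists y, (cbox x r `&` box k%:R) y); last first.
  rewrite (_ : _ `&` _ = set0) ?measure0; last by apply/seteqP; split => // y hy; exfalso; apply: ny; exists y.
  by rewrite lee_fin mulr_ge0// addr_ge0// mulr_ge0// powR_ge0.
have index (u v : R) : `|u - v| <= r -> - k%:R <= v <= k%:R ->
    exists2 a, (a < grid_size k j)%N & 0 <= u - (- k.+1%:R + a%:R * h j) <= h j.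
  move=> /ler_normlP[u1 u2] /andP[v1 v2]; have k1 : k.+1%:R = k%:R + 1 :> R by rewrite -natr1.
  have p0 : 0 <= (u + k.+1%:R) / h j by rewrite divr_ge0 ?(ltW (h0 j))// k1; lra.
  have /andP[t1 t2] := truncn_itv p0.
  set T := Num.truncn _ in t1 t2.
  move: t1 t2; rewrite ler_pdivlMr// ltr_pdivrMr// -[T.+1%:R]natr1 mulrDl mul1r => t1 t2.
  exists T.
    rewrite /grid_size ltnS -(ler_nat R).
    rewrite -(ler_pM2r (h0 j)); apply: le_trans t1 _.
    have -> : (16 * k.+1 * 2 ^ j)%:R * h j = 2 * k.+1%:R :> R.
      by rewrite !natrM natrX /h exprVn; field; rewrite expf_neq0.
    rewrite k1; lra.
  by apply/andP; split; lra.
move: yk; rewrite /box /= !in_itv/= => -[y1 y2].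
have [a aN /andP[a1 a2]] := index _ _ xy1 y1.
have [b bN /andP[b1 b2]] := index _ _ xy2 y2.
have hm := hmu j a b Jj aN bN.
apply: le_trans (_ : _ <= mu (cbox (grid_point k j a b) (2^-1 ^+ j / 4)))%E _.
  apply: le_measure; rewrite ?inE.
  - by apply: measurableI; [exact: measurable_cbox|exact: measurable_box].
  - exact: measurable_cbox.
  move=> z [/cboxP[z1 z2] _]; apply/cboxP; rewrite /grid_point /= -/(h j).
  have -> : 2^-1 ^+ j / 4 = h j + h j by rewrite /h; field.
  move/ler_normlP: z1 => [z11 z12]; move/ler_normlP: z2 => [z21 z22].
  by clear -rj z11 z12 z21 z22 a1 a2 b1 b2; split; apply/ler_normlP; split; lra.
apply: le_trans hm _; rewrite lee_fin mulrDl -[leLHS]add0r lerD//.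
  by rewrite !mulr_ge0// powR_ge0.
rewrite -mulrA ler_wpM2l// -powRM// ?(ltW r0)//.
apply: ge0_ler_powR; rewrite ?nnegrE ?(ltW eta0)// ?exprn_ge0 ?invr_ge0//.
  by rewrite mulr_ge0// ltW.
by move: hj; rewrite hS /h; lra.
Qed.

End Grid.

Section LiouvilleGrowth.
Context {R : realType} {d : measure_display} {Om : measurableType d}.
Context (P : probability Om R) (m gamma : R) (c : nat -> R) (Y : nat -> plane R -> Om -> R).
Hypotheses (m0 : 0 < m) (gamma02 : 0 < gamma < 2).
Hypotheses (c0 : c 0%N = 1) (cS : forall k, c k < c k.+1) (cub : ~ has_ubound (range c)).
Hypothesis gff : massive_gff_fields P m c Y.

(* The fields are continuous only almost surely; killing them on a null event makes
   them jointly measurable. *)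
Lemma continuous_modification : exists X : nat -> plane R -> Om -> R,
  [/\ forall n, measurable_fun setT (fun z : bplane R * Om => X n z.1 z.2),
      {ae P, forall w, forall n z, X n z w = partial_field Y n z w} &
      forall n N (z : 'I_N -> plane R) (a : 'I_N -> R),
        (\int[P]_w (expR (\sum_(i < N) a i * X n (z i) w))%:E =
         (expR (2^-1 * \sum_(i < N) \sum_(j < N) a i * a j * Xcov m c n (z i) (z j)))%:E)%E].
Proof.
have := ae_foralln (Y_continuous gff) => -[Z [mZ PZ hZ]].
have cY w k : ~ Z w -> continuous (fun z => Y k z w).
  by move=> nZ; apply: contrapT => nc; apply: nZ; apply: hZ => /(_ k).
pose X n z w := partial_field Y n z w * \1_(~` Z) w.
have Xout n z w : ~ Z w -> X n z w = partial_field Y n z w.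
  by move=> nZ; rewrite /X indicE mem_set// mulr1.
have mX n z : measurable_fun setT (X n z).
  apply: measurable_funM; first exact: (measurable_partial_field gff).
  by apply: measurable_indic; exact: measurableC.
have cX n w : continuous (fun z => X n z w).
  move=> z; have [Zw|nZ] := pselect (Z w).
    rewrite (_ : (fun z => _) = fun=> 0); first exact: cvg_cst.
    by apply/funext => y; rewrite /X indicE memNset ?mulr0//; exact.
  apply: cvgM; last exact: cvg_cst.
  by apply: cvg_big => [|k _]; [exact: add_continuous|exact: cY].
have aeX : {ae P, forall w, forall n z, X n z w = partial_field Y n z w}.
  by exists Z; split => // w /=; apply: contra_notP => nZ n z; exact: Xout.
exists X; split => //.
- by move=> n; apply: measurable_caratheodory.
- move=> n N z a; rewrite -(partial_field_mgf gff); apply: ae_eq_integral => //.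
  + apply/measurable_EFinP; apply: measurableT_comp => //.
    by apply: measurable_sum => i; apply: measurable_funM.
  + apply/measurable_EFinP; apply: measurableT_comp => //; apply: measurable_sum => i.
    by apply: measurable_funM => //; exact: (measurable_partial_field gff).
  + apply: filterS aeX => w h _; congr (expR _)%:E.
    by apply: eq_bigr => i _; rewrite h.
Qed.

Let eta := growth_exponent gamma.
Let C1 : R := 2^-1 * ln ((8 + m ^+ 2) / m ^+ 2).

Let C10 : 0 <= C1.
Proof.
rewrite mulr_ge0// ln_ge0// ler_pdivlMr ?exprn_gt0// mul1r lerDr//.
Qed.

Let c_large (b : R) : \forall n \near \oo, b <= c n.
Proof.
have [n hn] : exists n, b < c n.
  apply: contrapT => h; apply: cub; exists b => _ [n _ <-].
  by rewrite leNgt; apply/negP => hb; apply: h; exists n.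
have cmono : {homo c : i j / (i <= j)%N >-> i <= j}.
  by apply: homo_leq => // [x y z|k]; [exact: le_trans|exact: ltW].
by exists n => // i /= ni; exact: le_trans (ltW hn) (cmono _ _ ni).
Qed.

Lemma liouville_growth (M : Om -> {measure set (bplane R) -> \bar R}) :
  liouville_measure P gamma Y M ->
  {ae P, forall w, radon (M w) /\ forall k : nat, exists C al : R, [/\ 0 <= C, 0 < al <= 2 &
    forall x r, 0 < r <= 1 -> (M w (cbox x r `&` box k%:R) <= (C * r `^ al)%:E)%E]}.
Proof.
move=> hM; have [X [mX aeX mgfX]] := continuous_modification.
have eta0 : 0 < eta by exact: growth_exponent_gt0.
have eta2 : eta <= 2 by exact: growth_exponent_le2.
pose mass n := chaos_mass (X n) (ln (c n)) gamma.
have mmass n A : measurable A -> measurable_fun setT (mass n A).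
  by apply: measurable_chaos_mass; exact: mX.
have lam0 := chain_factor_gt0 gamma02.
pose r j : R := 2^-1 ^+ j.
have r0 j : 0 < r j by rewrite exprn_gt0// invr_gt0.
have r1 j : r j <= 1 by rewrite exprn_ile1// ?invr_ge0// invf_le1// ler1n.
(* Both grid coordinates are encoded in one index. The half-side is twice that of [grid_growth],
   which leaves room for the tent function between the two squares. *)
pose S k j i := cbox (grid_point k j (i %/ grid_size k j) (i %% grid_size k j) : plane R) (r j / 2).
have mS k j i : measurable (S k j i : set (bplane R)) by exact: measurable_cbox.
pose E k j n i := [set w | ((chain_factor gamma * expR (eta * ln (r j)))%:E < mass n (S k j i) w)%E].
have mE k j n i : measurable (E k j n i).
  by rewrite -[X in measurable X]setTI; apply: measurable_lte => //; exact: mmass.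
pose G k j n := \big[setU/set0]_(i < grid_size k j * grid_size k j) E k j n i.
have mG k j n : measurable (G k j n) by exact: bigsetU_measurable.
pose q := expR (- (eta * ln 2)).
have ln20 : 0 < ln 2 :> R by rewrite ln_gt0// ltr1n.
have q01 : 0 < q < 1 by rewrite expR_gt0 expR_lt1 oppr_lt0 mulr_gt0.
have lnr j : ln (r j) = - (j%:R * ln 2).
  by rewrite lnXn ?invr_gt0// lnV ?posrE// mulNrn mulr_natl.
pose cc := chain_constant m C1 gamma.
have cc0 : 0 <= cc := chain_constant_ge0 m C1 gamma.
have PE k j n i : (r j)^-1 <= c n ->
    (P (E k j n i) <= (cc * expR ((2 + eta) * ln (r j)))%:E)%E.
  move=> hn; have cn0 := c_gt0 c0 cS n; have cn1 := c_ge1 c0 cS n.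
  have hS (x : plane R) : S k j i x -> S k j i `<=` cbox x (r j).
    move=> /cboxP[x1 x2] y /cboxP[y1 y2]; apply/cboxP.
    move: x1 x2 y1 y2 => /ler_normlP[? ?] /ler_normlP[? ?] /ler_normlP[? ?] /ler_normlP[? ?].
    by split; apply/ler_normlP; split; lra.
  apply: (chaos_tail (K := Xcov m c n) (mX n) (mgfX n) (ltW m0) C10 (ln_ge0 cn1)) => //.
  - exact: (Xcov_diag m c0 cS).
  - exact: (Xcov_le_ln m c0 cS).
  - exact: (Xcov_le_dist m0 c0 cS).
  - by move=> x y s t s0 hs; rewrite lnK ?posrE//; exact: (Xcov_ge m0 c0 cS).
  - by rewrite r0 r1.
  - by rewrite lnK ?posrE.
  - have r20 : 0 <= r j / 2 by rewrite divr_ge0// ltW.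
    rewrite [leLHS](leb2_cbox _ r20) lee_fin (_ : 4 * (r j / 2) ^+ 2 = r j ^+ 2)//; by field.
have PG k j : \forall n \near \oo,
    (P (G k j n) <= (289 * k.+1%:R ^+ 2 * cc * q ^+ j)%:E)%E.
  (* For a fixed scale the tail estimate holds only once the cut-off [c n] resolves it, hence for
     large n. *)
  have := c_large (r j)^-1; apply: filterS => n hn.
  apply: le_trans (Boole_inequality P (A := E k j n) (fun i _ => mE k j n i)) _.
  apply: (@le_trans _ _ (\sum_(i < grid_size k j * grid_size k j)
      (cc * expR ((2 + eta) * ln (r j)))%:E)%E).
    by apply: lee_sum => i _; exact: PE.
  rewrite sumEFin lee_fin sumr_const card_ord -[leLHS]mulr_natl natrM.
  have -> : expR ((2 + eta) * ln (r j)) = r j ^+ 2 * q ^+ j.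
    rewrite mulrDl expRD expRM_natl lnK ?posrE//; congr (_ * _).
    by rewrite -expRM_natl lnr; congr expR; ring.
  (* The grid has 16 (k + 1) / r_j + 1 points per side, and r_j <= 1 <= k + 1; then 289 is the
     square of 17. *)
  have gs : (grid_size k j)%:R * r j <= 17 * k.+1%:R.
    rewrite /grid_size -natr1 !natrM natrX mulrDl mul1r -[16%:R * _ * _ * _]mulrA /r exprVn.
    rewrite divff ?expf_neq0// -exprVn mulr1; have : 1 <= k.+1%:R :> R by rewrite ler1n.
    by have := r1 j; rewrite /r; lra.
  have gs0 : 0 <= (grid_size k j)%:R * r j by rewrite mulr_ge0// ltW.
  have -> : (grid_size k j)%:R * (grid_size k j)%:R * (cc * (r j ^+ 2 * q ^+ j)) =
    ((grid_size k j)%:R * r j) ^+ 2 * (cc * q ^+ j) by ring.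
  have -> : 289 * k.+1%:R ^+ 2 * cc * q ^+ j = (17 * k.+1%:R) ^+ 2 * (cc * q ^+ j) by ring.
  rewrite ler_wpM2r//; first by rewrite mulr_ge0// exprn_ge0// expR_ge0.
  by rewrite lerXn2r ?nnegrE// mulr_ge0.
have BC : {ae P, forall w, forall k, exists J, forall j, (J <= j)%N -> forall N,
    exists2 n, (N <= n)%N & ~ G k j n w}.
  apply: ae_foralln => k; have A0 : 0 <= 289 * k.+1%:R ^+ 2 * cc.
    by apply: mulr_ge0 cc0; apply: mulr_ge0 (sqr_ge0 _); exact: ler0n.
  exact: ae_infinitely_often_notin A0 q01 (mG k) (PG k).
move: hM; rewrite /liouville_measure => hM.
apply: filterS3 aeX BC hM => w Xw BCw [rw cvw].
split => // k; have [J hJ] := BCw k.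
apply: (@grid_growth R (M w) k J (chain_factor gamma) eta) => //; [by rewrite eta0|exact: ltW|].
move=> j a b Jj aN bN.
set x := grid_point k j a b.
have rj4 : 0 < r j / 4 by rewrite divr_gt0.
have tx := C0_tent x rj4.
have hf := cvw _ tx.
pose T := tent x (r j / 4).
have mT : measurable_fun setT (T : bplane R -> R).
  by apply: continuous_plane_measurable; exact: continuous_tent.
apply: (@le_trans _ _ (\int[M w]_z (T z)%:E)%E).
  rewrite -[X in M w X]setIT -integral_indic//; last exact: measurable_cbox.
  apply: ge0_le_integral => //.
  - by apply/measurable_EFinP; apply: measurable_indic; exact: measurable_cbox.
  - exact/measurable_EFinP.
  move=> z _; rewrite lee_fin indicE; have [|_] := boolP (z \in _); last by rewrite tent_ge0.
  by rewrite inE => /(tent_eq1 rj4); rewrite /T => ->.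
have -> : (2^-1 ^+ j) `^ eta = expR (eta * ln (r j)) by rewrite /powR gt_eqF// r0.
(* For infinitely many n no square of the grid at scale j is heavy, in particular not the one around
   [x]. *)
apply: (frequently_cvge_le hf) => N; have [n Nn nG] := hJ j Jj N; exists n => //.
pose i := (a * grid_size k j + b)%N.
have iN : (i < grid_size k j * grid_size k j)%N.
  rewrite /i (@leq_trans (a.+1 * grid_size k j))//; first by rewrite mulSn addnC ltn_add2r.
  by rewrite leq_mul2r aN orbT.
have nE : ~ E k j n i w.
  apply: contra_not nG => Ew; rewrite /G -(bigcup_mkord _ (E k j n)).
  by exists i.
have Sx : S k j i = cbox x (r j / 2).
  by rewrite /S /i divnMDl// divn_small// addn0 modnMDl modn_small.
move: nE; rewrite /E /= => /negP; rewrite -leNgt Sx; apply: le_trans.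
pose g z := expR (gamma * partial_field Y n z w -
       gamma ^+ 2 / 2 * fine 'E_P[fun w' => (partial_field Y n z w' ^+ 2)%R]%E).
have gE z : g z = chaos (X n) (ln (c n)) gamma z w.
  by rewrite /g /chaos (partial_field_variance gff) /= (Xcov_diag m c0 cS) Xw.
have mg : measurable_fun setT (g : bplane R -> R).
  rewrite (_ : g = fun z => chaos (X n) (ln (c n)) gamma z w); last by apply/funext => z; rewrite gE.
  have mc : measurable_fun setT
      (fun z : Om * bplane R => chaos (X n) (ln (c n)) gamma z.2 z.1).
    by apply: measurable_chaos; exact: mX.
  exact: (measurable_fun_pair2 w mc).
have [nu hnu] := density_measure leb2 (f := fun z => (g z)%:E)
  (proj2 (measurable_EFinP _ _) mg) (fun z => expR_ge0 _).
have -> : liouville_approx P gamma Y n w = nu by apply/funext => A; rewrite hnu.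
apply: (@le_trans _ _ (\int[nu]_z (\1_(cbox x (r j / 2)) z)%:E)%E).
  apply: ge0_le_integral => //.
  - by move=> z _; rewrite lee_fin tent_ge0.
  - exact/measurable_EFinP.
  - by apply/measurable_EFinP; apply: measurable_indic; exact: measurable_cbox.
  move=> z _; rewrite lee_fin indicE; have [_|] := boolP (z \in _); first exact: tent_le1.
  rewrite notin_setE => nz; rewrite tent_eq0//.
  by rewrite (_ : 2 * (r j / 4) = r j / 2)//; field.
rewrite integral_indic//; last exact: measurable_cbox.
rewrite setIT hnu integral_mkcond /mass /chaos_mass.
rewrite le_eqVlt; apply/orP; left; apply/eqP; apply: eq_integral => z _.
rewrite patchE indicE -gE; case: ifPn => _; by rewrite ?mul1r ?mul0r.
Qed.

End LiouvilleGrowth.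

Theorem theorem3p5 (R : realType) (m gamma : R) (c : nat -> R)
    (d : measure_display) (Om : measurableType d) (P : probability Om R)
    (Y : nat -> plane R -> Om -> R)
    (M : Om -> {measure set (bplane R) -> \bar R})
    (d' : measure_display) (W : measurableType d')
    (PB : plane R -> probability W R) (B : R -> W -> plane R) :
  0 < m -> 0 < gamma < 2 ->
  c 0%N = 1 -> increasing_seq c -> ~ has_ubound (range c) ->
  massive_gff_fields P m c Y ->
  liouville_measure P gamma Y M ->
  planar_brownian_motion PB B ->
  {ae P, forall w, smooth_strict PB B (M w)}.
Proof.
move=> m0 gamma02 c0 cI cub gff hM bm.
have cS k : c k < c k.+1 by rewrite ltNge cI ltnn.
have := liouville_growth m0 gamma02 c0 cS cub gff hM.
by apply: filterS => w [rw hw]; exact: smooth_strict_growth bm rw hw.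
Qed.
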